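(* Let $S\in\mathbb{S}^d_m$, $Y\in\mathcal{L}_2(\mathbb{R}^d)$, $\nu:=\mathrm{Law}(Y)$. Assume that the interior of the convex hull of $\operatorname{supp}\nu$ is non-empty and (A4) $h(SY)\ne0$ a.s. for every $h\in\mathcal{H}^j_C$ with index $j\in\{1,\dots,d\}$ and compact set $C\subset\{x\in\mathbb{R}^d:x^j=1,\ S(x,x)\ge0\}$. Then $\nu(\Sigma(P_G))=0$ for every $G\in\mathcal{M}(S)$ with $\mathbb{E}[\psi_G(Y)]<\infty$, and for every optimal set $G$ of the dual problem, $X:=P_G(Y)\mathbf{1}_{\{Y\notin\Sigma(P_G)\}}$ is the unique optimal map and $\mathrm{Law}(X,Y)$ is the unique optimal plan.
   Context: $\mathbb{S}^d_m$: symmetric invertible $d\times d$ real matrices with exactly $m$ positive eigenvalues; $S(x,y):=\langle x,Sy\rangle$. $G\subset\mathbb{R}^d$ is $S$-monotone if $S(x-y,x-y)\ge0$ for $x,y\in G$; maximal if not a strict subset of another $S$-monotone set; $\mathcal{M}(S)$ is the family of maximal $S$-monotone sets. $\psi_G(y):=\sup_{x\in G}(S(x,y)-\frac12S(x,x))$, $P_G(y):=\operatorname{argmax}_{x\in G}(S(x,y)-\frac12S(x,x))$. $\Sigma(P_G):=\{y:P_G(y)\ne\emptyset\text{ and not a single point}\}$. For $x\in\mathbb{R}^d$, $x^{-j}$ is $x$ without its $j$-th coordinate. For $j$ and compact $C$ with $y^j=1$ on $C$, $\mathcal{H}^j_C$ is the family of functions $h(x)=x^j+g_1(x^{-j})-g_2(x^{-j})$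 with $g_1,g_2$ convex on $\mathbb{R}^{d-1}$ of linear growth and $\nabla h(x)\in C$ whenever $g_1,g_2$ are differentiable at $x^{-j}$. $\mathcal{X}(Y):=\{X\in\mathcal{L}_2(\mathbb{R}^d):X\ Y\text{-measurable},\ \mathbb{E}[Y|X]=X\}$; optimal map: maximizer of $\frac12\mathbb{E}[S(X,Y)]$ over $\mathcal{X}(Y)$. $\Gamma(\nu)$: Borel probability measures on $\mathbb{R}^d\times\mathbb{R}^d$ (coordinates $(x,y)$) with finite second moments, second marginal $\nu$, conditional expectation of $y$ given $x$ equal to $x$; optimal plan: maximizer of $\frac12\int S(x,y)d\gamma$ over $\Gamma(\nu)$. Optimal set of the dual problem: minimizer of $\int\psi_H d\nu$ over $H\in\mathcal{M}(S)$. *)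

(* Defs.v *)
From HB Require Import structures.
From mathcomp Require Import all_boot all_order all_algebra.
From mathcomp Require Import all_classical all_reals all_analysis.
From mathcomp Require Import zify.
Import Order.TTheory GRing.Theory Num.Theory.
Import numFieldNormedType.Exports.

Set Implicit Arguments.
Unset Strict Implicit.
Unset Printing Implicit Defensive.

Local Open Scope classical_set_scope.
Local Open Scope ring_scope.

(* Vectors of R^d are row vectors 'rV[R]_d; x^j is x 0 j. *)

Definition Rd (R : realType) (d : nat) := g_sigma_algebraType (@open 'M[R]_(1, d)).

Section Defs.
Variables (R : realType) (d : nat).
Local Notation vec := 'rV[R]_d.

Definition Sform (S : 'M[R]_d) (x y : vec) : R := (x *m S *m y^T) 0 0.

Definition Sapply (S : 'M[R]_d) (y : vec) : vec := (S *m y^T)^T.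

Definition sqnorm (x : vec) : R := \sum_(i < d) x 0 i ^+ 2.

Definition n_pos_eigs (S : 'M[R]_d) (m : nat) : Prop :=
  exists rs : seq R, char_poly S = \prod_(r <- rs) ('X - r%:P) /\
                     count (fun r => 0 < r) rs = m.

Definition in_SSdm (m : nat) (S : 'M[R]_d) : Prop :=
  S^T = S /\ S \in unitmx /\ n_pos_eigs S m.

Definition S_monotone (S : 'M[R]_d) (G : set vec) : Prop :=
  forall x y, G x -> G y -> 0 <= Sform S (x - y) (x - y).

Definition maximal_S_monotone (S : 'M[R]_d) (G : set vec) : Prop :=
  S_monotone S G /\ forall G', S_monotone S G' -> G `<=` G' -> G' = G.

Definition psi (S : 'M[R]_d) (G : set vec) (y : vec) : \bar R :=
  ereal_sup [set (Sform S x y - Sform S x x / 2)%:E | x in G].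

Definition PG (S : 'M[R]_d) (G : set vec) (y : vec) : set vec :=
  [set x | G x /\ forall x', G x' ->
     Sform S x' y - Sform S x' x' / 2 <= Sform S x y - Sform S x x / 2].

Definition Sigma (S : 'M[R]_d) (G : set vec) : set vec :=
  [set y | exists x1 x2, PG S G y x1 /\ PG S G y x2 /\ x1 <> x2].

Definition conv_hull (A : set vec) : set vec :=
  [set x | exists (n : nat) (w : 'I_n -> R) (p : 'I_n -> vec),
     (forall i, 0 <= w i) /\ \sum_(i < n) w i = 1 /\
     (forall i, A (p i)) /\ x = \sum_(i < n) w i *: p i].

Definition lin_growth (n : nat) (g : 'rV[R]_n -> R) : Prop :=
  exists c : R, forall x, `|g x| <= c * (1 + `|x|).

Definition grad (h : vec -> R) (x : vec) : vec :=
  \row_(i < d) ('d h x (delta_mx 0 i : vec)).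

End Defs.

Lemma bump_lt (d : nat) (j : 'I_d) (k : 'I_d.-1) : (bump j k < d)%N.
Proof.
case: d j k => [[]//|n] j k /=.
have := ltn_ord k; have := ltn_ord j; rewrite /bump.
by case: (j <= k)%N => /=; lia.
Qed.

Definition skip_ord (d : nat) (j : 'I_d) (k : 'I_d.-1) : 'I_d :=
  Ordinal (bump_lt j k).

Definition del_coord (R : realType) (d : nat) (j : 'I_d) (x : 'rV[R]_d)
  : 'rV[R]_(d.-1) := \row_(k < d.-1) x 0 (skip_ord j k).

Definition in_Hclass (R : realType) (d : nat) (j : 'I_d) (C : set 'rV[R]_d)
    (h : 'rV[R]_d -> R) : Prop :=
  exists g1 g2 : 'rV[R]_(d.-1) -> R,
    convex_function setT g1 /\ convex_function setT g2 /\
    lin_growth g1 /\ lin_growth g2 /\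
    (forall x, h x = x 0 j + g1 (del_coord j x) - g2 (del_coord j x)) /\
    (forall x, differentiable g1 (del_coord j x) ->
               differentiable g2 (del_coord j x) -> C (grad h x)).

Section Prob.
Variables (R : realType) (d : nat) (dT : measure_display) (T : measurableType dT)
  (P : probability T R).
Local Notation vec := 'rV[R]_d.
Local Open Scope ereal_scope.

Definition supp (Y : T -> Rd R d) : set vec :=
  [set x | forall U : set vec, open U -> U x -> 0 < P (Y @^-1` U)].

Definition A4 (S : 'M[R]_d) (Y : T -> Rd R d) : Prop :=
  forall (j : 'I_d) (C : set vec), compact C ->
    C `<=` [set x : vec | x 0%R j = 1%R /\ (0 <= Sform S x x)%R] ->
    forall h, in_Hclass j C h -> {ae P, forall w, h (Sapply S (Y w)) <> 0%R}.

Definition in_calX (Y X : T -> Rd R d) : Prop :=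
  measurable_fun setT X /\
  (forall A : set (Rd R d), measurable A ->
     exists B : set (Rd R d), measurable B /\ X @^-1` A = Y @^-1` B) /\
  \int[P]_w (sqnorm (X w))%:E < +oo /\
  (forall A : set (Rd R d), measurable A -> forall i : 'I_d,
     \int[P]_(w in X @^-1` A) (Y w 0%R i)%:E = \int[P]_(w in X @^-1` A) (X w 0%R i)%:E).

Definition map_value (S : 'M[R]_d) (Y X : T -> Rd R d) : \bar R :=
  \int[P]_w (Sform S (X w) (Y w) / 2)%:E.

Definition optimal_map (S : 'M[R]_d) (Y X : T -> Rd R d) : Prop :=
  in_calX Y X /\ forall X', in_calX Y X' -> map_value S Y X' <= map_value S Y X.

Definition unique_optimal_map (S : 'M[R]_d) (Y X : T -> Rd R d) : Prop :=
  optimal_map S Y X /\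
  forall X', optimal_map S Y X' -> {ae P, forall w, X' w = X w}.

Definition in_Gamma (Y : T -> Rd R d) (g : probability (Rd R d * Rd R d)%type R) : Prop :=
  \int[g]_z (sqnorm z.1 + sqnorm z.2)%:E < +oo /\
  (forall B : set (Rd R d), measurable B -> g (setT `*` B) = P (Y @^-1` B)) /\
  (forall B : set (Rd R d), measurable B -> forall i : 'I_d,
     \int[g]_(z in B `*` setT) (z.2 0%R i)%:E = \int[g]_(z in B `*` setT) (z.1 0%R i)%:E).

Definition plan_value (S : 'M[R]_d) (g : probability (Rd R d * Rd R d)%type R) : \bar R :=
  \int[g]_z (Sform S z.1 z.2 / 2)%:E.

Definition optimal_plan (S : 'M[R]_d) (Y : T -> Rd R d)
    (g : probability (Rd R d * Rd R d)%type R) : Prop :=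
  in_Gamma Y g /\ forall g', in_Gamma Y g' -> plan_value S g' <= plan_value S g.

Definition unique_optimal_plan (S : 'M[R]_d) (Y : T -> Rd R d)
    (g : probability (Rd R d * Rd R d)%type R) : Prop :=
  optimal_plan S Y g /\
  forall g', optimal_plan S Y g' -> forall A, measurable A -> g' A = g A.

Definition dual_optimal (S : 'M[R]_d) (Y : T -> Rd R d) (G : set vec) : Prop :=
  maximal_S_monotone S G /\
  forall H, maximal_S_monotone S H ->
    \int[P]_w psi S G (Y w) <= \int[P]_w psi S H (Y w).

End Prob.

(* X := P_G(Y) 1_{Y \notin Sigma(P_G)}; outside Sigma, P_G(Y) has at most one
   point, which xget selects (0 if P_G(Y) is empty). *)
Definition Xopt (R : realType) (d : nat) (T : Type) (S : 'M[R]_d)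
    (G : set 'rV[R]_d) (Y : T -> Rd R d) : T -> Rd R d :=
  fun w => if `[< Sigma S G (Y w) >] then 0 else xget 0 (PG S G (Y w)).

(* Main.v *)
Require Import Defs.
From HB Require Import structures.
From mathcomp Require Import all_boot all_order all_algebra.
From mathcomp Require Import all_classical all_reals all_analysis.
From mathcomp Require Import measurable_realfun ring lra.
Import Order.TTheory GRing.Theory Num.Theory.
Import numFieldNormedType.Exports.
Local Open Scope classical_set_scope.
Local Open Scope ring_scope.

(* Write [q x = S(x,x)/2].

   Singular set: if [x1 <> x2] both lie in [P_G(y)], they are separated in some
   coordinate [j] by a rational slab [be < al], so [SY] lies on the set where
   the support functions of two compact pieces of [G] agree; this set is a graph
   over the other coordinates, of a difference of two convex functions whose
   gradient is a normalised difference of points of [G], and (A4) applies.  The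
   points of the domain of [psi_G] having an outer normal [s] with
   [S(s,s) >= 0] lie similarly on two convex graphs for each [j].  Off these null
   sets every maximising sequence in [psi_G(y)] converges to [P_G(y)].

   Weak duality: every [y] has a unique [x] in a maximal [G] such that [y - x]
   is a negative vector (Minty), and [x = pi(y)] is Lipschitz in [y]; hence
   [E psi_G(Y) >= E[S(pi X, Y) - q(pi X)] = E[S(pi X, X) - q(pi X)] >= E q(X)],
   with equality only if [X] belongs to [P_G(Y)] almost surely.

   Strong duality: a convex set contained in the epigraph of [q] and maximal for
   inclusion touches the graph of [q] exactly along a maximal monotone set, so
   every convex [phi >= q] dominates some [psi_H].  Applying this to
   [sup_x (S(x',.) - q(x')) + K eps^2] with [x' = x + eps theta(x)], [x] in [G],
   the optimality of [G] gives [E S(theta(X), Y - X) >= 0] to first order, for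
   all [theta] and [- theta], that is, [E[Y|X] = X]. *)

(** The set of the points [x + eps theta(x)] is not monotone, so its supremum is not a [psi_H];
    adding [K eps^2] lifts it above [q], and an error of second order does not show in the
    derivative. Differentiating under the expectation needs domination, while nothing is known yet
    about the moments of [X]: hence [theta] is taken continuous with [theta(x)] and [|x| theta(x)]
    bounded, which bounds the variation by a multiple of [1 + |Y|]. Truncated coordinates are such
    fields and give [E X_i^2 <= E Y_i^2], so [X] is in [L2]; arbitrary events in [X] are reached
    only afterwards. In weak duality [pi(X)] replaces a subgradient of [psi_G] at [X], whose
    existence and integrability are not given. The maximal convex set serves three times: for
    Minty's theorem, for the finiteness of the dual value, and for a competitor below the perturbed
    supremum. As [S] is indefinite, coercivity comes from an auxiliary positive definite form
    [M]. *)

Section BilinearForm.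
Set Implicit Arguments.
Unset Strict Implicit.
Context {R : realType} {d : nat}.
Implicit Types (A : 'M[R]_d) (x y z : 'rV[R]_d).

Lemma Sform_sum A x y : Sform A x y = \sum_i \sum_j x 0 i * A i j * y 0 j.
Proof.
rewrite /Sform mxE exchange_big /=; apply: eq_bigr => j _.
by rewrite !mxE big_distrl /=; apply: eq_bigr.
Qed.

Lemma SformDl A x y z : Sform A (x + y) z = Sform A x z + Sform A y z.
Proof. by rewrite /Sform !mulmxDl mxE. Qed.
Lemma SformDr A x y z : Sform A x (y + z) = Sform A x y + Sform A x z.
Proof. by rewrite /Sform linearD /= mulmxDr mxE. Qed.
Lemma SformNl A x z : Sform A (- x) z = - Sform A x z.
Proof. by rewrite /Sform !mulNmx mxE. Qed.
Lemma SformNr A x z : Sform A x (- z) = - Sform A x z.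
Proof. by rewrite /Sform linearN /= mulmxN mxE. Qed.
Lemma SformZl A a x z : Sform A (a *: x) z = a * Sform A x z.
Proof. by rewrite /Sform -!scalemxAl mxE. Qed.
Lemma SformZr A a x z : Sform A x (a *: z) = a * Sform A x z.
Proof. by rewrite /Sform linearZ /= -scalemxAr mxE. Qed.
Lemma Sform0l A z : Sform A 0 z = 0.
Proof. by rewrite /Sform !mul0mx mxE. Qed.
Lemma Sform0r A z : Sform A z 0 = 0.
Proof. by rewrite /Sform trmx0 mulmx0 mxE. Qed.
Definition SformE := (SformDl, SformDr, SformNl, SformNr, SformZl, SformZr).

Lemma SformC A x y : A^T = A -> Sform A x y = Sform A y x.
Proof.
move=> AT; rewrite /Sform.
have -> : x *m A *m y^T = (y *m A *m x^T)^T by rewrite !trmx_mul trmxK AT mulmxA.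
by rewrite mxE.
Qed.

Lemma norm_coord x i : `|x 0 i| <= `|x|.
Proof.
rewrite [leRHS]/Num.norm/= mx_normE.
exact: (le_bigmax _ (fun ij : 'I_1 * 'I_d => `|x ij.1 ij.2|%:nng) (0, i)).
Qed.

Lemma norm_le x (c : R) : 0 <= c -> (forall i, `|x 0 i| <= c) -> `|x| <= c.
Proof.
move=> c0 xc; rewrite [leLHS]/Num.norm/= mx_normE.
rewrite -[c]/((NngNum c0)%:num) num_le; apply/bigmax_leP; split => //.
by move=> [i j] _ /=; rewrite ord1 -num_le /=.
Qed.

Lemma Sform_bound A : exists2 c : R, 0 < c & forall x y, `|Sform A x y| <= c * `|x| * `|y|.
Proof.
exists (1 + \sum_i \sum_j `|A i j|).
  by rewrite ltr_pwDl// sumr_ge0// => i _; rewrite sumr_ge0.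
move=> x y; rewrite Sform_sum.
apply: (@le_trans _ _ ((\sum_i \sum_j `|A i j|) * `|x| * `|y|)); last first.
  by rewrite !mulrDl mul1r lerDr mulr_ge0.
rewrite !mulr_suml (le_trans (ler_norm_sum _ _ _))// ler_sum// => i _.
rewrite !mulr_suml (le_trans (ler_norm_sum _ _ _))// ler_sum// => j _.
rewrite !normrM; apply: ler_pM; rewrite ?mulr_ge0 ?norm_coord//.
by rewrite mulrC ler_wpM2l ?norm_coord.
Qed.

End BilinearForm.

(** * Diagonalisation of symmetric forms; positive and negative directions *)

Section Sylvester.
Set Implicit Arguments.
Unset Strict Implicit.
Context {R : realType}.

(** Polarisation on [delta_mx 0 i + delta_mx 0 j] recovers the entry [S i j] from the quadratic
    form. *)
Lemma sym_nonisotropic n (S : 'M[R]_n) : S^T = S -> S != 0 ->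
  exists v, Sform S v v != 0.
Proof.
move=> ST S0; apply: contrapT => nv.
have Sv v : Sform S v v = 0.
  by apply/eqP; apply: contrapT => Sv; apply: nv; exists v; apply/negP.
move/eqP: S0; apply; apply/matrixP => i j; rewrite mxE.
have : Sform S (delta_mx 0 i) (delta_mx 0 j) = S i j.
  by rewrite /Sform -rowE trmx_delta -colE !mxE.
have := Sv (delta_mx 0 i + delta_mx 0 j).
rewrite !SformE !Sv (SformC (delta_mx 0 j) _ ST).
lra.
Qed.

(** Orthogonalisation for an indefinite form: a non-isotropic vector gives a non-zero pivot, and the
    Schur complement is again symmetric. *)
Lemma sym_congr_diag n (S : 'M[R]_n) : S^T = S ->
  exists B (D : 'rV_n), B \in unitmx /\ B *m S *m B^T = diag_mx D.
Proof.
elim: n S => [S _|n IH S ST].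
  exists 1%:M, 0; split; first exact: unitmx1.
  by apply/matrixP => -[].
have [->|S0] := eqVneq S 0.
  by exists 1%:M, 0; rewrite unitmx1 mulmx0 mul0mx linear0.
have [v vSv] := sym_nonisotropic ST S0.
have v0 : v != 0 by apply: contra_neq vSv => ->; rewrite Sform0l.
(* [E] is invertible and its first row is proportional to [v], so the pivot of [S1] is non-zero. *)
pose E : 'M[R]_(1 + n) := row_ebase v.
have Eu : E \in unitmx by exact: row_ebase_unit.
pose c := col_ebase v 0 0.
have vE : v = c *: row 0 E.
  have rv : \rank v = 1%N by apply/eqP; rewrite eqn_leq rank_leq_row lt0n mxrank_eq0.
  rewrite -[LHS](mulmx_ebase v) rv [col_ebase v]mx11_scalar -/c mul_scalar_mx.
  rewrite -scalemxAl; congr (_ *: _).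
  rewrite rowE; congr (_ *m _); apply/rowP => j; rewrite !mxE /= andbT.
  by rewrite eq_sym.
pose S1 := E *m S *m E^T.
have S1T : S1^T = S1 by rewrite /S1 !trmx_mul trmxK ST mulmxA.
pose a := S1 0 0.
have a0 : a != 0.
  have : Sform S v v = c ^+ 2 * a.
    rewrite vE SformZl SformZr mulrA -expr2; congr (_ * _).
    rewrite /Sform /a /S1 -row_mul [LHS]mxE [RHS]mxE.
    by apply: eq_bigr => k _; rewrite !mxE.
  by move=> e; apply: contra_neq vSv => a0; rewrite e a0 mulr0.
pose b := ursubmx S1.
have S1E : S1 = block_mx a%:M b b^T (drsubmx S1).
  rewrite -[LHS](submxK S1) /b trmx_ursub S1T.
  congr block_mx; rewrite [LHS]mx11_scalar; congr (_%:M).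
  rewrite /ulsubmx /lsubmx mxE /usubmx mxE -/a; congr (S1 _ _); exact: val_inj.
(* [L] clears the first column; [S2] is the Schur complement of the pivot [a]. *)
pose L : 'M[R]_(1 + n) := block_mx 1%:M 0 (- (a^-1 *: b^T)) 1%:M.
have Lu : L \in unitmx by rewrite unitmxE det_lblock !det1 mulr1 unitr1.
pose S2 := drsubmx S1 - a^-1 *: (b^T *m b).
have LS : L *m S1 *m L^T = block_mx a%:M 0 0 S2.
  rewrite S1E /L tr_block_mx !mulmx_block !trmx1 !trmx0 !mul1mx !mul0mx !mulmx1 !mulmx0.
  rewrite !addr0 !linearN /= !linearZ /= trmxK mul_scalar_mx.
  rewrite !scalerN scalerA mulVf// scale1r addNr !mulNmx -!scalemxAl mul_mx_scalar.
  by rewrite scalerA mulVf// scale1r addNr mul0mx scaler0 oppr0 add0r addrC.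
have S2T : S2^T = S2.
  rewrite /S2 linearB /= linearZ /= trmx_mul trmxK; congr (_ - _).
  by rewrite -[in RHS]S1T trmx_drsub.
have [B [D [Bu BS]]] := IH _ S2T.
pose B1 : 'M[R]_(1 + n) := block_mx 1%:M 0 0 B.
have B1u : B1 \in unitmx by rewrite unitmxE det_lblock det1 mul1r -unitmxE.
exists (B1 *m L *m E), (row_mx a%:M D); split; first by rewrite !unitmx_mul B1u Lu Eu.
have -> : B1 *m L *m E *m S *m (B1 *m L *m E)^T = B1 *m (L *m S1 *m L^T) *m B1^T.
  by rewrite /S1 !trmx_mul !mulmxA.
rewrite LS /B1 tr_block_mx !mulmx_block !trmx1 !trmx0 !mul1mx !mul0mx !mulmx1 !mulmx0.
rewrite !addr0 !add0r BS; apply: etrans (esym (diag_mx_row a%:M D)).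
by congr block_mx; rewrite ?mul0mx//; apply/matrixP => i j; rewrite !ord1 !mxE !eqxx.
Qed.

Lemma sylvester n (S : 'M[R]_n) : S^T = S -> S \in unitmx ->
  exists B (e : 'rV[R]_n), [/\ B \in unitmx, forall k, e 0 k ^+ 2 = 1 &
    S = B *m diag_mx e *m B^T].
Proof.
move=> ST Su; have [B0 [D [Bu BS]]] := sym_congr_diag ST.
have Du k : D 0 k != 0.
  have : diag_mx D \in unitmx by rewrite -BS !unitmx_mul Bu Su unitmx_tr.
  rewrite unitmxE det_diag unitfE => /prodf_neq0/(_ k erefl) //.
pose e := \row_k Num.sg (D 0 k); pose r := \row_k Num.sqrt `|D 0 k|.
exists (invmx B0 *m diag_mx r), e; split.
- rewrite unitmx_mul unitmx_inv Bu unitmxE det_diag unitfE /=.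
  by apply/prodf_neq0 => k _; rewrite mxE sqrtr_eq0 -ltNge normr_gt0.
- by move=> k; rewrite mxE sqr_sg Du.
- rewrite trmx_mul tr_diag_mx !mulmxA -(mulmxA (invmx B0)) -(mulmxA (invmx B0)).
  have -> : diag_mx r *m diag_mx e *m diag_mx r = diag_mx D.
    rewrite !mulmx_diag; congr diag_mx; apply/rowP => k; rewrite !mxE.
    by rewrite mulrAC -expr2 sqr_sqrtr// mulrC -numEsg.
  by rewrite -BS !mulmxA mulVmx// mul1mx -mulmxA -trmx_mul mulVmx// trmx1 mulmx1.
Qed.

(* For [S = B diag(e) B^T] take [M = B B^T] and [J = B diag(e) B^-1]; then
   [(M + S)/2] and [(M - S)/2] are the squared norms of the positive and the
   negative part, and the negative vectors are those with [x J = - x]. *)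
Lemma pseudo_euclidean n (S : 'M[R]_n) : S^T = S -> S \in unitmx ->
  exists M J : 'M[R]_n, [/\ M^T = M,
    forall x y, Sform S (x *m J) y = Sform M x y,
    J *m J = 1%:M,
    forall x, `|Sform S x x| <= Sform M x x &
    exists2 c : R, 0 < c & forall x : 'rV[R]_n, `|x| ^+ 2 <= c * Sform M x x].
Proof.
move=> ST Su; have [B [e [Bu e1 SE]]] := sylvester ST Su.
have de : diag_mx e *m diag_mx e = 1%:M.
  rewrite mulmx_diag -diag_const_mx; congr diag_mx; apply/rowP => k.
  by rewrite !mxE -expr2 e1.
have ME x y : Sform (B *m B^T) x y = \sum_k (x *m B) 0 k * (y *m B) 0 k.
  rewrite /Sform mulmxA -mulmxA -trmx_mul mxE; apply: eq_bigr => k _.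
  by rewrite [X in _ * X]mxE.
have SxE x : Sform S x x = \sum_k e 0 k * (x *m B) 0 k ^+ 2.
  rewrite SE /Sform !mulmxA -(mulmxA _ B^T) -trmx_mul mxE; apply: eq_bigr => k _.
  rewrite [X in _ * X]mxE mul_mx_diag mxE.
  by rewrite expr2 mulrA [e _ _ * _]mulrC.
exists (B *m B^T), (B *m diag_mx e *m invmx B); split.
- by rewrite trmx_mul trmxK.
- move=> x y; rewrite {1}SE /Sform !mulmxA.
  by rewrite (mulmxKV Bu) -(mulmxA (x *m B)) de mulmx1.
- by rewrite !mulmxA (mulmxKV Bu) -(mulmxA B) de mulmx1 mulmxV.
- move=> x; rewrite SxE ME; apply: le_trans (ler_norm_sum _ _ _) _.
  apply: ler_sum => k _; rewrite -expr2 normrM [X in _ * X]ger0_norm ?sqr_ge0//.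
  by rewrite (_ : `|e 0 k| = 1) ?mul1r//; apply/eqP; rewrite -sqrp_eq1// real_normK ?num_real// e1.
- pose C := invmx B; pose c := 1 + \sum_i \sum_j `|C i j|.
  have c0 : 0 < c by rewrite ltr_pwDl// sumr_ge0// => i _; rewrite sumr_ge0.
  exists (c ^+ 2); first by rewrite exprn_gt0.
  move=> x; rewrite ME; set N := \sum_k _.
  have N0 : 0 <= N by apply: sumr_ge0 => k _; rewrite -expr2 sqr_ge0.
  have uN k : `|(x *m B) 0 k| <= Num.sqrt N.
    rewrite -sqrtr_sqr ler_wsqrtr// /N (bigD1 k)//= expr2 lerDl sumr_ge0// => l _.
    by rewrite -expr2 sqr_ge0.
  suff xN : `|x| <= c * Num.sqrt N.
    rewrite -[N in leRHS]sqr_sqrtr// -exprMn ler_sqr ?nnegrE// mulr_ge0 ?sqrtr_ge0 ?ltW//.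
  apply: norm_le; first by rewrite mulr_ge0 ?sqrtr_ge0 ?ltW//.
  move=> i; rewrite -[x in leLHS](mulmxK Bu) mxE.
  apply: le_trans (ler_norm_sum _ _ _) _.
  apply: (@le_trans _ _ (\sum_k (`|C k i| * Num.sqrt N))).
    by apply: ler_sum => k _; rewrite normrM mulrC ler_wpM2l.
  rewrite -mulr_suml ler_wpM2r ?sqrtr_ge0//.
  apply: (@le_trans _ _ (\sum_i \sum_j `|C i j|)); last by rewrite lerDr.
  by apply: ler_sum => k _; rewrite (bigD1 i)//= lerDl sumr_ge0.
Qed.

End Sylvester.

(** * Continuity and compactness in finite dimension *)

Section Continuity.
Context {R : realType} {d : nat}.
Set Implicit Arguments.
Unset Strict Implicit.

Lemma cvg_sum (T I : Type) (F : set_system T) {FF : Filter F} (s : seq I)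
    (f : I -> T -> R) (a : I -> R) : (forall i, f i @ F --> a i) ->
  (fun t => \sum_(i <- s) f i t) @ F --> \sum_(i <- s) a i.
Proof.
move=> fa; elim: s => [|i s IH].
  by under eq_fun do rewrite big_nil; rewrite big_nil; exact: cvg_cst.
by under eq_fun do rewrite big_cons; rewrite big_cons; exact: cvgD.
Qed.

Lemma cvg_Sform (T : Type) (F : set_system T) {FF : Filter F} (A : 'M[R]_d)
    (f g : T -> 'rV[R]_d) (a b : 'rV[R]_d) :
  f @ F --> a -> g @ F --> b ->
  (fun t => Sform A (f t) (g t)) @ F --> Sform A a b.
Proof.
move=> fa gb; rewrite Sform_sum; under eq_fun do rewrite Sform_sum.
have cf i : (fun t => f t 0 i) @ F --> a 0 i.
  exact: (cvg_comp _ _ fa (@coord_continuous _ _ _ 0 i a)).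
have cg i : (fun t => g t 0 i) @ F --> b 0 i.
  exact: (cvg_comp _ _ gb (@coord_continuous _ _ _ 0 i b)).
apply: cvg_sum => i; apply: cvg_sum => j.
by apply: cvgM => //; apply: cvgM => //; exact: cvg_cst.
Qed.

Lemma continuous_Sform (T : topologicalType) (A : 'M[R]_d) (f g : T -> 'rV[R]_d) :
  continuous f -> continuous g -> continuous (fun t => Sform A (f t) (g t)).
Proof. by move=> cf cg x; exact: cvg_Sform (cf x) (cg x). Qed.

Lemma contD (T : topologicalType) (f g : T -> R) :
  continuous f -> continuous g -> continuous (fun x => f x + g x).
Proof. by move=> cf cg x; apply: cvgD; [exact: cf|exact: cg]. Qed.

Lemma contB (T : topologicalType) (f g : T -> R) :
  continuous f -> continuous g -> continuous (fun x => f x - g x).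
Proof. by move=> cf cg x; apply: cvgB; [exact: cf|exact: cg]. Qed.

Lemma cont_subv (T : topologicalType) (V : normedModType R) (f g : T -> V) :
  continuous f -> continuous g -> continuous (fun x => f x - g x).
Proof. by move=> cf cg x; apply: cvgB; [exact: cf|exact: cg]. Qed.

Lemma cont_scalev (T : topologicalType) (V : normedModType R) (f : T -> R) (v : V) :
  continuous f -> continuous (fun x => f x *: v).
Proof. by move=> cf x; apply: cvgZ; [exact: cf|exact: cvg_cst]. Qed.

Lemma contM (T : topologicalType) (f g : T -> R) :
  continuous f -> continuous g -> continuous (fun x => f x * g x).
Proof. by move=> cf cg x; apply: cvgM; [exact: cf|exact: cg]. Qed.

Lemma cont_cst (T : topologicalType) (U : topologicalType) (a : U) :
  continuous (fun _ : T => a).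
Proof. exact: cst_continuous. Qed.

Lemma cont_id (T : topologicalType) : continuous (fun x : T => x).
Proof. by move=> x; exact: cvg_id. Qed.

Lemma closed_le_fun (T : topologicalType) (f g : T -> R) :
  continuous f -> continuous g -> closed [set x | f x <= g x].
Proof.
move=> cf cg; rewrite (_ : mkset _ = (fun x => g x - f x) @^-1` [set y | 0 <= y]).
  apply: closed_comp; last exact: closed_ge.
  by move=> x _; apply: cvgB; [exact: cg|exact: cf].
by apply/seteqP; split => x /=; rewrite subr_ge0.
Qed.

Lemma ge0_first_order (L K : R) :
  (forall t, 0 < t <= 1 -> 0 <= t * L + t ^+ 2 * K) -> 0 <= L.
Proof.
move=> H; rewrite leNgt; apply/negP => L0.
(* This choice gives [t |K| < - L], so the quadratic term cannot compensate a negative [L]. *)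
pose t := - L / (- L + `|K| + 1).
have den : 0 < - L + `|K| + 1 by have := normr_ge0 K; lra.
have t0 : 0 < t by rewrite divr_gt0// oppr_gt0.
have t1 : t <= 1 by rewrite ler_pdivrMr// mul1r; have := normr_ge0 K; lra.
have := H t; rewrite t0 t1 => /(_ isT).
rewrite expr2 -mulrA -mulrDr pmulr_rge0// leNgt => /negP; apply.
have : t * K <= t * `|K| by rewrite ler_wpM2l ?ler_norm// ltW.
have : t * (- L + `|K| + 1) = - L by rewrite /t divfK// gt_eqF.
nra.
Qed.

Lemma closed_bounded_EVT_max (G : set 'rV[R]_d) (f : 'rV[R]_d -> R) (K : R) :
  G !=set0 -> closed G -> (forall x, G x -> `|x| <= K) -> continuous f ->
  exists2 x, G x & forall x', G x' -> f x' <= f x.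
Proof.
move=> G0 cG GK cf.
have kG : compact G.
  apply: bounded_closed_compact => //; exists K; split; first exact: num_real.
  by move=> k Kk x Gx; exact: le_trans (GK _ Gx) (ltW Kk).
have [c /set_mem Gc fc] := compact_EVT_max G0 kG (continuous_subspaceT cf).
by exists c => // x /mem_set; exact: fc.
Qed.

End Continuity.

(** * Maximal convex sets above the graph of [q], and Minty's theorem *)

Section MaximalMonotone.
Context {R : realType} {d : nat}.
Set Implicit Arguments.
Unset Strict Implicit.
Variables (S M J : 'M[R]_d) (c : R).
Hypotheses (ST : S^T = S) (MT : M^T = M)
  (SJ : forall x y, Sform S (x *m J) y = Sform M x y) (JJ : J *m J = 1%:M)
  (SM : forall x, `|Sform S x x| <= Sform M x x)
  (c0 : 0 < c) (Mc : forall x : 'rV[R]_d, `|x| ^+ 2 <= c * Sform M x x).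
Local Notation vec := 'rV[R]_d.
Local Notation q x := (Sform S x x / 2).
Implicit Types (x y v w : vec).

Lemma M_ge0 x : 0 <= Sform M x x.
Proof. exact: le_trans (SM x). Qed.

Lemma M_eq0 x : Sform M x x <= 0 -> x = 0.
Proof.
move=> Mx; apply/eqP; rewrite -normr_eq0 -sqrf_eq0 eq_le sqr_ge0 andbT.
by rewrite (le_trans (Mc x))// pmulr_rle0.
Qed.

Lemma SJr x y : Sform S x (y *m J) = Sform M x y.
Proof. by rewrite SformC// SJ SformC. Qed.

Lemma SJJ x y : Sform S (x *m J) (y *m J) = Sform S x y.
Proof. by rewrite SJ SformC// -SJ -mulmxA JJ mulmx1 SformC. Qed.

Lemma MJ x y : Sform M x (y *m J) = Sform S x y.
Proof. by rewrite -SJ SJJ. Qed.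

Lemma MS_ge0 x : 0 <= Sform M x x + Sform S x x.
Proof. by have := SM x; rewrite ler_norml => /andP[]; lra. Qed.

(** [M (v + v J, v + v J) = 2 (M + S)(v, v)], and [M] is definite. *)
Lemma MS_eq0 v : Sform M v v + Sform S v v <= 0 -> v *m J = - v.
Proof.
move=> H; apply/eqP; rewrite -subr_eq0 opprK; apply/eqP/M_eq0.
have e1 : Sform M (v *m J) (v *m J) = Sform M v v by rewrite MJ SJ.
have e2 : Sform M (v *m J) v = Sform S v v by rewrite SformC// MJ.
by rewrite !SformE e1 e2 MJ; lra.
Qed.

Lemma negative_form v : v *m J = - v -> Sform S v v = - Sform M v v.
Proof. by move=> vJ; rewrite -SJ vJ SformNl opprK. Qed.

(* Only the positive part of [w] contributes. *)
Lemma negative_sub_form v w : v *m J = - v ->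
  Sform S (v - w) (v - w) <= Sform M w w.
Proof.
move=> vJ; have SN : Sform S (v - w) (v - w) <=
    (Sform M (v - w) (v - w) + Sform S (v - w) (v - w)) / 2.
  by have := SM (v - w); rewrite ler_norml => /andP[_]; lra.
have := SM w; rewrite ler_norml => /andP[_ wM].
have vw : Sform M v w = - Sform S v w by rewrite -SJ vJ SformNl.
have vv := negative_form vJ.
move: SN; rewrite !SformE !(SformC w v ST) !(SformC w v MT) vw; lra.
Qed.

(** Convex functions with infinite values are handled through their epigraphs in [vec * R]. *)
Definition cvx_set (E : set (vec * R)) := forall p1 p2 t, E p1 -> E p2 ->
  0 <= t <= 1 -> E ((1 - t) *: p1.1 + t *: p2.1, (1 - t) * p1.2 + t * p2.2).

Definition above_q : set (vec * R) := [set p | q p.1 <= p.2].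

Lemma q_conv x y t : q ((1 - t) *: x + t *: y) =
  (1 - t) ^+ 2 * q x + t * (1 - t) * Sform S x y + t ^+ 2 * q y.
Proof. by rewrite !SformE (SformC y x ST); field. Qed.

Lemma q_sub x y : q (x - y) = q x - Sform S x y + q y.
Proof. by rewrite !SformE (SformC y x ST); field. Qed.

Lemma q_addJ v : q (v + v *m J) = Sform M v v + Sform S v v.
Proof. by rewrite !SformE SJJ SJ SJr; field. Qed.

(** Zorn's lemma, applied to the sets whose union with [E0] is admissible instead of the supersets
    of [E0]: the empty chain, whose union is empty, is then no exception. *)
Lemma exists_maximal_cvx (E0 : set (vec * R)) : cvx_set E0 -> E0 `<=` above_q ->
  exists E, [/\ cvx_set E, E `<=` above_q, E0 `<=` E &
   forall E', cvx_set E' -> E' `<=` above_q -> E `<=` E' -> E' `<=` E].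
Proof.
move=> cE0 qE0.
have [F FF|E [[cE qE] mE]] := @Zorn_bigcup _
    [set E | cvx_set (E0 `|` E) /\ E0 `|` E `<=` above_q].
  move=> totF; have FE X : F X -> cvx_set (E0 `|` X) /\ E0 `|` X `<=` above_q by exact: FF.
  split; last first.
    move=> p [/qE0//|[X FX Xp]]; apply: (FE _ FX).2; by right.
  move=> p1 p2 t p1E p2E t01.
  have sub X : F X -> E0 `|` X `<=` E0 `|` \bigcup_(X in F) X.
    by move=> FX p [?|Xp]; [left|right; exists X].
  case: p1E => [p1E|[X1 FX1 X1p]]; case: p2E => [p2E|[X2 FX2 X2p]].
  - by left; exact: cE0.
  - by apply: (sub _ FX2); apply: (FE _ FX2).1 => //; [left|right].
  - by apply: (sub _ FX1); apply: (FE _ FX1).1 => //; [right|left].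
  - have [X12|X21] := totF _ _ FX1 FX2.
      by apply: (sub _ FX2); apply: (FE _ FX2).1 => //; right => //; exact: X12.
    by apply: (sub _ FX1); apply: (FE _ FX1).1 => //; right => //; exact: X21.
exists (E0 `|` E); split => //.
move=> E' cE' qE' EE'; apply: contrapT => nE.
apply: (mE E'); last by rewrite /= setUidr// => p Ep; apply: EE'; left.
split; first by move=> p Ep; apply: EE'; right.
by move=> E'E; apply: nE => p /E'E; right.
Qed.

Section MaximalCvx.
Variable E : set (vec * R).
Hypotheses (cE : cvx_set E) (qE : E `<=` above_q)
  (mE : forall E', cvx_set E' -> E' `<=` above_q -> E `<=` E' -> E' `<=` E).

Lemma maximal_cvx_neq0 : E !=set0.
Proof.
apply: contrapT => nE; apply: (nE); exists (0, 0).
apply: (mE (E' := [set (0, 0)])) => //.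
- move=> _ _ t -> -> _ /=; rewrite !scaler0 !mulr0 !addr0; by [].
- by move=> _ ->; rewrite /above_q /= Sform0l mul0r.
- by move=> p Ep; exfalso; apply: nE; exists p.
Qed.

(** The union of the segments joining [E] to [p] is convex, contains [E] and stays above [q], so
    maximality puts it into [E]. *)
Lemma maximal_cvx_add (p : vec * R) :
  (forall e t, E e -> 0 <= t <= 1 ->
    q ((1 - t) *: e.1 + t *: p.1) <= (1 - t) * e.2 + t * p.2) -> E p.
Proof.
move=> H; have [e0 Ee0] := maximal_cvx_neq0.
pose E' : set (vec * R) := [set x | exists e t, [/\ E e, 0 <= t <= 1 &
  x = ((1 - t) *: e.1 + t *: p.1, (1 - t) * e.2 + t * p.2)]].
have E'p : E' p.
  exists e0, 1; split => //; first by rewrite ler01 lexx.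
  by rewrite subrr scale0r scale1r mul0r mul1r !add0r; case: (p).
apply: (mE (E' := E')) => //.
- move=> _ _ l [e [t [Ee t01 ->]]] [e' [t' [Ee' t01' ->]]] l01 /=.
  (* [w] is the total weight carried by [E] and [s] the share of [e'] in it; for [w = 0] the
     combination is [p] itself. *)
  pose w := (1 - l) * (1 - t) + l * (1 - t').
  have [w0|w0] := eqVneq w 0.
    have w1 : (1 - l) * (1 - t) = 0 by move: w0; rewrite /w; nra.
    have w2 : l * (1 - t') = 0 by move: w0; rewrite /w; nra.
    have w3 : (1 - l) * t + l * t' = 1 by nra.
    exists e, 1; split => //; first by rewrite ler01 lexx.
    rewrite subrr scale0r scale1r mul0r mul1r !add0r !scalerDr !scalerA.
    rewrite w1 w2 !scale0r !add0r -scalerDl w3 scale1r; congr pair.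
    by rewrite !mulrDr !mulrA w1 w2 !mul0r !add0r -mulrDl w3 mul1r.
  have wp : 0 < w by rewrite lt_neqAle eq_sym w0 /= /w; nra.
  pose s := l * (1 - t') / w.
  have s01 : 0 <= s <= 1.
    rewrite divr_ge0 ?(ltW wp)//=; last by nra.
    by rewrite ler_pdivrMr// mul1r /w; nra.
  exists ((1 - s) *: e.1 + s *: e'.1, (1 - s) * e.2 + s * e'.2), (1 - w); split.
  - exact: cE.
  - rewrite /w; apply/andP; split; nra.
  - have ws : w * s = l * (1 - t') by rewrite /s mulrC divfK.
    have ws1 : w * (1 - s) = (1 - l) * (1 - t) by rewrite mulrBr ws /w; ring.
    rewrite /= !subKr; congr pair; last first.
      have -> : w * ((1 - s) * e.2 + s * e'.2) = w * (1 - s) * e.2 + w * s * e'.2 by ring.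
      by rewrite ws ws1 /w; ring.
    rewrite !scalerDr !scalerA ws ws1 -!addrA; congr (_ + _).
    rewrite addrCA; congr (_ + _); rewrite -scalerDl; congr (_ *: _).
    by rewrite /w; ring.
- by move=> _ [e [t [Ee t01 ->]]]; exact: H.
- move=> e Ee; exists e, 0; split => //; first by rewrite lexx ler01.
  by rewrite subr0 scale0r scale1r mul0r mul1r !addr0; case: (e).
Qed.

(** For a fixed starting point in [E] and a fixed [t], lying above [q] is a closed condition on the
    endpoint [p]. *)
Lemma maximal_cvx_closed : closed E.
Proof.
move=> p clp; apply: maximal_cvx_add => e t Ee t01.
pose C : set (vec * R) := [set p | q ((1 - t) *: e.1 + t *: p.1) <= (1 - t) * e.2 + t * p.2].
have cC : closed C.
  have c1 : continuous (fun p : vec * R => (1 - t) *: e.1 + t *: p.1).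
    by move=> x; apply: cvgD; [exact: cvg_cst|apply: cvgZ; [exact: cvg_cst|exact: cvg_fst]].
  apply: closed_le_fun.
    move=> x; apply: cvgM; last exact: cvg_cst.
    exact: (continuous_Sform c1 c1).
  by move=> x; apply: cvgD; [exact: cvg_cst|apply: cvgM; [exact: cvg_cst|exact: cvg_snd]].
have EC : E `<=` C by move=> p' Ep' /=; exact: (qE (cE Ee Ep' t01)).
by have := closureS EC clp; rewrite -(closure_id C).1.
Qed.

Definition contact : set vec := [set x | E (x, q x)].

(** The segment from [(x, q x)] to [p] starts on the graph of [q] and stays above it; comparing
    slopes at its start gives the tangent inequality. *)
Lemma contact_tangent x p : contact x -> E p -> Sform S x p.1 - q x <= p.2.
Proof.
move=> Ex Ep; rewrite -subr_ge0.
apply: (@ge0_first_order _ _ (- q (p.1 - x))) => t /andP[t0 t1].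
have t01 : 0 <= t <= 1 by rewrite t1 ltW.
have := qE (cE Ex Ep t01).
rewrite /above_q /= q_conv q_sub (SformC p.1 x ST).
nra.
Qed.

(** [F p] is the height of [p] above the graph of [q] plus the squared norm of the positive part of
    [p.1 - y0]. Its minimiser over [E] produces the contact point [y0 - v J]. *)
Lemma minty y0 : exists2 x, contact x & (x - y0) *m J = - (x - y0).
Proof.
pose F (p : vec * R) := p.2 - Sform S p.1 y0 + q y0 + Sform M (p.1 - y0) (p.1 - y0) / 2.
have F0 p : E p -> 0 <= F p.
  move=> /qE; rewrite /above_q /= => qp; have := MS_ge0 (p.1 - y0).
  have := q_sub p.1 y0; rewrite /F; lra.
have [e0 Ee0] := maximal_cvx_neq0.
have cF : continuous F.
  have c1 : continuous (fun p : vec * R => p.1 - y0).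
    by move=> x; apply: cvgB; [exact: cvg_fst|exact: cvg_cst].
  move=> x; apply: cvgD; last first.
    apply: cvgM; last exact: cvg_cst.
    exact: (continuous_Sform c1 c1).
  apply: cvgD; last exact: cvg_cst.
  apply: cvgB; first exact: cvg_snd.
  by apply: cvg_Sform; [exact: cvg_fst|exact: cvg_cst].
pose E1 := E `&` [set p | F p <= F e0].
(* [F] is strongly convex in [p.1] through [M]; as [F] is non-negative at the midpoint of [p] and
   [e0], its sublevel sets are bounded. *)
have Fmid p : E p -> F p <= F e0 -> Sform M (p.1 - e0.1) (p.1 - e0.1) <= 8 * F e0.
  move=> Ep Fp; have t01 : 0 <= (2^-1 : R) <= 1 by apply/andP; split; lra.
  have := F0 _ (cE Ep Ee0 t01).
  have : F ((1 - 2^-1) *: p.1 + 2^-1 *: e0.1, (1 - 2^-1) * p.2 + 2^-1 * e0.2) =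
    (F p + F e0) / 2 - Sform M (p.1 - e0.1) (p.1 - e0.1) / 8.
    rewrite /F /= !SformE !(SformC e0.1 p.1 MT) !(SformC y0 p.1 MT) !(SformC y0 e0.1 MT).
    by field.
  move=> ->; lra.
have [cS cS0 Sb] := Sform_bound S.
(* [|z|^2 <= s] implies [|z| <= s + 1], which avoids a square root. *)
pose K := `|e0.1| + (c * (8 * F e0) + 1).
have Fe0 := F0 _ Ee0.
have cF0 : 0 <= c * (8 * F e0) by rewrite mulr_ge0 ?mulr_ge0// ltW.
have E1K p : E1 p -> `|p.1| <= K.
  move=> [Ep Fp]; have := Fmid _ Ep Fp; rewrite -(ler_pM2l c0) => /(le_trans (Mc _)) H.
  rewrite -[p.1](subrK e0.1) addrC (le_trans (ler_normD _ _))// lerD2l.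
  by have := normr_ge0 (p.1 - e0.1); nra.
pose K2 := F e0 + cS * K * `|y0| + cS * K * K + `|q y0|.
have K0 : 0 <= K by rewrite /K; have := normr_ge0 e0.1; lra.
have E1K2 p : E1 p -> `|p.2| <= K2.
  move=> E1p; have pK := E1K _ E1p; case: E1p => Ep Fp.
  have Sy : `|Sform S p.1 y0| <= cS * K * `|y0|.
    by rewrite (le_trans (Sb _ _))// ler_wpM2r// ler_wpM2l// ltW.
  have Sp : `|Sform S p.1 p.1| <= cS * K * K.
    rewrite (le_trans (Sb _ _))// ler_pM//; first by rewrite mulr_ge0// ltW.
    by rewrite ler_wpM2l// ltW.
  have := qE Ep; rewrite /above_q /= => qp.
  have := M_ge0 (p.1 - y0); have := ler_norm (q y0); have := ler_norm (- q y0).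
  rewrite normrN => h1 h2 h3.
  move: Sy Sp; rewrite !ler_norml => /andP[s1 s2] /andP[s3 s4].
  have cKK : 0 <= cS * K * K by rewrite !mulr_ge0// ltW.
  have cKy : 0 <= cS * K * `|y0| by rewrite !mulr_ge0// ltW.
  by move: Fp; rewrite /K2 /F /= => Fp; apply/andP; split; lra.
have cE1 : compact E1.
  apply: (@subclosed_compact _ _ ([set x | `|x| <= K] `*` `[- K2, K2])).
  - apply: closedI; first exact: maximal_cvx_closed.
    by apply: closed_le_fun => //; move=> x; exact: cvg_cst.
  - apply: compact_setX; last exact: segment_compact.
    apply: bounded_closed_compact.
      exists K; split; first exact: num_real.
      by move=> k Kk x xK; exact: le_trans xK (ltW Kk).
    by apply: closed_le_fun => x; [exact: norm_continuous|exact: cst_continuous].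
  - move=> p E1p; split; first exact: E1K.
    by rewrite /= in_itv /= -ler_norml; exact: E1K2.
have [[a r] /set_mem[Ea Fa] Fmin] :=
  compact_EVT_min (ex_intro _ e0 (conj Ee0 (lexx _))) cE1 (continuous_subspaceT cF).
have {}Fmin p : E p -> F (a, r) <= F p.
  move=> Ep; have [h|/ltW h] := leP (F p) (F e0); first exact: Fmin (mem_set (conj Ep h)).
  exact: le_trans Fa h.
pose v := a - y0; pose p := y0 - v *m J.
(* First-order optimality of [(a, r)]: the functional [S b p - s] is maximal on [E] at [(a, r)]. *)
have hs b s : E (b, s) -> Sform S b p - s <= Sform S a p - r.
  move=> Eb; rewrite -subr_ge0.
  apply: (@ge0_first_order _ _ (Sform M (b - a) (b - a) / 2)) => t /andP[t0 t1].
  have t01 : 0 <= t <= 1 by rewrite t1 ltW.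
  have := Fmin _ (cE Ea Eb t01).
  rewrite -subr_ge0; congr (0 <= _).
  rewrite /F /= /p !(SformDr S _ y0) !SformNr !SJr /v !SformE.
  rewrite !(SformC b a MT) !(SformC y0 a MT) !(SformC y0 b MT).
  by field.
have aq : q a <= r by exact: (qE Ea).
have qap : q (a - p) = Sform M v v + Sform S v v.
  have -> : a - p = v + v *m J by rewrite /p /v opprB addrA addrAC.
  exact: q_addJ.
have hq : Sform S a p - r <= q p - (Sform M v v + Sform S v v).
  by have := q_sub a p; rewrite qap; lra.
have v0 := MS_ge0 v.
(* By [hs] and [hq], [S b p <= s + q p] on [E], so all segments from [E] to [(p, q p)] stay above
   [q]. *)
have cp : contact p.
  apply: maximal_cvx_add => -[b s] t Eb /= /andP[t0 t1].
  have := hs _ _ Eb; have := qE Eb; rewrite /above_q q_conv /= => bs hb.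
  have t10 : 0 <= 1 - t by lra.
  have : (1 - t) ^+ 2 * q b <= (1 - t) ^+ 2 * s by rewrite ler_wpM2l// sqr_ge0.
  have : t * (1 - t) * Sform S b p <= t * (1 - t) * (s + q p).
    by rewrite ler_wpM2l ?mulr_ge0//; lra.
  move=> h1 h2; apply: le_trans (lerD (lerD h2 h1) (lexx _)) _.
  by rewrite le_eqVlt; apply/orP; left; apply/eqP; ring.
(* Inserting [(p, q p)] into [hs] kills the positive part of [v], and then [p = a]. *)
have vJ : v *m J = - v by apply: MS_eq0; have := hs _ _ cp; lra.
by exists p => //; rewrite /p vJ opprK addrAC subrr add0r.
Qed.

(** A point [y] of a larger monotone set is compared with its Minty point [x]: [S] is non-negative
    on [x - y] by monotonicity and equals [- M] there. *)
Lemma contact_maximal : maximal_S_monotone S contact.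
Proof.
have mono : S_monotone S contact.
  move=> x y Ex Ey; have := contact_tangent Ex Ey; have /= := q_sub x y; lra.
split => // G mG EG; apply/seteqP; split => // y Gy.
have [x Ex xJ] := minty y.
suff <- : x = y by [].
apply/eqP; rewrite -subr_eq0; apply/eqP/M_eq0; rewrite -oppr_ge0 -negative_form//.
by apply: mG => //; exact: EG.
Qed.

End MaximalCvx.

(** With [E0] read as the epigraph of a convex [phi >= q], the second clause is [psi S G <= phi],
    and the third puts into [G] the points where [phi] touches [q]. *)
Lemma maximal_monotone_below (E0 : set (vec * R)) : cvx_set E0 -> E0 `<=` above_q ->
  exists G, [/\ maximal_S_monotone S G,
    forall x p, G x -> E0 p -> Sform S x p.1 - q x <= p.2,
    forall x, E0 (x, q x) -> G x &
    forall y, exists2 x, G x & (x - y) *m J = - (x - y)].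
Proof.
move=> cE0 qE0; have [E [cE qE E0E mE]] := exists_maximal_cvx cE0 qE0.
exists (contact E); split.
- exact: contact_maximal.
- by move=> x p Ex /E0E; exact: contact_tangent.
- by move=> x /E0E.
- by move=> y; exact: minty.
Qed.

End MaximalMonotone.

(** * Splitting off one coordinate of the scalar product *)

Section LinearInstances.
Context {R : realType} {d : nat}.
Set Implicit Arguments.
Unset Strict Implicit.

Fact Sform_is_linear (A : 'M[R]_d) x : linear (Sform A x : 'rV[R]_d -> R^o).
Proof. by move=> a y z; rewrite SformDr SformZr. Qed.
HB.instance Definition _ A x :=
  GRing.isLinear.Build R 'rV[R]_d R^o *:%R (Sform A x) (@Sform_is_linear A x).

Fact del_coord_is_linear (j : 'I_d) : linear (@del_coord R d j).
Proof. by move=> a y z; apply/rowP => i; rewrite !mxE. Qed.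
HB.instance Definition _ j :=
  GRing.isLinear.Build R 'rV[R]_d 'rV[R]_d.-1 *:%R (@del_coord R d j) (@del_coord_is_linear j).

Lemma del_coord_continuous (j : 'I_d) : continuous (@del_coord R d j).
Proof.
move=> /= x s /= /nbhs_ballP[e e0 es]; apply/nbhs_ballP; exists e => //= y [_ xy].
by apply: es; split => // i k; rewrite !mxE; exact: xy.
Qed.

Lemma norm_del_coord (j : 'I_d) (x : 'rV[R]_d) : `|del_coord j x| <= `|x|.
Proof. by apply: norm_le => // i; rewrite mxE norm_coord. Qed.

Lemma dotE n (x z : 'rV[R]_n) : Sform 1%:M x z = \sum_i x 0 i * z 0 i.
Proof. by rewrite /Sform mulmx1 mxE; apply: eq_bigr => i _; rewrite [X in _ * X]mxE. Qed.

Lemma dot_split (j : 'I_d) (x z : 'rV[R]_d) : Sform 1%:M x z =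
  x 0 j * z 0 j + Sform 1%:M (del_coord j x) (del_coord j z).
Proof.
rewrite !dotE; case: d j x z => [[]//|n] j x z.
rewrite (bigD1_ord j)//=; congr (_ + _); apply: eq_bigr => k _; rewrite !mxE.
by congr (x _ _ * z _ _); apply: val_inj.
Qed.

(** Passes to [z = S y], the variable of (A4), in which the functions under the supremum are affine
    for the standard product. *)
Lemma Sform_Sapply (S : 'M[R]_d) (x y : 'rV[R]_d) :
  Sform S x y = Sform 1%:M x (Sapply S y).
Proof. by rewrite /Sform /Sapply trmxK mulmx1 mulmxA. Qed.

Lemma dot_delta (x : 'rV[R]_d) i : Sform 1%:M x (delta_mx 0 i) = x 0 i.
Proof. by rewrite /Sform mulmx1 trmx_delta -colE mxE. Qed.

End LinearInstances.

(** * Gradients at touching points *)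

Section Differentials.
Context {R : realType}.
Set Implicit Arguments.
Unset Strict Implicit.

Lemma lip_continuous (U W : normedModType R) (f : U -> W) (L : R) :
  (forall x y, `|f x - f y| <= L * `|x - y|) -> continuous f.
Proof.
move=> fL x; apply/cvgrPdist_lt => e e0.
have L1 : 0 < `|L| + 1 by rewrite ltr_wpDl.
near=> y; apply: le_lt_trans (fL _ _) _.
apply: (@le_lt_trans _ _ ((`|L| + 1) * `|x - y|)).
  by rewrite ler_wpM2r// (le_trans (ler_norm L))// lerDl.
rewrite mulrC -ltr_pdivlMr//; near: y.
by apply: cvgr_dist_lt => //; rewrite divr_gt0.
Unshelve. all: by end_near. Qed.

Lemma diff_min_eq0 (U : normedModType R) (m : U -> R) u v :
  differentiable m u -> (forall u', m u <= m u') -> 'd m u v = 0.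
Proof.
move=> dm mmin.
have ge0 w : 0 <= 'd m u w.
  rewrite -deriveE//; have dw : derivable m u w by exact: diff_derivable.
  have /cvg_dnbhs_at_right cv := dw.
  apply: (cvgr_to_ge cv); near=> h; apply: mulr_ge0; last by rewrite subr_ge0; exact: mmin.
  by rewrite invr_ge0; apply: ltW; near: h; exact: nbhs_right_gt.
apply/eqP; rewrite eq_le ge0 andbT -oppr_ge0.
by have := ge0 (- v); rewrite linearN.
Unshelve. all: by end_near. Qed.

(** Envelope principle: [m1] and [m2] are minimal at [z], so their differentials vanish there and
    only the linear part [w] remains. *)
Lemma grad_touch d (h : 'rV[R]_d -> R) (z w : 'rV[R]_d) (m1 m2 : 'rV[R]_d -> R) (a : R) :
  (forall z', h z' = Sform 1%:M w z' + a * (m1 z' - m2 z')) ->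
  differentiable m1 z -> differentiable m2 z ->
  (forall z', m1 z <= m1 z') -> (forall z', m2 z <= m2 z') -> grad h z = w.
Proof.
move=> hE d1 d2 min1 min2; apply/rowP => i; rewrite mxE.
have cw : continuous (Sform 1%:M w : 'rV[R]_d -> R^o).
  apply: (@continuous_Sform _ _ _ 1%:M (fun=> w) id) => x; last exact: cvg_id.
  exact: cst_continuous.
have dw : differentiable (Sform 1%:M w : 'rV[R]_d -> R^o) z by exact: linear_differentiable.
have -> : h = (Sform 1%:M w : 'rV[R]_d -> R^o) + a *: (m1 - m2).
  by apply/funext => z'; rewrite hE.
have d12 : differentiable (m1 - m2) z by exact: differentiableB.
have da : differentiable (a *: (m1 - m2)) z by exact: differentiableZ.
rewrite diffD// diffZ// diffB// /= diff_lin//=.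
by rewrite !diff_min_eq0// subrr scaler0 addr0 dot_delta.
Qed.

Lemma convex_functionI n (f : 'rV[R]_n -> R) :
  (forall t u v, 0 <= t <= 1 -> f (t *: u + (1 - t) *: v) <= t * f u + (1 - t) * f v) ->
  convex_function setT f.
Proof.
move=> H t u v _ _; have /= := H t%:num u v; apply; apply/andP; split => //.
Qed.

Lemma lin_growth_comb n (f g : 'rV[R]_n -> R) (a b : R) :
  lin_growth f -> lin_growth g -> lin_growth (fun x => a * f x + b * g x).
Proof.
move=> [cf Hf] [cg Hg]; exists (`|a| * cf + `|b| * cg) => x.
rewrite (le_trans (ler_normD _ _))// !normrM mulrDl -!mulrA lerD//.
  by rewrite ler_wpM2l.
by rewrite ler_wpM2l.
Qed.

End Differentials.

(** * Surfaces on which the support functions of two pieces of [G] agree *)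

Section Covers.
Context {R : realType} {d : nat}.
Set Implicit Arguments.
Unset Strict Implicit.
Variables (S : 'M[R]_d) (j : 'I_d).
Local Notation vec := 'rV[R]_d.
Local Notation q x := (Sform S x x / 2).
Local Notation dot := (Sform 1%:M).
Implicit Types (x y z w : vec) (u v : 'rV[R]_d.-1) (t : R).

(** Serves as the set [C] of (A4); the radius [K] makes it compact. *)
Definition normals (K : R) : set vec :=
  [set x : vec | [/\ x 0 j = 1, 0 <= Sform S x x & `|x| <= K]].

Lemma closed_normals K : closed (normals K).
Proof.
have -> : normals K = [set x : vec | x 0 j <= 1] `&` [set x : vec | 1 <= x 0 j] `&`
    [set x | 0 <= Sform S x x] `&` [set x | `|x| <= K].
  apply/seteqP; split => x /=; first by move=> [-> ? ?]; rewrite !lexx.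
  by move=> [[[h1 h2] h3] h4]; split => //; apply/eqP; rewrite eq_le h1.
have cid : continuous (@id vec) by move=> x; exact: cvg_id.
repeat apply: closedI; apply: closed_le_fun => //; try exact: cst_continuous.
- exact: coord_continuous.
- exact: coord_continuous.
- exact: continuous_Sform.
- exact: norm_continuous.
Qed.

Lemma compact_normals K : compact (normals K).
Proof.
apply: bounded_closed_compact; last exact: closed_normals.
exists K; split; first exact: num_real.
by move=> k Kk x [_ _ xK]; exact: le_trans xK (ltW Kk).
Qed.

(** The function [dot x z - q x] of [z], with [t] for [z 0 j] and [u] for the other coordinates. *)
Definition aff x t u := x 0 j * t + dot (del_coord j x) u - q x.

Lemma aff_dot x z : aff x (z 0 j) (del_coord j z) = dot x z - q x.
Proof. by rewrite /aff (dot_split j). Qed.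

Lemma aff_conv x (s : R) t t' u v :
  aff x (s * t + (1 - s) * t') (s *: u + (1 - s) *: v) =
  s * aff x t u + (1 - s) * aff x t' v.
Proof. by rewrite /aff !SformE; ring. Qed.

(** The maximum over [F], written as attainment plus upper bound so that a maximiser, which acts as
    a subgradient, is always at hand. *)
Definition support_fun (F : set vec) (V : R -> 'rV[R]_d.-1 -> R) :=
  (forall t u, exists2 x, F x & V t u = aff x t u) /\
  (forall x t u, F x -> aff x t u <= V t u).

Lemma exists_support_fun (F : set vec) (K : R) : F !=set0 -> closed F ->
  (forall x, F x -> `|x| <= K) -> exists V, support_fun F V.
Proof.
move=> F0 cF FK.
have ex (p : R * 'rV[R]_d.-1) :
    exists x, F x /\ forall x', F x' -> aff x' p.1 p.2 <= aff x p.1 p.2.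
  have ca : continuous (fun x => aff x p.1 p.2).
    apply: contB; last first.
      apply: contM; last exact: cont_cst.
      by apply: continuous_Sform; exact: cont_id.
    apply: contD; first by apply: contM; [exact: coord_continuous|exact: cont_cst].
    by apply: continuous_Sform; [exact: del_coord_continuous|exact: cont_cst].
  by have [x Fx Hx] := closed_bounded_EVT_max F0 cF FK ca; exists x.
have [X HX] := choice ex.
exists (fun t u => aff (X (t, u)) t u); split=> [t u|x t u Fx].
  by exists (X (t, u)) => //; exact: (HX (t, u)).1.
exact: (HX (t, u)).2.
Qed.

Lemma support_conv F V s t t' u v : support_fun F V -> 0 <= s <= 1 ->
  V (s * t + (1 - s) * t') (s *: u + (1 - s) *: v) <=
  s * V t u + (1 - s) * V t' v.
Proof.
move=> [ex ub] /andP[s0 s1]; have [x Fx ->] := ex (s * t + (1 - s) * t') (s *: u + (1 - s) *: v).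
rewrite aff_conv lerD// ler_wpM2l//; [exact: ub|by rewrite subr_ge0|exact: ub].
Qed.

Lemma support_slope F V t t' u : support_fun F V ->
  exists2 x, F x & V t u + x 0 j * (t' - t) <= V t' u.
Proof.
move=> [ex ub]; have [x Fx ->] := ex t u; exists x => //.
by apply: le_trans (ub x t' u Fx); rewrite /aff; lra.
Qed.

Lemma support_lip F V (K : R) t t' u : support_fun F V ->
  (forall x, F x -> `|x| <= K) -> `|V t u - V t' u| <= K * `|t - t'|.
Proof.
move=> sV FK.
have H a b : V b u - V a u >= - (K * `|a - b|).
  have [x Fx Hx] := support_slope a b u sV.
  have : `|x 0 j * (b - a)| <= K * `|a - b|.
    by rewrite normrM distrC ler_wpM2r// (le_trans (norm_coord _ _))// FK.
  by rewrite ler_norml => /andP[h _]; lra.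
rewrite ler_norml; apply/andP; split; first by rewrite distrC; exact: H.
by have := H t t'; lra.
Qed.

Lemma support_growth F V (K : R) : support_fun F V ->
  (forall x, F x -> `|x| <= K) ->
  exists c, forall t u, `|V t u| <= c * (1 + `|u|) + K * `|t|.
Proof.
move=> sV FK; have [cb cb0 dotb] := @Sform_bound R d.-1 1%:M.
have affb x t u : F x -> `|aff x t u - aff x 0 0| <= cb * K * `|u| + K * `|t|.
  move=> Fx; have xK := FK _ Fx.
  have -> : aff x t u - aff x 0 0 = dot (del_coord j x) u + x 0 j * t.
    by rewrite /aff Sform0r; ring.
  rewrite (le_trans (ler_normD _ _))// lerD//.
    rewrite (le_trans (dotb _ _))// ler_wpM2r// ler_wpM2l ?(ltW cb0)//.
    by rewrite (le_trans (norm_del_coord _ _)).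
  by rewrite normrM ler_wpM2r// (le_trans (norm_coord _ _)).
exists (`|V 0 0| + cb * `|K|) => t u.
have [ex ub] := sV.
have [x Fx Vx] := ex t u; have [y Fy Vy] := ex 0 0.
have Vxb := ub x 0 0 Fx; have Vyb := ub y t u Fy.
have := affb x t u Fx; have := affb y t u Fy.
rewrite !ler_norml => /andP[h1 h2] /andP[h3 h4].
have h5 : cb * K * `|u| <= cb * `|K| * `|u|.
  by rewrite ler_wpM2r// ler_wpM2l ?ler_norm// ltW.
have h6 : 0 <= cb * `|K| by rewrite mulr_ge0// ltW.
have h7 : 0 <= `|V 0 0| * `|u| by [].
have := ler_norm (V 0 0); have := ler_norm (- V 0 0); rewrite normrN => h8 h9.
by rewrite mulrDr mulr1 mulrDl; apply/andP; split; lra.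
Qed.

(* If [V1 (phi u) u = V2 (phi u) u =: k u], where [V1] grows in its first
   argument at least at the rate [al] and [V2] at most at the rate [be < al],
   then [k - a phi] is convex for all [a] between [be] and [al]; hence
   [phi] is a difference of convex functions. *)
Section EqualSupport.
Variables (F1 F2 : set vec) (al be K : R).
Hypotheses (F10 : F1 !=set0) (F20 : F2 !=set0) (cF1 : closed F1) (cF2 : closed F2)
  (F1K : forall x, F1 x -> `|x| <= K) (F2K : forall x, F2 x -> `|x| <= K)
  (F1al : forall x, F1 x -> al <= x 0 j) (F2be : forall x, F2 x -> x 0 j <= be)
  (ab : be < al)
  (mono : forall x y, F1 x -> F2 y -> 0 <= Sform S (x - y) (x - y)).

Lemma equal_support_cover : exists C h,
  [/\ compact C, C `<=` [set x : vec | x 0 j = 1 /\ 0 <= Sform S x x],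
    in_Hclass j C h &
    forall z x1 x2, F1 x1 -> F2 x2 -> dot x1 z - q x1 = dot x2 z - q x2 ->
    (forall x, F1 x -> dot x z - q x <= dot x1 z - q x1) ->
    (forall x, F2 x -> dot x z - q x <= dot x2 z - q x2) -> h z = 0].
Proof.
have [V1 sV1] := exists_support_fun F10 cF1 F1K.
have [V2 sV2] := exists_support_fun F20 cF2 F2K.
have ab0 : 0 < al - be by rewrite subr_gt0.
pose D u t := V1 t u - V2 t u.
(* In [t], [V1] has slopes at least [al] and [V2] at most [be]; so [D u] is strictly increasing and
   has exactly one zero, called [phi u] below. *)
have Dinc u t t' : t <= t' -> (al - be) * (t' - t) <= D u t' - D u t.
  move=> tt'; have [x Fx Hx] := support_slope t t' u sV1.
  have [y Fy Hy] := support_slope t' t u sV2.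
  have := F1al Fx; have := F2be Fy; rewrite /D; nra.
have Dinj u t t' : D u t = 0 -> D u t' = 0 -> t = t'.
  wlog tt' : t t' / t <= t'.
    by move=> H; have [?|/ltW ?] := leP t t' => ? ?; [|apply/esym]; exact: H.
  move=> Dt Dt'; have := Dinc u _ _ tt'; rewrite Dt Dt' subrr pmulr_rle0// => h.
  by apply/eqP; rewrite eq_le tt' -subr_le0.
have Dc u : continuous (D u).
  apply: (@lip_continuous _ _ _ _ (K + K)) => t t'; rewrite /D.
  have -> : V1 t u - V2 t u - (V1 t' u - V2 t' u) =
    (V1 t u - V1 t' u) - (V2 t u - V2 t' u) by ring.
  rewrite (le_trans (ler_normB _ _))// mulrDl lerD//.
    exact: support_lip sV1 F1K.
  exact: support_lip sV2 F2K.
have exphi u : exists t, D u t = 0.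
  (* Growth at rate [al - be] forces the zero of [D u] into [[- T, T]]. *)
  pose T := `|D u 0| / (al - be).
  have T0 : 0 <= T by rewrite divr_ge0// ltW.
  have TE : (al - be) * T = `|D u 0| by rewrite /T mulrC divfK// gt_eqF.
  have D1 : D u (- T) <= 0.
    have := Dinc u (- T) 0; rewrite oppr_le0 opprK add0r => /(_ T0).
    by have := ler_norm (D u 0); lra.
  have D2 : 0 <= D u T.
    have := Dinc u 0 T T0; rewrite subr0.
    by have := ler_norm (- D u 0); rewrite normrN; lra.
  have [||t _ Dt] := @IVT R (D u) (- T) T 0 _ (continuous_subspaceT (Dc u)).
  - by rewrite (le_trans _ T0)// oppr_le0.
  - by rewrite ge_min D1 /= le_max D2 orbT.
  - by exists t.
have [phi Dphi] := choice exphi.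
pose k u := V1 (phi u) u.
have kE u : k u = V2 (phi u) u by apply/eqP; rewrite -subr_eq0; apply/eqP/Dphi.
(* Joint convexity bounds [V1] and [V2] from above at the averaged argument [p], which may differ
   from [phi w]. From below, the slope of [V1] is used if [p >= phi w] and that of [V2]
   otherwise. *)
have core s u v (w := s *: u + (1 - s) *: v) : 0 <= s <= 1 ->
    forall a, be <= a <= al ->
    a * (s * phi u + (1 - s) * phi v - phi w) <= s * k u + (1 - s) * k v - k w.
  move=> s01 a /andP[bea aal].
  have := support_conv (phi u) (phi v) u v sV1 s01; rewrite -/w -/(k u) -/(k v) => c1.
  have := support_conv (phi u) (phi v) u v sV2 s01; rewrite -/w -!kE => c2.
  set p := s * phi u + (1 - s) * phi v in c1 c2 *.
  have [x Fx] := support_slope (phi w) p w sV1; rewrite -/(k w) => Hx.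
  have [y Fy] := support_slope (phi w) p w sV2; rewrite -kE => Hy.
  have xal := F1al Fx; have ybe := F2be Fy.
  have [h|/ltW h] := leP 0 (p - phi w).
    have : a * (p - phi w) <= x 0 j * (p - phi w) by rewrite ler_wpM2r// (le_trans aal).
    lra.
  have : a * (p - phi w) <= y 0 j * (p - phi w) by rewrite ler_wnM2r// (le_trans ybe).
  lra.
(* The two extreme slopes are taken: [phi = g2 - g1], so that [h z = z 0 j - phi]. *)
pose g1 u := (k u - al * phi u) / (al - be).
pose g2 u := (k u - be * phi u) / (al - be).
have cvx a : be <= a <= al -> convex_function setT (fun u => (k u - a * phi u) / (al - be)).
  move=> ha; apply: convex_functionI => s u v s01.
  rewrite !mulrA -mulrDl ler_pM2r ?invr_gt0//.
  by have := core s u v s01 a ha; lra.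
have lphi : lin_growth phi.
  have [c1 H1] := support_growth sV1 F1K; have [c2 H2] := support_growth sV2 F2K.
  exists ((c1 + c2) / (al - be)) => u.
  rewrite mulrAC ler_pdivlMr//.
  apply: (@le_trans _ _ `|D u 0|).
    have := Dphi u; have [h|/ltW h] := leP 0 (phi u).
      have := Dinc u _ _ h; rewrite (ger0_norm h) => h1 h2.
      by have := ler_norm (- D u 0); rewrite normrN; lra.
    have := Dinc u _ _ h; rewrite (ler0_norm h) => h1 h2.
    by have := ler_norm (D u 0); lra.
  rewrite /D (le_trans (ler_normB _ _))// mulrDl.
  by have := H1 0 u; have := H2 0 u; rewrite normr0 !mulr0 !addr0; lra.
have lk : lin_growth k.
  have [c1 H1] := support_growth sV1 F1K; have [c2 H2] := lphi.
  exists (c1 + `|K| * c2) => u; rewrite (le_trans (H1 _ _))// mulrDl lerD2l.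
  rewrite -mulrA (@le_trans _ _ (`|K| * `|phi u|))//.
    by rewrite ler_wpM2r// ler_norm.
  by rewrite ler_wpM2l.
have lg a : lin_growth (fun u => (k u - a * phi u) / (al - be)).
  rewrite (_ : (fun _ => _) = fun u => (al - be)^-1 * k u + (- a / (al - be)) * phi u).
    exact: lin_growth_comb.
  by apply/funext => u; ring.
have phiE u : phi u = g2 u - g1 u by rewrite /g1 /g2; field; rewrite gt_eqF.
have kgE u : k u = al * g2 u - be * g1 u by rewrite /g1 /g2; field; rewrite gt_eqF.
(* The gradient is [(x1 - x2) / de] with [de >= al - be] and both norms at most [K], whence this
   radius. *)
exists (normals ((K + K) / (al - be))), (fun z => z 0 j + g1 (del_coord j z) - g2 (del_coord j z)).
split.
- exact: compact_normals.
- by move=> x [].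
- exists g1, g2.
  split; first by apply: cvx; rewrite lexx ltW.
  split; first by apply: cvx; rewrite lexx ltW.
  split; first exact: lg.
  split; first exact: lg.
  split; first by [].
  move=> z dg1 dg2; set u := del_coord j z.
  have [x1 F1x1 Vx1] := sV1.1 (phi u) u; have [x2 F2x2 Vx2] := sV2.1 (phi u) u.
  pose de := (x1 - x2) 0 j.
  have de0 : al - be <= de.
    by rewrite /de !mxE; have := F1al F1x1; have := F2be F2x2; lra.
  have dep : 0 < de := lt_le_trans ab0 de0.
  (* For [x] in [F1] or [F2], [m x] is at least [- q x], with equality where [x] is a maximiser; so
     [m x1] and [m x2] are minimal at [z], and [h] is linear plus [(m x1 - m x2) / de]. *)
  pose m (x : vec) (z' : vec) := k (del_coord j z') - x 0 j * phi (del_coord j z')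
     - dot (del_coord j x) (del_coord j z').
  have dm x : differentiable (m x) z.
    have dd : differentiable (@del_coord R d j) z.
      exact/linear_differentiable/del_coord_continuous.
    have D1 : differentiable (g1 \o @del_coord R d j) z by exact: differentiable_comp.
    have D2 : differentiable (g2 \o @del_coord R d j) z by exact: differentiable_comp.
    have D3 : differentiable ((dot (del_coord j x) : _ -> R^o) \o @del_coord R d j) z.
      apply: differentiable_comp => //; apply: linear_differentiable.
      move=> y; apply: (@continuous_Sform _ _ _ 1%:M (fun=> del_coord j x) id) => y'.
        exact: cst_continuous.
      exact: cvg_id.
    have -> : m x = (al - x 0 j) *: (g2 \o @del_coord R d j) +
       (x 0 j - be) *: (g1 \o @del_coord R d j) -
       ((dot (del_coord j x) : _ -> R^o) \o @del_coord R d j).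
      apply/funext => z'; rewrite /m kgE phiE /= !fctE /= /GRing.scale /=; ring.
    apply: differentiableB => //; apply: differentiableD; exact: differentiableZ.
  have min1 z' : m x1 z <= m x1 z'.
    have := sV1.2 x1 (phi (del_coord j z')) (del_coord j z') F1x1.
    rewrite -/(k _) => h; move: Vx1; rewrite -/(k u) => h'.
    by rewrite /m -/u h'; move: h; rewrite /aff; lra.
  have min2 z' : m x2 z <= m x2 z'.
    have := sV2.2 x2 (phi (del_coord j z')) (del_coord j z') F2x2.
    rewrite -kE => h; move: Vx2; rewrite -kE => h'.
    by rewrite /m -/u h'; move: h; rewrite /aff; lra.
  rewrite (@grad_touch _ _ _ z (de^-1 *: (x1 - x2)) (m x1) (m x2) de^-1)//.
    split.
    + by rewrite mxE mulVf// gt_eqF.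
    + rewrite SformZl SformZr mulr_ge0 ?invr_ge0 ?(ltW dep)//.
      by rewrite mulr_ge0 ?invr_ge0 ?(ltW dep)//; exact: mono.
    + rewrite normrZ gtr0_norm ?invr_gt0// mulrC.
      apply: ler_pM => //; first by rewrite invr_ge0 ltW.
        exact: le_trans (ler_normB _ _) (lerD (F1K F1x1) (F2K F2x2)).
      by rewrite lef_pV2// posrE.
  move=> z'; rewrite (dot_split j).
  have -> : del_coord j (de^-1 *: (x1 - x2)) = de^-1 *: (del_coord j x1 - del_coord j x2).
    by apply/rowP => i; rewrite !mxE.
  rewrite SformZl mxE -/de.
  rewrite SformDl SformNl /m kgE phiE.
  have -> : x1 0 j = x2 0 j + de by rewrite /de !mxE; ring.
  by field; rewrite gt_eqF.
- move=> z x1 x2 F1x1 F2x2 e12 max1 max2; set u := del_coord j z.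
  have V1z : V1 (z 0 j) u = dot x1 z - q x1.
    have [x Fx Vx] := sV1.1 (z 0 j) u; apply/eqP; rewrite eq_le {1}Vx aff_dot max1//=.
    by rewrite -aff_dot; exact: sV1.2.
  have V2z : V2 (z 0 j) u = dot x2 z - q x2.
    have [x Fx Vx] := sV2.1 (z 0 j) u; apply/eqP; rewrite eq_le {1}Vx aff_dot max2//=.
    by rewrite -aff_dot; exact: sV2.2.
  have : z 0 j = phi u by apply: Dinj (Dphi u); rewrite /D V1z V2z e12 subrr.
  by rewrite phiE /g1 /g2 => ->; ring.
Qed.

End EqualSupport.
End Covers.

(** * Convex graphs through the points having a normal on which [S] is non-negative *)

Section NormalCover.
Context {R : realType} {d : nat}.
Set Implicit Arguments.
Unset Strict Implicit.
Variables (S : 'M[R]_d) (j : 'I_d) (D : set 'rV[R]_d) (sg : R).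
Hypothesis sgP : sg = 1 \/ sg = -1.
Local Notation vec := 'rV[R]_d.
Local Notation dot := (Sform 1%:M).
Implicit Types (s z : vec) (u : 'rV[R]_d.-1).

(** The outer normal is [sg *: s]. As the norm is the largest modulus of a coordinate, radius [1]
    together with [s 0 j = 1] says that [j] is a dominant coordinate. *)
Definition boundary_points : set vec := [set z | D z /\
  exists2 s, normals S j 1 s & forall z', D z' -> sg * dot s z' <= sg * dot s z].

(** Half-spaces containing [D], given by normal and offset; solved for the coordinate [j], each
    reads [sg * z 0 j <= - val p u]. *)
Let A : set (vec * R) := [set p | normals S j 1 p.1 /\
  forall z, D z -> sg * dot p.1 z <= p.2].

Let val (p : vec * R) u := sg * dot (del_coord j p.1) u - p.2.

Lemma sg_sq : sg * sg = 1.
Proof. by case: sgP => ->; rewrite ?mulrNN mulr1. Qed.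

Lemma norm_sg : `|sg| = 1.
Proof. by case: sgP => ->; rewrite ?normrN normr1. Qed.

Let A_closed : closed A.
Proof.
have -> : A = [set p | normals S j 1 p.1] `&`
    \bigcap_(z in D) [set p | sg * dot p.1 z <= p.2].
  by apply/seteqP; split => p.
apply: closedI.
  have -> : [set p : vec * R | normals S j 1 p.1] = fst @^-1` (normals S j 1) by [].
  by apply: closed_comp; [move=> x _; exact: cvg_fst|exact: closed_normals].
apply: closed_bigI => z _; apply: closed_le_fun; last by move=> x; exact: cvg_snd.
apply: contM; first exact: cont_cst.
apply: continuous_Sform; last exact: cont_cst.
by move=> x; exact: cvg_fst.
Qed.

(** The offset is bounded below by a point [z1] of [D] and above on a superlevel set of [val], so
    the maximum is over a compact set. *)
Let max_val u : boundary_points !=set0 ->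
  exists p, A p /\ forall p', A p' -> val p' u <= val p u.
Proof.
move=> [z1 [Dz1 [s1 s1N s1D]]].
have A1 : A (s1, sg * dot s1 z1) by split.
set p1 := (s1, _) in A1.
have [cb cb0 dotb] := @Sform_bound R d 1%:M.
have [cb' cb'0 dotb'] := @Sform_bound R d.-1 1%:M.
pose K := cb * `|z1| + cb' * `|u| + `|val p1 u|.
have AK p : A p -> val p1 u <= val p u -> `|p.2| <= K.
  move=> [[_ _ p1le] pD] pval; have h1 := pD _ Dz1.
  have b1 : `|sg * dot p.1 z1| <= cb * `|z1|.
    rewrite normrM norm_sg mul1r (le_trans (dotb _ _))// ler_wpM2r//.
    by rewrite -[leRHS]mulr1 ler_wpM2l// ltW.
  have b2 : `|sg * dot (del_coord j p.1) u| <= cb' * `|u|.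
    rewrite normrM norm_sg mul1r (le_trans (dotb' _ _))// ler_wpM2r//.
    by rewrite -[leRHS]mulr1 ler_wpM2l ?(ltW cb'0)// (le_trans (norm_del_coord _ _)).
  move: b1 b2; rewrite !ler_norml => /andP[b1 b2] /andP[b3 b4].
  have b5 : 0 <= cb * `|z1| by rewrite mulr_ge0// ltW.
  have b6 : 0 <= cb' * `|u| by rewrite mulr_ge0// ltW.
  have := normr_ge0 (val p1 u); have := ler_norm (- val p1 u); rewrite normrN.
  by move: pval; rewrite {2}/val /K => h5 h6 h7; apply/andP; split; lra.
have cval : continuous (fun p => val p u).
  apply: contB; last by move=> x; exact: cvg_snd.
  apply: contM; first exact: cont_cst.
  apply: continuous_Sform; last exact: cont_cst.
  move=> x; apply: (@continuous_comp _ _ _ fst (@del_coord R d j)); first exact: cvg_fst.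
  exact: del_coord_continuous.
pose A' := A `&` [set p | val p1 u <= val p u].
have cA' : compact A'.
  apply: (@subclosed_compact _ _ (normals S j 1 `*` `[- K, K])).
  - apply: closedI => //; apply: closed_le_fun => //; exact: cont_cst.
  - by apply: compact_setX; [exact: compact_normals|exact: segment_compact].
  - move=> p [Ap pv]; split; first exact: Ap.1.
    by rewrite /= in_itv /= -ler_norml; exact: AK.
have [p /set_mem[Ap pv] pmax] :=
  compact_EVT_max (ex_intro _ p1 (conj A1 (lexx _))) cA' (continuous_subspaceT cval).
exists p; split => // p' Ap'.
have [h|/ltW h] := leP (val p1 u) (val p' u); first exact: pmax (mem_set (conj Ap' h)).
exact: le_trans h pv.
Qed.

(** With [g] the maximum of the [val p], [D] lies in [sg * z 0 j <= - g] with equality at the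
    boundary points. A boundary point is needed to start with: it supplies a half-space, so that [g]
    is defined. *)
Lemma normal_cover : exists C h,
  [/\ compact C, C `<=` [set x : vec | x 0 j = 1 /\ 0 <= Sform S x x],
    in_Hclass j C h & boundary_points `<=` [set z | h z = 0]] \/ boundary_points = set0.
Proof.
have [->|/set0P B0] := eqVneq boundary_points set0; first by exists set0, (fun=> 0); right.
have [X HX] := choice (fun u => max_val u B0).
pose g u := val (X u) u.
have gub u p : A p -> val p u <= g u by exact: (HX u).2.
have [z1 [Dz1 [s1 s1N s1D]]] := B0.
have A1 : A (s1, sg * dot s1 z1) by split.
set p1 := (s1, _) in A1.
have gc : convex_function setT g.
  apply: convex_functionI => t u v /andP[t0 t1]; rewrite {1}/g.
  set p := X _.
  have -> : val p (t *: u + (1 - t) *: v) = t * val p u + (1 - t) * val p v.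
    by rewrite /val !SformE; ring.
  by rewrite lerD// ler_wpM2l ?subr_ge0//; apply: gub; exact: (HX _).1.
have gl : lin_growth g.
  have [cb cb0 dotb] := @Sform_bound R d 1%:M.
  have [cb' cb'0 dotb'] := @Sform_bound R d.-1 1%:M.
  exists (cb' + cb * `|z1| + `|p1.2|) => u.
  have b2 p : A p -> `|sg * dot (del_coord j p.1) u| <= cb' * `|u|.
    move=> [[_ _ ple] _]; rewrite normrM norm_sg mul1r (le_trans (dotb' _ _))// ler_wpM2r//.
    by rewrite -[leRHS]mulr1 ler_wpM2l ?(ltW cb'0)// (le_trans (norm_del_coord _ _)).
  have [Ap _] := HX u; have := gub u _ A1; have := b2 _ A1; have := b2 _ Ap.
  have h1 := Ap.2 _ Dz1.
  have : `|sg * dot (X u).1 z1| <= cb * `|z1|.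
    case: Ap => [[_ _ ple] _]; rewrite normrM norm_sg mul1r (le_trans (dotb _ _))//.
    by rewrite ler_wpM2r// -[leRHS]mulr1 ler_wpM2l// ltW.
  rewrite !ler_norml /g /val => /andP[e1 e2] /andP[e3 e4] /andP[e5 e6] e7.
  have e8 : 0 <= cb * `|z1| by rewrite mulr_ge0// ltW.
  have e9 : 0 <= cb * `|z1| * `|u| by rewrite mulr_ge0.
  have e10 : 0 <= `|p1.2| * `|u| by [].
  have := ler_norm (p1.2); have := ler_norm (- p1.2); rewrite normrN => e11 e12.
  by rewrite mulrDr !mulrDl mulr1; apply/andP; split; lra.
have cvx0 : convex_function setT (fun _ : 'rV[R]_d.-1 => 0 : R).
  by apply: convex_functionI => *; rewrite !mulr0 addr0.
have lin0 : lin_growth (fun _ : 'rV[R]_d.-1 => 0 : R).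
  by exists 0 => x; rewrite normr0 mul0r.
pose h z := z 0 j + sg * g (del_coord j z).
have gradh z : differentiable g (del_coord j z) -> normals S j 1 (grad h z).
  move=> dg; set u := del_coord j z; have [Ap _] := HX u; set p := X u in Ap.
  pose m z' := g (del_coord j z') - sg * dot (del_coord j p.1) (del_coord j z').
  rewrite (@grad_touch _ _ h z p.1 m (fun=> 0) sg); first exact: Ap.1.
  - move=> z'; rewrite (dot_split j) /h /m; have [[-> _ _] _] := Ap.
    rewrite subr0; move: (g _) (dot (del_coord j p.1) _) => G0 D0.
    by rewrite mulrBr mulrA sg_sq; ring.
  - have dd : differentiable (@del_coord R d j) z.
      exact/linear_differentiable/del_coord_continuous.
    have D1 : differentiable (g \o @del_coord R d j) z by exact: differentiable_comp.
    have D3 : differentiable ((dot (del_coord j p.1) : _ -> R^o) \o @del_coord R d j) z.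
      apply: differentiable_comp => //; apply: linear_differentiable.
      by apply: continuous_Sform; [exact: cont_cst|exact: cont_id].
    suff : differentiable ((g \o @del_coord R d j) -
       sg *: ((dot (del_coord j p.1) : _ -> R^o) \o @del_coord R d j)) z by [].
    by apply: differentiableB => //; exact: differentiableZ.
  - exact: differentiable_cst.
  - move=> z'; have := gub (del_coord j z') _ Ap; rewrite /m /val -/u.
    by have -> : g u = val p u by []; rewrite /val; lra.
  - by [].
exists (normals S j 1), h; left; split.
- exact: compact_normals.
- by move=> x [].
- have [sg1|sg1] := sgP.
    exists g, (fun=> 0); do 4 (split => //); split => [x|x dg _]; last exact: gradh.
    by rewrite /h sg1 mul1r subr0.
  exists (fun=> 0), g; do 4 (split => //); split => [x|x _ dg]; last exact: gradh.
  by rewrite /h sg1 mulN1r addr0.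
- move=> z [Dz [s sN sD]] /=; rewrite /h.
  suff -> : g (del_coord j z) = - (sg * z 0 j) by rewrite mulrN mulrA sg_sq mul1r subrr.
  have As : A (s, sg * dot s z) by split.
  apply/eqP; rewrite eq_le; apply/andP; split.
    have [Ap _] := HX (del_coord j z); rewrite /g; set p := X _ in Ap *.
    have := Ap.2 _ Dz; rewrite /val (dot_split j); have [[-> _ _] _] := Ap.
    by rewrite mul1r mulrDr; lra.
  apply: le_trans (gub _ _ As); rewrite /val /= (dot_split j s z).
  by case: sN => -> _ _; rewrite mul1r mulrDr; lra.
Qed.

End NormalCover.

(** * Attainment and stability of the maximum that defines [psi] *)

Section Projection.
Context {R : realType} {d : nat}.
Set Implicit Arguments.
Unset Strict Implicit.
Variables (S : 'M[R]_d) (G : set 'rV[R]_d).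
Hypotheses (ST : S^T = S) (mG : maximal_S_monotone S G).
Local Notation vec := 'rV[R]_d.
Local Notation q x := (Sform S x x / 2).
Local Notation a x y := (Sform S x y - Sform S x x / 2).
Implicit Types (x y z : vec).

Lemma maximal_closed : closed G.
Proof.
have [mono max] := mG.
have cl y : closed [set x | 0 <= Sform S (x - y) (x - y)].
  apply: closed_le_fun; first exact: cont_cst.
  have c : continuous (fun x : vec => x - y) by apply: cont_subv; [exact: cont_id|exact: cont_cst].
  exact: continuous_Sform.
have step y (A : set vec) : A `<=` [set x | 0 <= Sform S (x - y) (x - y)] ->
    closure A `<=` [set x | 0 <= Sform S (x - y) (x - y)].
  by move=> sub x /(closureS sub); rewrite -(closure_id _).1.
rewrite -(max (closure G)); first exact: closed_closure.
  move=> x y Gx Gy; apply: (step y G) Gx => x' Gx' /=.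
  have -> : x' - y = - (y - x') by rewrite opprB.
  rewrite SformNl SformNr opprK; apply: (step x' G) Gy => y' Gy' /=.
  exact: mono.
exact: subset_closure.
Qed.

Lemma maximal_neq0 : G !=set0.
Proof.
have [mono max] := mG; apply: contrapT => nG.
apply: (nG); exists 0; rewrite -(max [set 0])//.
  by move=> _ _ -> ->; rewrite subrr Sform0l.
by move=> x Gx; exfalso; apply: nG; exists x.
Qed.

Definition dompsi : set vec := [set y | exists c, forall x, G x -> a x y <= c].

Lemma cont_a y : continuous (fun x => a x y).
Proof.
apply: contB; first by apply: continuous_Sform; [exact: cont_id|exact: cont_cst].
apply: contM; last exact: cont_cst.
by apply: continuous_Sform; exact: cont_id.
Qed.

Lemma psi_PG y x : PG S G y x -> psi S G y = (a x y)%:E.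
Proof.
move=> [Gx xmax]; apply/eqP; rewrite eq_le; apply/andP; split.
  by apply: ge_ereal_sup => _ [x' Gx' <-]; rewrite lee_fin; exact: xmax.
by apply: ereal_sup_ubound; exists x.
Qed.

Lemma psi_ge y x : G x -> ((a x y)%:E <= psi S G y)%E.
Proof. by move=> Gx; apply: ereal_sup_ubound; exists x. Qed.

Lemma psi_le y c : (forall x, G x -> a x y <= c) -> (psi S G y <= c%:E)%E.
Proof. by move=> H; apply: ge_ereal_sup => _ [x' Gx' <-]; rewrite lee_fin; exact: H. Qed.

Lemma dompsiP y : (psi S G y < +oo)%E -> dompsi y.
Proof.
have [x0 Gx0] := maximal_neq0; have := psi_ge y Gx0.
case E : (psi S G y) => [c| |]// _ _.
by exists c => x Gx; rewrite -lee_fin -E psi_ge.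
Qed.

Lemma PG_of_psi y x : G x -> psi S G y = (a x y)%:E -> PG S G y x.
Proof. by move=> Gx e; split => // x' Gx'; rewrite -lee_fin -e psi_ge. Qed.

Definition dual_domain : set vec := [set Sapply S y | y in dompsi].

(** Only outer normals [s] with [S(s, s) >= 0] are excluded, the sort that directions of unbounded
    sequences in a monotone set can produce. *)
Definition interior_point y := forall j sg, sg = 1 \/ sg = -1 ->
  ~ boundary_points S j dual_domain sg (Sapply S y).

(* Otherwise the directions of an unbounded sequence in [G] along which
   [a x y] is bounded below accumulate at a normal to [dual_domain]. *)
Lemma superlevel_bounded y c0 : dompsi y -> interior_point y ->
  exists K, forall x, G x -> c0 <= a x y -> `|x| <= K.
Proof.
move=> dy iy; apply: contrapT => nK.
have ex (n : nat) : exists x, [/\ G x, c0 <= a x y & n.+1%:R < `|x|].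
  apply: contrapT => nx; apply: nK; exists n.+1%:R => x Gx cx.
  by rewrite leNgt; apply/negP => xn; apply: nx; exists x.
have [X HX] := choice ex.
have Xp n : 0 < `|X n| by have [_ _] := HX n; apply: lt_trans; rewrite ltr0n.
pose s n := `|X n|^-1 *: X n.
have s1 n : `|s n| = 1.
  by rewrite normrZ normrV ?unitfE ?gt_eqF// normr_id mulVf// gt_eqF.
have sphere_compact : compact [set x : vec | `|x| <= 1].
  apply: bounded_closed_compact.
    exists 1; split; first exact: num_real.
    by move=> k Kk x xK; exact: le_trans xK (ltW Kk).
  by apply: closed_le_fun; [exact: norm_continuous|exact: cont_cst].
have [|sl [_ clus]] := sphere_compact (s @ \oo) _.
  by exists 0%N => // n _ /=; rewrite s1.
have lim (C : set vec) : closed C -> (\forall n \near \oo, C (s n)) -> C sl.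
  by move=> cC nC; apply: cC => B nB; exact: (clus _ _ nC nB).
have small (B : R) : forall e, 0 < e -> \forall n \near \oo, B / `|X n| <= e.
  move=> e e0; exists (Num.truncn (`|B| / e)).+1 => // n /= Bn.
  have [_ _ Xn] := HX n.
  rewrite ler_pdivrMr// (le_trans (ler_norm B))// -ler_pdivrMl// mulrC.
  rewrite (le_trans (ltW (truncnS_gt _)))// (le_trans _ (ltW Xn))// ler_nat.
  by rewrite (leq_trans Bn).
have le_eps (u v : R) : (forall e, 0 < e -> u <= v + e) -> u <= v by move=> /ler_addgt0Pr.
have sl1 : `|sl| = 1.
  apply/eqP; rewrite eq_le; apply/andP; split.
    apply: (lim [set x : vec | `|x| <= 1]); last by exists 0%N => // n _ /=; rewrite s1.
    by apply: closed_le_fun; [exact: norm_continuous|exact: cont_cst].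
  apply: (lim [set x : vec | 1 <= `|x|]); last by exists 0%N => // n _ /=; rewrite s1.
  by apply: closed_le_fun; [exact: cont_cst|exact: norm_continuous].
(* [a (X n) y >= c0] and [a (X n) y' <= c'] bound [S (X n) (y' - y)] from above; after division by
   the norm the bound tends to zero. *)
have sly y' : dompsi y' -> Sform S sl y' <= Sform S sl y.
  move=> [c' Hc']; apply: le_eps => e e0.
  have : Sform S sl (y' - y) <= e.
    apply: (lim [set x : vec | Sform S x (y' - y) <= e]).
      apply: closed_le_fun; last exact: cont_cst.
      by apply: continuous_Sform; [exact: cont_id|exact: cont_cst].
    apply: filterS (small (c' - c0) e e0) => n /=; apply: le_trans.
    rewrite /s SformZl mulrC ler_wpM2r ?invr_ge0// SformDr SformNr.
    have [Gn cn _] := HX n; have := Hc' _ Gn; lra.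
  by rewrite SformDr SformNr; lra.
have [x0 Gx0] := maximal_neq0.
have [cS cS0 Sb] := Sform_bound S.
have slS : 0 <= Sform S sl sl.
  apply: le_eps => e e0; rewrite -lerBlDr sub0r.
  apply: (lim [set x : vec | - e <= Sform S x x]).
    apply: closed_le_fun; first exact: cont_cst.
    by apply: continuous_Sform; exact: cont_id.
  pose B := 2 * (cS * `|x0|) + `|Sform S x0 x0|.
  apply: filterS (small B e e0) => n /= Bn.
  have [Gn _ Xn] := HX n.
  have X1 : 1 <= `|X n| by rewrite (le_trans _ (ltW Xn))// ler1n.
  have := mG.1 _ _ Gn Gx0; rewrite !SformE (SformC x0 (X n) ST) => h.
  have h1 : Sform S (X n) x0 >= - (cS * `|x0| * `|X n|).
    by have := Sb (X n) x0; rewrite ler_norml => /andP[h1 _]; rewrite mulrAC.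
  have h3 : - (B * `|X n|) <= Sform S (X n) (X n).
    have h4 : `|Sform S x0 x0| <= `|Sform S x0 x0| * `|X n| by rewrite ler_peMr.
    have := ler_norm (Sform S x0 x0).
    by rewrite /B mulrDl; lra.
  rewrite mulrA -expr2 mulrC.
  apply: (@le_trans _ _ (- (B / `|X n|))); first by rewrite lerN2.
  rewrite exprVn ler_pdivlMr ?exprn_gt0// mulNr expr2 mulrA divfK ?gt_eqF//.
(* A coordinate [j] of largest modulus equals [1] or [-1], which gives the index and the sign for
   [boundary_points]. *)
have [[i j] /= slj] : exists i, mx_norm sl = `|sl i.1 i.2|.
  by apply: mx_norm_neq0; rewrite -[mx_norm sl]/(`|sl|) sl1 oner_eq0.
rewrite ord1 -[mx_norm sl]/(`|sl|) sl1 in slj.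
pose sg := sl 0 j.
have sgP : sg = 1 \/ sg = -1.
  have [h|/ltW h] := leP 0 sg; [left|right]; rewrite slj -/sg.
    by rewrite ger0_norm.
  by rewrite ler0_norm// opprK.
have sg2 := sg_sq sgP.
apply: (iy j sg sgP); split; first by exists y.
exists (sg *: sl).
  split; first by rewrite mxE sg2.
    by rewrite SformZl SformZr mulrA sg2 mul1r.
  by rewrite normrZ sl1 mulr1 norm_sg.
move=> _ [y' dy' <-]; rewrite !SformZl !mulrA sg2 !mul1r -!Sform_Sapply.
exact: sly.
Qed.

Lemma PG_neq0 y : dompsi y -> interior_point y -> exists x, PG S G y x.
Proof.
move=> dy iy; have [x0 Gx0] := maximal_neq0.
have [K HK] := superlevel_bounded (a x0 y) dy iy.
have [|||x [Gx ax] xmax] := @closed_bounded_EVT_max R d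
   (G `&` [set x | a x0 y <= a x y]) (fun x => a x y) K _ _ _ (@cont_a y).
- by exists x0; split => /=.
- by apply: closedI; [exact: maximal_closed|apply: closed_le_fun; [exact: cont_cst|exact: cont_a]].
- by move=> x [Gx ax]; exact: HK.
exists x; split => // x' Gx'; have [h|/ltW h] := leP (a x0 y) (a x' y).
  exact: xmax.
exact: le_trans h ax.
Qed.

(** On the near-maximisers at distance at least [de] from [x] the maximum is attained by
    compactness, and it is strictly smaller as the maximiser is unique. *)
Lemma max_well_posed y x : dompsi y -> interior_point y -> ~ Sigma S G y ->
  PG S G y x -> forall de, 0 < de -> exists2 eta, 0 < eta &
  forall x', G x' -> a x y - eta <= a x' y -> `|x' - x| < de.
Proof.
move=> dy iy nS [Gx xmax] de de0.
have [K HK] := superlevel_bounded (a x y - 1) dy iy.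
pose B := G `&` [set x' | a x y - 1 <= a x' y] `&` [set x' | de <= `|x' - x|].
have [B0|/set0P B0] := eqVneq B set0.
  exists 1 => // x' Gx' h; rewrite ltNge; apply/negP => h'.
  by have : B x' by []; rewrite B0.
have [||x' [[Gx' ax'] x'x] x'max] := @closed_bounded_EVT_max R d B (fun x => a x y) K B0 _ _ (@cont_a y).
- apply: closedI; first apply: closedI; first exact: maximal_closed.
    by apply: closed_le_fun; [exact: cont_cst|exact: cont_a].
  apply: closed_le_fun; first exact: cont_cst.
  have c : continuous (fun x' : vec => x' - x) by apply: cont_subv; [exact: cont_id|exact: cont_cst].
  by move=> x1; apply: (@continuous_comp _ _ _ (fun x' => x' - x) Num.norm); [exact: c|exact: norm_continuous].
- by move=> x' [[? ?] _]; exact: HK.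
have lt : a x' y < a x y.
  rewrite lt_neqAle xmax// andbT; apply/negP => /eqP e; apply: nS.
  exists x, x'; split => //; split; first by split => // x1 Gx1; rewrite e xmax.
  by move=> e'; move: x'x; rewrite /= e' subrr normr0 leNgt de0.
(* The bound [1] keeps the point in the bounded superlevel set; half the gap then excludes it from
   [B]. *)
exists (Num.min 1 ((a x y - a x' y) / 2)).
  by rewrite lt_min ltr01 divr_gt0// subr_gt0.
move=> x1 Gx1 h; rewrite ltNge; apply/negP => h'.
have h1 : Num.min 1 ((a x y - a x' y) / 2) <= 1 by rewrite ge_min lexx.
have h2 : Num.min 1 ((a x y - a x' y) / 2) <= (a x y - a x' y) / 2 by rewrite ge_min lexx orbT.
have Bx1 : B x1 by split => //; split => //=; lra.
have := x'max _ Bx1; lra.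
Qed.

(** Points that lose more than [eta] in [a] lose at least [2 * Cb] after division by a small [ep],
    as much as [b] can gain; the others are close to [x], where [b] is nearly [b x]. *)
Lemma perturbed_max y x (b : vec -> R) (Cb : R) : dompsi y -> interior_point y ->
  ~ Sigma S G y -> PG S G y x -> {for x, continuous b} ->
  (forall x', `|b x'| <= Cb) -> forall e, 0 < e ->
  exists2 ep0, 0 < ep0 & forall ep, 0 < ep < ep0 ->
  forall x', G x' -> (a x' y - a x y) / ep + b x' <= b x + e.
Proof.
move=> dy iy nS Px cb bC e e0.
have Cb0 : 0 <= Cb := le_trans (normr_ge0 _) (bC x).
have /cvgrPdist_lt /(_ e e0) /nbhs_normP[de /= de0 bde] := cb.
have [eta eta0 Heta] := max_well_posed dy iy nS Px de0.
exists (eta / (2 * Cb + 1)); first by rewrite divr_gt0//; lra.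
move=> ep /andP[ep0 epl] x' Gx'.
have [h|h] := leP (a x y - eta) (a x' y).
  have h1 : (a x' y - a x y) / ep <= 0.
    by rewrite pmulr_lle0 ?invr_gt0// subr_le0; exact: Px.2.
  have : `|b x - b x'| < e by apply: bde => /=; rewrite distrC; exact: Heta.
  by rewrite ltr_norml => /andP[h2 h3]; lra.
have h1 : (a x' y - a x y) / ep <= - (2 * Cb).
  rewrite ler_pdivrMr//; have : ep * (2 * Cb + 1) <= eta.
    by rewrite -ler_pdivlMr ?ltW//; lra.
  by nra.
have := bC x; have := bC x'; rewrite !ler_norml => /andP[h2 h3] /andP[h4 h5].
lra.
Qed.

End Projection.

(** * Borel measurability of [psi], [Sigma] and the projection; null sets from (A4) *)

Section Measurability.
Context {R : realType} {d : nat}.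
Set Implicit Arguments.
Unset Strict Implicit.
Local Notation vec := 'rV[R]_d.
Local Notation Rd := (Rd R d).

Lemma open_Rd (U : set vec) : open U -> measurable (U : set Rd).
Proof. by move=> oU; apply: sub_sigma_algebra. Qed.

Lemma closed_Rd (F : set vec) : closed F -> measurable (F : set Rd).
Proof. by move=> cF; rewrite -[F]setCK; apply: measurableC; apply: open_Rd; exact: closed_openC. Qed.

Lemma continuous_Rd (f : vec -> R) : continuous f -> measurable_fun setT (f : Rd -> R).
Proof.
move=> cf; apply: (measurability _ (RGenOpens.measurableE R)) => _ [_ [a [b ->] <-]].
rewrite setTI; apply: open_Rd; apply: open_comp; last exact: interval_open.
by move=> x _; exact: cf.
Qed.

Lemma coord_Rd i : measurable_fun setT (fun x : Rd => x 0 i : R).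
Proof. exact: (@continuous_Rd (fun x => x 0 i) (@coord_continuous _ _ _ 0 i)). Qed.

Lemma Rd_measurable_fun dT (T : measurableType dT) (f : T -> Rd) :
  (forall F : set vec, closed F -> measurable (f @^-1` F)) -> measurable_fun setT f.
Proof.
move=> H; apply: (@measurability _ _ T Rd setT f (@open 'M[R]_(1, d)) erefl) => _ [U oU <-].
rewrite setTI -[U]setCK preimage_setC; apply: measurableC; apply: (H (~` U)).
exact: open_closedC.
Qed.

Lemma lsc_Rd (f : vec -> \bar R) : lower_semicontinuous f ->
  measurable_fun setT (f : Rd -> \bar R).
Proof.
move=> scif; apply: (measurability _ (ErealGenOInfty.measurableE R)).
move=> /= _ [_ [a ->]] <-; apply: measurableI => //; apply: open_Rd.
by rewrite preimage_itvoy; move/lower_semicontinuousP : scif; exact.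
Qed.

(** The index set may be uncountable; measurability comes from lower semicontinuity. *)
Lemma sup_affine_Rd (I : Type) (A : set I) (f : I -> vec -> R) :
  (forall i, continuous (f i)) ->
  measurable_fun setT (fun y : Rd => ereal_sup [set (f i y)%:E | i in A]).
Proof.
move=> cf; apply: lsc_Rd; apply/lower_semicontinuousP => a.
have -> : [set y | (a%:E < ereal_sup [set (f i y)%:E | i in A])%E] =
    \bigcup_(i in A) (f i @^-1` `]a, +oo[).
  apply/seteqP; split=> [y /= /ereal_sup_gt[_ [i Ai <-]]|y [i Ai]] /=.
    by rewrite lte_fin => h; exists i => //=; rewrite in_itv /= h.
  rewrite in_itv /= andbT => h; apply: lt_le_trans (ereal_sup_ubound _); last by exists i.
  by rewrite lte_fin.
apply: bigcup_open => i _; apply: open_comp; last exact: interval_open.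
by move=> x _; exact: cf.
Qed.

Lemma psi_Rd (S : 'M[R]_d) (G : set vec) : measurable_fun setT (psi S G : Rd -> \bar R).
Proof.
apply: (@sup_affine_Rd _ G (fun x y => Sform S x y - Sform S x x / 2)) => x.
apply: contB; last exact: cont_cst.
by apply: continuous_Sform; [exact: cont_cst|exact: cont_id].
Qed.

Lemma negligible_bigcup_count dT (T : measurableType dT) (mu : {measure set T -> \bar R})
    (I : countType) (F : I -> set T) : (forall i, mu.-negligible (F i)) ->
  mu.-negligible (\bigcup_i F i).
Proof.
move=> nF; apply: (@negligibleS _ _ _ _
    (\bigcup_n (if unpickle n is Some i then F i else set0))).
  by move=> x [i _ Fx]; exists (pickle i) => //; rewrite pickleK.
by apply: negligible_bigcup => n; case: unpickle => //; exact: negligible_set0.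
Qed.

Lemma bigcup_count_measurable dT (T : measurableType dT) (I : countType) (F : I -> set T) :
  (forall i, measurable (F i)) -> measurable (\bigcup_i F i).
Proof. by move=> mF; apply: countable_bigcupT_measurable => //; exact: countableP. Qed.

Section Graph.
Variables (S : 'M[R]_d) (G : set vec).
Hypothesis mG : maximal_S_monotone S G.

(** The inverse image of [F] under the multifunction [PG S G]. *)
Definition hit (F : set vec) : set Rd := [set y | exists2 x, F x & PG S G y x].

(** On a bounded closed piece of [G] the supremum is attained, so [PG] meets the piece exactly where
    its [psi] agrees with that of [G]; such pieces exhaust [F]. *)
Lemma measurable_hit (F : set vec) : closed F -> measurable (hit F).
Proof.
move=> cF.
pose F_ (n : nat) := G `&` F `&` [set x : vec | `|x| <= n%:R].
have cF_ n : closed (F_ n).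
  apply: closedI; first by apply: closedI => //; exact: maximal_closed mG.
  by apply: closed_le_fun; [exact: norm_continuous|exact: cont_cst].
have -> : hit F = \bigcup_n (if `[< F_ n !=set0 >] then
    setT `&` [set y | psi S (F_ n) y = psi S G y] else set0).
  apply/seteqP; split=> [y [x Fx Px]|y [n _]].
    have [n xn] : exists n : nat, `|x| <= n%:R.
      by exists (Num.truncn `|x|).+1; rewrite ltW// truncnS_gt.
    exists n => //; case: asboolP => [_|[]]; last by exists x; do 2!split => //; exact: Px.1.
    split => //=; rewrite (psi_PG Px) (@psi_PG _ _ _ _ _ x)//.
    by split; [do 2!split => //; exact: Px.1|move=> x' [[Gx' _] _]; exact: Px.2].
  case: asboolP => // n0 [_ /= e].
  have Fb x : F_ n x -> `|x| <= n%:R by case.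
  have [x [[Gx Fx] ?] xmax] := closed_bounded_EVT_max n0 (cF_ n) Fb (@cont_a _ _ S y).
  exists x => //; apply: PG_of_psi => //; rewrite -e.
  by apply: psi_PG; split.
apply: bigcup_count_measurable => n; case: asboolP => // _.
by apply: (@measurable_eqe _ Rd R setT measurableT (psi S (F_ n)) (psi S G)); exact: psi_Rd.
Qed.

(* Distinct points of [PG S G y] are separated by a rational slab in some coordinate. *)
Lemma SigmaE : Sigma S G = \bigcup_(i : 'I_d * rat * rat)
  (if (ratr i.2 < ratr i.1.2 :> R) then hit [set x : vec | ratr i.1.2 <= x 0 i.1.1] `&`
     hit [set x : vec | x 0 i.1.1 <= ratr i.2] else set0).
Proof.
apply/seteqP; split=> [y [x1 [x2 [P1 [P2 x12]]]]|y [[[j al] be] _ /=]].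
  have [j xj] : exists j, x1 0 j != x2 0 j.
    apply: contrapT => nj; apply: x12; apply/rowP => j; apply/eqP.
    by apply: contrapT => /negP h; apply: nj; exists j.
  wlog lt12 : x1 x2 P1 P2 x12 xj / x2 0 j < x1 0 j.
    move=> H; have [h|h|h] := ltgtP (x1 0 j) (x2 0 j).
    - by apply: (H x2 x1) => //; [exact: nesym|rewrite eq_sym].
    - exact: (H x1 x2).
    - by rewrite h eqxx in xj.
  have [al] := rat_in_itvoo lt12; rewrite in_itv /= => /andP[al1 al2].
  have [be] := rat_in_itvoo al1; rewrite in_itv /= => /andP[be1 be2].
  exists (j, al, be) => //=; rewrite be2.
  by split; [exists x1 => //=; exact: ltW|exists x2 => //=; exact: ltW].
case: ifP => // lt [[x1 /= h1 P1] [x2 /= h2 P2]]; exists x1, x2; do 2!split => //.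
by move=> e; move: (le_lt_trans h2 (lt_le_trans lt h1)); rewrite e ltxx.
Qed.

Lemma measurable_Sigma : measurable (Sigma S G : set Rd).
Proof.
rewrite SigmaE; apply: bigcup_count_measurable => -[[j al] be] /=; case: ifP => // _.
apply: measurableI; apply: measurable_hit; apply: closed_le_fun; try exact: cont_cst.
  exact: coord_continuous.
exact: coord_continuous.
Qed.

(** [Xopt S G Y w] unfolds to [proj_fun S G (Y w)]; detached from [Y], the map shows that [X] is a
    function of [Y] and can act on the coordinates of a plan. *)
Definition proj_fun (y : Rd) : Rd := if `[< Sigma S G y >] then 0 else xget 0 (PG S G y).

Lemma proj_funP y x : ~ Sigma S G y -> PG S G y x -> proj_fun y = x.
Proof.
move=> nS Px; rewrite /proj_fun asboolF//; have Px' := xgetPex 0 (ex_intro _ x Px).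
by apply: contrapT => xx'; apply: nS; exists (xget 0 (PG S G y)), x.
Qed.

Lemma measurable_proj_fun : measurable_fun setT proj_fun.
Proof.
apply: Rd_measurable_fun => F cF.
(* The second set holds the points sent to the default [0]: those of [Sigma] and those without a
   maximiser. *)
have -> : proj_fun @^-1` F = (hit F `\` Sigma S G) `|`
    (if `[< F 0 >] then Sigma S G `|` ~` hit setT else set0).
  apply/seteqP; split=> y.
    rewrite /preimage /= /proj_fun; case: asboolP => Sy.
      by move=> F0; right; case: asboolP => // _; left.
    case: xgetP => [x _ Px Fx|nP F0]; first by left; split => //; exists x.
    by right; case: asboolP => // _; right => -[x _ /nP].
  case=> [[[x Fx Px] nS]|]; first by rewrite /preimage /= (proj_funP nS Px).
  case: asboolP => // F0 [Sy|nh]; rewrite /preimage /= /proj_fun; case: asboolP => // _.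
  by case: xgetP => // x _ Px; exfalso; apply: nh; exists x.
apply: measurableU.
  by apply: measurableD; [exact: measurable_hit|exact: measurable_Sigma].
case: asboolP => // _; apply: measurableU; first exact: measurable_Sigma.
by apply: measurableC; apply: measurable_hit; exact: closedT.
Qed.

End Graph.

Section A4.
Variables (dT : measure_display) (T : measurableType dT) (P : probability T R).
Variables (S : 'M[R]_d) (Y : T -> Rd).
Hypothesis A4Y : A4 P S Y.
Variable (G : set vec).
Hypothesis mG : maximal_S_monotone S G.

Lemma A4_negligible j C h : compact C ->
  C `<=` [set x : vec | x 0 j = 1 /\ 0 <= Sform S x x] -> in_Hclass j C h ->
  P.-negligible [set w | h (Sapply S (Y w)) = 0].
Proof.
move=> cC sC Hh; apply: (@negligibleS _ _ _ _ (~` [set w | h (Sapply S (Y w)) <> 0])).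
  by move=> w /= ->.
exact: (A4Y cC sC Hh).
Qed.

(** Besides the rational slab a radius [n] is fixed, so that the two separated pieces of [G] are
    compact and have finite support functions. *)
Lemma negligible_Sigma : P.-negligible (Y @^-1` Sigma S G).
Proof.
pose F1 (j : 'I_d) (al : R) (n : nat) := G `&` [set x : vec | al <= x 0 j] `&` [set x : vec | `|x| <= n%:R].
pose F2 (j : 'I_d) (al : R) (n : nat) := G `&` [set x : vec | x 0 j <= al] `&` [set x : vec | `|x| <= n%:R].
pose N (i : 'I_d * rat * rat * nat) := [set w | ratr i.1.2 < ratr i.1.1.2 :> R /\
  exists x1 x2, [/\ PG S G (Y w) x1, PG S G (Y w) x2,
    F1 i.1.1.1 (ratr i.1.1.2) i.2 x1 & F2 i.1.1.1 (ratr i.1.2) i.2 x2]].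
apply: (@negligibleS _ _ _ _ (\bigcup_i N i)).
  move=> w; rewrite /preimage /= SigmaE => -[[[j al] be] _ /=].
  case: ifP => // lt [[x1 /= h1 P1] [x2 /= h2 P2]].
  pose n := (Num.truncn (`|x1| + `|x2|)).+1.
  have xn : `|x1| + `|x2| <= n%:R by rewrite ltW// truncnS_gt.
  exists (j, al, be, n) => //; split => //; exists x1, x2; split => //=.
    by do 2?split => //; [exact: P1.1|rewrite /= (le_trans _ xn)// lerDl].
  by do 2?split => //; [exact: P2.1|rewrite /= (le_trans _ xn)// lerDr].
apply: negligible_bigcup_count => -[[[j al'] be'] n]; rewrite /N /=.
set al : R := ratr al'; set be : R := ratr be'.
have [lt|nlt] := pselect (be < al); last first.
  by apply: negligibleS (negligible_set0 P) => w [].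
have [f1|nf1] := pselect (F1 j al n !=set0); last first.
  apply: negligibleS (negligible_set0 P) => w [_ [x1 [x2 [_ _ F1x1 _]]]].
  by apply: nf1; exists x1.
have [f2|nf2] := pselect (F2 j be n !=set0); last first.
  apply: negligibleS (negligible_set0 P) => w [_ [x1 [x2 [_ _ _ F2x2]]]].
  by apply: nf2; exists x2.
have cn : closed [set x : vec | `|x| <= n%:R].
  by apply: closed_le_fun; [exact: norm_continuous|exact: cont_cst].
have c1 : closed (F1 j al n).
  apply: closedI => //; apply: closedI; first exact: maximal_closed mG.
  by apply: closed_le_fun; [exact: cont_cst|exact: coord_continuous].
have c2 : closed (F2 j be n).
  apply: closedI => //; apply: closedI; first exact: maximal_closed mG.
  by apply: closed_le_fun; [exact: coord_continuous|exact: cont_cst].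
have [||||x y [[Gx _] _] [[Gy _] _]|C [h [cC sC Hh hz]]] :=
  @equal_support_cover R d S j (F1 j al n) (F2 j be n) al be n%:R f1 f2 c1 c2 _ _ _ _ lt _.
- by move=> x [].
- by move=> x [].
- by move=> x [[_ ?] _].
- by move=> x [[_ ?] _].
- exact: mG.1.
apply: negligibleS (A4_negligible cC sC Hh) => w [_ [x1 [x2 [P1 P2 F1x1 F2x2]]]] /=.
have e : Sform S x1 (Y w) - Sform S x1 x1 / 2 = Sform S x2 (Y w) - Sform S x2 x2 / 2.
  by apply/eqP; rewrite eq_le P1.2 ?P2.2//; [exact: P1.1|exact: P2.1].
apply: (hz _ x1 x2) => //; rewrite -!Sform_Sapply// => x.
  by case=> -[Gx _] _; rewrite -Sform_Sapply; exact: P1.2.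
by case=> -[Gx _] _; rewrite -Sform_Sapply; exact: P2.2.
Qed.

(** Failure of [interior_point] singles out one of finitely many pairs of a coordinate and a sign,
    and each pair is covered by one function of (A4). *)
Lemma negligible_boundary : P.-negligible
  [set w | dompsi S G (Y w) /\ ~ interior_point S G (Y w)].
Proof.
pose N (i : 'I_d * bool) := [set w |
  boundary_points S i.1 (dual_domain S G) ((-1) ^+ i.2) (Sapply S (Y w))].
apply: (@negligibleS _ _ _ _ (\bigcup_i N i)).
  move=> w [_ /existsNP[j /existsNP[sg /not_implyP[sgP /contrapT]]]].
  by case: sgP => -> B; [exists (j, false)|exists (j, true)].
apply: negligible_bigcup_count => -[j b]; rewrite /N /=.
have sgP : ((-1) ^+ b = 1 :> R) \/ ((-1) ^+ b = -1 :> R).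
  by case: b; [right; rewrite expr1|left; rewrite expr0].
have [C [h [[cC sC Hh hz]|B0]]] := normal_cover S j (dual_domain S G) sgP.
  by apply: negligibleS (A4_negligible cC sC Hh) => w /hz.
by apply: negligibleS (negligible_set0 P) => w /=; rewrite B0.
Qed.

End A4.
End Measurability.

(** * Integrable and square-integrable random variables *)

Section SquareIntegrable.
Context {R : realType} {dT : measure_display} {T : measurableType dT}.
Set Implicit Arguments.
Unset Strict Implicit.
Variable P : probability T R.
Implicit Types f g h : T -> R.
Local Notation intg f := (P.-integrable setT (EFin \o f)).
Local Notation E f := (\int[P]_w f w).

Lemma EFin_E f : intg f -> (E f)%:E = (\int[P]_w (f w)%:E)%E.
Proof. by move=> fi; rewrite fineK//; exact: integrable_fin_num. Qed.

Lemma intg_meas f : intg f -> measurable_fun setT f.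
Proof. by move=> /integrableP[/measurable_EFinP]. Qed.

Lemma intgD f g : intg f -> intg g -> intg (fun w => f w + g w).
Proof. by move=> fi gi; exact: (integrableD measurableT fi gi). Qed.

Lemma intgZ (a : R) f : intg f -> intg (fun w => a * f w).
Proof. by move=> fi; exact: (integrableZl measurableT a fi). Qed.

Lemma intgB f g : intg f -> intg g -> intg (fun w => f w - g w).
Proof. by move=> fi gi; exact: (integrableB measurableT fi gi). Qed.

Lemma intg_cst (a : R) : intg (fun=> a).
Proof. exact: finite_measure_integrable_cst. Qed.

Lemma E_cst (a : R) : E (fun=> a) = a.
Proof.
rewrite Rintegral_cst//; suff -> : fine (P setT) = 1 by rewrite mulr1.
by rewrite probability_setT.
Qed.

Lemma intg_le f g : measurable_fun setT f -> (forall w, `|f w| <= g w) -> intg g -> intg f.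
Proof.
move=> mf fg; apply: le_integrable => //; first exact: measurableT_comp.
by move=> w _ /=; rewrite lee_fin (le_trans (fg w))// ler_norm.
Qed.

Lemma intg_norm f : intg f -> intg (fun w => `|f w|).
Proof. by move=> fi; exact: (integrable_norm fi). Qed.

Lemma intg_sum (I : Type) (s : seq I) (f : I -> T -> R) : (forall i, intg (f i)) ->
  intg (fun w => \sum_(i <- s) f i w).
Proof.
move=> fi; elim: s => [|i s IH].
  by under eq_fun do rewrite big_nil; exact: intg_cst.
by under eq_fun do rewrite big_cons; exact: intgD.
Qed.

Lemma E_D f g : intg f -> intg g -> E (fun w => f w + g w) = E f + E g.
Proof. by move=> fi gi; rewrite RintegralD. Qed.

Lemma E_B f g : intg f -> intg g -> E (fun w => f w - g w) = E f - E g.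
Proof. by move=> fi gi; rewrite RintegralB. Qed.

Lemma E_Z (a : R) f : intg f -> E (fun w => a * f w) = a * E f.
Proof. by move=> fi; rewrite RintegralZl. Qed.

Lemma E_le f g : intg f -> intg g -> (forall w, f w <= g w) -> E f <= E g.
Proof. by move=> fi gi fg; apply: le_Rintegral. Qed.

Lemma E_sum (I : Type) (s : seq I) (f : I -> T -> R) : (forall i, intg (f i)) ->
  E (fun w => \sum_(i <- s) f i w) = \sum_(i <- s) E (f i).
Proof.
move=> fi; elim: s => [|i s IH].
  rewrite big_nil; under eq_Rintegral do rewrite big_nil.
  by rewrite Rintegral_cst// mul0r.
rewrite big_cons -IH -E_D//; last exact: intg_sum.
by apply: eq_Rintegral => w _; rewrite big_cons.
Qed.

Lemma E_eq0_ae f : intg f -> (forall w, 0 <= f w) -> E f = 0 ->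
  {ae P, forall w, f w = 0}.
Proof.
move=> fi f0 E0.
have mf : measurable_fun setT (EFin \o f) by case/integrableP: fi.
have : ae_eq P setT (EFin \o f) (cst 0%E).
  apply/ae_eq_integral_abs => //.
  under eq_integral do rewrite gee0_abs ?lee_fin//.
  by rewrite -EFin_E// E0.
by apply: filterS => w /(_ I) [].
Qed.

Lemma E_ae f g : intg f -> intg g -> {ae P, forall w, f w = g w} -> E f = E g.
Proof.
move=> fi gi fg; apply/EFin_inj; rewrite !EFin_E//.
apply: ae_eq_integral => //; [by case/integrableP: fi|by case/integrableP: gi|].
by apply: filterS fg => w e _ /=; rewrite e.
Qed.

Lemma E_dominated (f_ : nat -> T -> R) f g :
  (forall n, measurable_fun setT (f_ n)) -> measurable_fun setT f -> intg g ->
  {ae P, forall w, f_ ^~ w @ \oo --> f w} ->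
  (forall n w, `|f_ n w| <= g w) ->
  (fun n => E (f_ n)) @ \oo --> E f /\ intg f.
Proof.
move=> mf_ mf gi cv dom.
have [||||fi _ H] := @dominated_convergence _ _ _ P setT measurableT
  (fun n => EFin \o f_ n) (EFin \o f) (EFin \o g) _ _ _ gi _.
- by move=> n; exact: measurableT_comp.
- exact: measurableT_comp.
- by apply: filterS cv => w cvw _; apply/fine_cvgP; split => //; exists 0%N.
- by apply: aeW => w n _ /=; rewrite lee_fin.
split => //; have fi_ n : intg (f_ n) by apply: intg_le gi.
have : (fun n => (E (f_ n))%:E) @ \oo --> (E f)%:E.
  by rewrite EFin_E//; under eq_fun do rewrite EFin_E//.
by move/fine_cvgP => [_]; apply: cvg_trans; apply: near_eq_cvg; near=> n.
Unshelve. all: by end_near. Qed.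

Definition L2 f := measurable_fun setT f /\ intg (fun w => f w ^+ 2).

Lemma L2_meas f : L2 f -> measurable_fun setT f. Proof. by case. Qed.

Lemma L2_le f g : measurable_fun setT f -> (forall w, `|f w| <= g w) -> L2 g -> L2 f.
Proof.
move=> mf fg [mg gi]; split => //; apply: intg_le gi; first exact: measurable_funX.
move=> w; rewrite normrX; apply: lerXn2r; rewrite ?nnegrE//.
exact: le_trans (fg w).
Qed.

Lemma L2M f g : L2 f -> L2 g -> intg (fun w => f w * g w).
Proof.
move=> [mf fi] [mg gi].
apply: (@intg_le _ (fun w => f w ^+ 2 + g w ^+ 2)); [exact: measurable_funM| |exact: intgD].
move=> w; rewrite ler_norml; apply/andP; split; nra.
Qed.

Lemma L2D f g : L2 f -> L2 g -> L2 (fun w => f w + g w).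
Proof.
move=> Lf Lg; split; first by apply: measurable_funD; exact: L2_meas.
have -> : (fun w => (f w + g w) ^+ 2) =
  (fun w => f w * f w + (2 * (f w * g w) + g w * g w)) by apply/funext => w; ring.
by apply: intgD; [exact: L2M|apply: intgD; [apply: intgZ|]; exact: L2M].
Qed.

Lemma L2Z (a : R) f : L2 f -> L2 (fun w => a * f w).
Proof.
move=> Lf; split; first by apply: measurable_funM => //; exact: L2_meas.
have -> : (fun w => (a * f w) ^+ 2) = (fun w => a ^+ 2 * (f w * f w)).
  by apply/funext => w; ring.
by apply: intgZ; exact: L2M.
Qed.

Lemma L2_cst (a : R) : L2 (fun=> a).
Proof. by split; [exact: measurable_cst|exact: intg_cst]. Qed.

Lemma L2_sum (I : Type) (s : seq I) (f : I -> T -> R) : (forall i, L2 (f i)) ->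
  L2 (fun w => \sum_(i <- s) f i w).
Proof.
move=> fi; elim: s => [|i s IH].
  by under eq_fun do rewrite big_nil; exact: L2_cst.
by under eq_fun do rewrite big_cons; exact: L2D.
Qed.

Lemma L2_intg f : L2 f -> intg f.
Proof.
move=> Lf; have := L2M Lf (L2_cst 1); congr (integrable _ _ _).
by apply/funext => w /=; rewrite mulr1.
Qed.

Lemma L2_norm f : L2 f -> L2 (fun w => `|f w|).
Proof.
move=> [mf fi]; split; first exact: measurableT_comp.
by under eq_fun do rewrite real_normK ?num_real//.
Qed.

(** The negative part of [f] is dominated by [|g|]; the bound on the integral then controls the
    positive part. *)
Lemma ereal_integrable (f : T -> \bar R) g : measurable_fun setT f -> intg g ->
  (forall w, ((g w)%:E <= f w)%E) -> (\int[P]_w f w < +oo)%E -> P.-integrable setT f.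
Proof.
move=> mf gi gf fy; have mg := intg_meas gi.
have fn : (\int[P]_w f^\- w < +oo)%E.
  have /integrableP[_] := intg_norm gi; apply: le_lt_trans; apply: ge0_le_integral => //.
  - exact: measurable_funeneg.
  - by apply: measurableT_comp => //; apply: measurableT_comp => //; exact: measurableT_comp.
  - move=> w _ /=; rewrite normr_id; rewrite funenegE; have := gf w.
    case: (f w) => [r| |] //=; rewrite ?lee_fin.
    + move=> h; rewrite ge_max !lee_fin normr_ge0 andbT.
      by have := ler_norm (- g w); rewrite normrN; lra.
    + by move=> _; rewrite maxNye lee_fin.
have fp : (\int[P]_w f^\+ w < +oo)%E.
  move: fy; rewrite integralE; have : (0 <= \int[P]_w f^\- w)%E.
    by apply: integral_ge0 => w _; exact: funeneg_ge0.
  have : (0 <= \int[P]_w f^\+ w)%E.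
    by apply: integral_ge0 => w _; exact: funepos_ge0.
  case: (\int[P]_w f^\+ w)%E => [r| |] //; first by rewrite ltry.
  by case: (\int[P]_w f^\- w)%E fn.
apply/integrableP; split => //.
under eq_integral do rewrite -/((abse \o f) _) fune_abse.
rewrite ge0_integralD//; [exact: lte_add_pinfty|exact: measurable_funepos|exact: measurable_funeneg].
Qed.

End SquareIntegrable.

(** * From events in [X] to square-integrable functions of [X] *)

Section Orthogonality.
Context {R : realType} {dT : measure_display} {T : measurableType dT}.
Context {dU : measure_display} {W : measurableType dU}.
Set Implicit Arguments.
Unset Strict Implicit.
Variables (P : probability T R) (X : T -> W) (U : T -> R).
Hypotheses (mX : measurable_fun setT X) (LU : L2 P U)
  (XU : forall A, measurable A -> (\int[P]_(w in X @^-1` A) (U w)%:E = 0)%E).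
Local Notation E f := (\int[P]_w f w).

Lemma E_restrict (A : set W) (V : T -> R) : P.-integrable setT (EFin \o V) -> measurable A ->
  P.-integrable setT (EFin \o (fun w => \1_A (X w) * V w)) /\
  (E (fun w => \1_A (X w) * V w))%:E = (\int[P]_(w in X @^-1` A) (V w)%:E)%E.
Proof.
move=> Vi mA.
have i1 : P.-integrable setT (EFin \o (fun w => \1_A (X w) * V w)).
  apply: intg_le (intg_norm Vi).
    apply: measurable_funM; last exact: intg_meas Vi.
    exact: (measurableT_comp (measurable_indic mA) mX).
  move=> w; rewrite normrM indicE; case: (_ \in _); rewrite ?normr1 ?mul1r//.
  by rewrite normr0 mul0r.
split => //; rewrite EFin_E// [RHS]integral_mkcond; apply: eq_integral => w _.
rewrite patchE indicE; have -> : (w \in X @^-1` A) = (X w \in A).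
  by apply/idP/idP => /set_mem h; exact/mem_set.
by case: (_ \in _); rewrite ?mul1r ?mul0r.
Qed.

Import HBNNSimple.

Lemma orth_simple (g : {nnsfun W >-> R}) : E (fun w => g (X w) * U w) = 0.
Proof.
pose s : seq R := finmap.enum_fset (fset_set (range g)).
have -> : E (fun w => g (X w) * U w) =
    E (fun w => \sum_(i < size s) s`_i * (\1_(g @^-1` [set s`_i]) (X w) * U w)).
  apply: eq_Rintegral => w _; rewrite (fimfunEord g) mulr_suml.
  by apply: eq_bigr => i _; rewrite mulrA.
have mg i : measurable (g @^-1` [set s`_i]) by exact: measurable_funPTI.
have ei i := E_restrict (L2_intg LU) (mg i).
rewrite E_sum; last by move=> i; apply: intgZ; exact: (ei i).1.
apply: big1 => i _; rewrite E_Z; last exact: (ei i).1.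
apply/eqP; rewrite mulf_eq0; apply/orP; right; apply/eqP/EFin_inj.
exact: etrans (ei i).2 (XU (mg i)).
Qed.

(** Simple functions increase to [f], and [|f(X) U|] dominates, being a product of two [L2]
    functions. *)
Lemma orth_ge0 (f : W -> R) : measurable_fun setT f -> (forall x, 0 <= f x) ->
  L2 P (f \o X) -> E (fun w => f (X w) * U w) = 0.
Proof.
move=> mf f0 Lf.
have mfE : measurable_fun setT (EFin \o f) by exact: measurableT_comp.
pose g n := nnsfun_approx measurableT mfE n.
have cvg_g x : (fun n => g n x) @ \oo --> f x.
  have /fine_cvgP[_] := @cvg_nnsfun_approx _ _ _ _ measurableT _ mfE
    (fun x _ => f0 x : (0 <= (EFin \o f) x)%E) x I.
  by apply: cvg_trans; apply: near_eq_cvg; near=> n.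
have gf n x : g n x <= f x.
  have nd : nondecreasing_seq (fun n => g n x).
    by move=> k l kl; have /lefP := nd_nnsfun_approx measurableT mfE kl; exact.
  have := nondecreasing_cvgn_le nd (cvgP _ (cvg_g x)) n.
  by rewrite (cvg_lim _ (cvg_g x)).
have [|||||cv _] := @E_dominated _ _ _ P (fun n w => g n (X w) * U w)
   (fun w => f (X w) * U w) (fun w => `|f (X w) * U w|).
- move=> n; apply: measurable_funM; last exact: L2_meas LU.
  by apply: (measurableT_comp _ mX); exact: measurable_funPT.
- apply: measurable_funM; [exact: (measurableT_comp mf mX)|exact: L2_meas LU].
- by apply: intg_norm; exact: L2M Lf LU.
- by apply: aeW => w; apply: cvgM; [exact: cvg_g|exact: cvg_cst].
- by move=> n w; rewrite !normrM ler_wpM2r// !ger0_norm.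
have : (fun n => E (fun w => g n (X w) * U w)) @ \oo --> 0.
  by under eq_fun do rewrite orth_simple; exact: cvg_cst.
by move/(cvg_unique _ cv); exact.
Unshelve. all: by end_near. Qed.

Lemma orth_L2 (f : W -> R) : measurable_fun setT f ->
  L2 P (f \o X) -> E (fun w => f (X w) * U w) = 0.
Proof.
move=> mf Lf.
pose fp x := Num.max (f x) 0; pose fm x := Num.max (- f x) 0.
have mfp : measurable_fun setT fp by exact: measurable_maxr.
have mfm : measurable_fun setT fm by apply: measurable_maxr => //; exact: measurableT_comp.
have Lp : L2 P (fp \o X).
  apply: L2_le (L2_norm Lf); first exact: measurableT_comp.
  by move=> w /=; rewrite /fp ger0_norm ?le_max ?lexx ?orbT// ge_max ler_norm normr_ge0.
have Lm : L2 P (fm \o X).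
  apply: L2_le (L2_norm Lf); first exact: measurableT_comp.
  move=> w /=; rewrite /fm ger0_norm ?le_max ?lexx ?orbT// ge_max normr_ge0 andbT.
  by rewrite -normrN ler_norm.
have -> : E (fun w => f (X w) * U w) = E (fun w => fp (X w) * U w - fm (X w) * U w).
  apply: eq_Rintegral => w _; rewrite -mulrBl; congr (_ * _); rewrite /fp /fm.
  by case: (leP (f (X w)) 0) => h; case: (leP (- f (X w)) 0) => h'; lra.
rewrite E_B; [|exact: L2M Lp LU|exact: L2M Lm LU].
rewrite !orth_ge0 ?subrr// => x; by rewrite le_max lexx orbT.
Qed.

End Orthogonality.

(** * Minty's theorem for an arbitrary maximal set *)

Section MintyOfMaximal.
Context {R : realType} {d : nat}.
Set Implicit Arguments.
Unset Strict Implicit.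
Variables (S M J : 'M[R]_d) (c : R) (G : set 'rV[R]_d).
Hypotheses (ST : S^T = S) (MT : M^T = M)
  (SJ : forall x y, Sform S (x *m J) y = Sform M x y) (JJ : J *m J = 1%:M)
  (SM : forall x, `|Sform S x x| <= Sform M x x)
  (c0 : 0 < c) (Mc : forall x : 'rV[R]_d, `|x| ^+ 2 <= c * Sform M x x)
  (mG : maximal_S_monotone S G).
Local Notation vec := 'rV[R]_d.
Local Notation q x := (Sform S x x / 2).

(** A point of the epigraph [E0] of [psi S G] strictly below the graph of [q] would be monotonically
    related to all of [G], against maximality. So [E0] is admissible, and the maximal set built from
    it contains [G], hence is [G]. *)
Lemma minty_of_maximal y0 : exists2 x, G x & (y0 - x) *m J = - (y0 - x).
Proof.
pose E0 : set (vec * R) := [set p | forall x, G x -> Sform S x p.1 - q x <= p.2].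
have cE0 : cvx_set E0.
  move=> p1 p2 t H1 H2 /andP[t0 t1] x Gx /=; rewrite !SformE.
  have h1 : (1 - t) * (Sform S x p1.1 - q x) <= (1 - t) * p1.2.
    by rewrite ler_wpM2l ?subr_ge0//; exact: H1.
  have h2 : t * (Sform S x p2.1 - q x) <= t * p2.2 by rewrite ler_wpM2l//; exact: H2.
  by lra.
have qE0 : E0 `<=` above_q S.
  move=> [y r] H; rewrite /above_q /=.
  have [Gy|nGy] := pselect (G y); first by have := H _ Gy; rewrite /=; lra.
  apply: contrapT => /negP; rewrite -ltNge => yr.
  apply: nGy; rewrite -(mG.2 (G `|` [set y])); [by right| |by left].
  have Gxy x : G x -> 0 <= Sform S (x - y) (x - y).
    by move=> Gx; have /= := H _ Gx; have := q_sub ST x y; lra.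
  move=> x x' [Gx|->] [Gx'|->]; [exact: mG.1|exact: Gxy| |by rewrite subrr Sform0l].
  have -> : y - x' = - (x' - y) by rewrite opprB.
  by rewrite SformNl SformNr opprK; exact: Gxy.
have [G' [mG' G'E0 E0G' minty]] := maximal_monotone_below ST MT SJ JJ SM c0 Mc cE0 qE0.
have GG' : G' = G.
  apply: mG.2; first exact: mG'.1.
  move=> x Gx; apply: E0G' => x' Gx' /=.
  by have := mG.1 _ _ Gx' Gx; have := q_sub ST x' x; lra.
have [x G'x xJ] := minty y0; exists x; first by rewrite -GG'.
have -> : y0 - x = - (x - y0) by rewrite opprB.
by rewrite mulNmx xJ.
Qed.

End MintyOfMaximal.

(** * Lipschitz projection along negative vectors, and weak duality *)

Section WeakDuality.
Context {R : realType} {d : nat} {dT : measure_display} {T : measurableType dT}.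
Set Implicit Arguments.
Unset Strict Implicit.
Variables (P : probability T R) (S : 'M[R]_d) (G : set 'rV[R]_d) (X Y : T -> Rd R d).
Hypotheses (ST : S^T = S) (Su : S \in unitmx) (mG : maximal_S_monotone S G)
  (mX : measurable_fun setT X) (mY : measurable_fun setT Y)
  (LX : forall i, L2 P (fun w => X w 0 i)) (LY : forall i, L2 P (fun w => Y w 0 i))
  (XY : forall A : set (Rd R d), measurable A -> forall i,
    (\int[P]_(w in X @^-1` A) (Y w 0 i)%:E = \int[P]_(w in X @^-1` A) (X w 0 i)%:E)%E).
Local Notation vec := 'rV[R]_d.
Local Notation q x := (Sform S x x / 2).
Local Notation E f := (\int[P]_w f w).

Lemma intg_Sform A (X1 Y1 : T -> vec) : (forall i, L2 P (fun w => X1 w 0 i)) ->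
  (forall i, L2 P (fun w => Y1 w 0 i)) ->
  P.-integrable setT (EFin \o (fun w => Sform A (X1 w) (Y1 w))).
Proof.
move=> L1 L1'; under eq_fun do rewrite Sform_sum.
apply: intg_sum => i; apply: intg_sum => j.
under eq_fun do rewrite [_ * A i j]mulrC.
by apply: L2M => //; exact: L2Z.
Qed.

Lemma orth_Sform (f : vec -> vec) : continuous f ->
  (forall i, L2 P (fun w => f (X w) 0 i)) ->
  E (fun w => Sform S (f (X w)) (Y w)) = E (fun w => Sform S (f (X w)) (X w)).
Proof.
move=> cf Lf; apply/eqP; rewrite -subr_eq0 -E_B; [|exact: intg_Sform..].
apply/eqP; have LU i : L2 P (fun w => Y w 0 i - X w 0 i).
  by under eq_fun do rewrite -mulN1r; apply: L2D => //; exact: L2Z.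
have XU i A : measurable A -> (\int[P]_(w in X @^-1` A) (Y w 0 i - X w 0 i)%:E = 0)%E.
  move=> mA; have mXA : measurable (X @^-1` A) by rewrite -[X in measurable X]setTI; exact: mX.
  under eq_integral do rewrite EFinB.
  have iY := integrableS measurableT mXA (@subsetT _ _) (L2_intg (LY i)).
  have iX := integrableS measurableT mXA (@subsetT _ _) (L2_intg (LX i)).
  rewrite (integralB mXA iY iX) XY// subee//; exact: integrable_fin_num.
have -> : E (fun w => Sform S (f (X w)) (Y w) - Sform S (f (X w)) (X w)) =
    E (fun w => \sum_i \sum_j S i j * (f (X w) 0 i * (Y w 0 j - X w 0 j))).
  apply: eq_Rintegral => w _; rewrite -SformNr -SformDr Sform_sum.
  by apply: eq_bigr => i _; apply: eq_bigr => j _; rewrite !mxE; ring.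
have fi i j : P.-integrable setT (EFin \o (fun w => f (X w) 0 i * (Y w 0 j - X w 0 j))).
  exact: L2M.
rewrite E_sum; last by move=> i; apply: intg_sum => j; exact: intgZ.
apply: big1 => i _; rewrite E_sum; last by move=> j; exact: intgZ.
apply: big1 => j _; rewrite E_Z//.
rewrite (@orth_L2 _ _ _ _ _ P X _ mX (LU j) (XU j) (fun x : Rd R d => f x 0 i)) ?mulr0//; last exact: Lf.
apply: (@continuous_Rd _ _ (fun x => f x 0 i)) => x.
by apply: (@continuous_comp _ _ _ f (fun x : vec => x 0 i)); [exact: cf|exact: coord_continuous].
Qed.

(** [M + S] does not see negative vectors: for [D = pi x - pi y] and [e = x - y],
    [(M + S)(D, D) = (M + S)(e, e)]. Since [S(D, D) >= 0] by monotonicity,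
    [M(D, D) <= 2 M(e, e)]. *)
Lemma exists_minty_projection : exists pi : vec -> vec,
  [/\ exists L, forall x y, `|pi x - pi y| <= L * `|x - y|, forall y, G (pi y),
    forall y, q (y - pi y) <= 0 & forall y, 0 <= q (y - pi y) -> y = pi y].
Proof.
have [M [J [MT SJ JJ SM [c c0 Mc]]]] := pseudo_euclidean ST Su.
have ex y : exists x, G x /\ (x - y) *m J = - (x - y).
  have [x Gx xJ] := minty_of_maximal ST MT SJ JJ SM c0 Mc mG y; exists x; split => //.
  by rewrite -opprB mulNmx xJ.
have [pi Hpi] := choice ex.
have neg y : Sform S (y - pi y) (y - pi y) = - Sform M (y - pi y) (y - pi y).
  apply: negative_form SJ _ _; have -> : y - pi y = - (pi y - y) by rewrite opprB.
  by rewrite mulNmx (Hpi y).2.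
have PLadd (e n : vec) : (forall w, Sform M n w + Sform S n w = 0) ->
    Sform M (e + n) (e + n) + Sform S (e + n) (e + n) = Sform M e e + Sform S e e.
  move=> PLn; rewrite !SformE (SformC e n MT) (SformC e n ST).
  by have := PLn e; have := PLn n; lra.
exists pi; split.
- have [cb cb0 Mb] := Sform_bound M.
  (* The summand [1] makes [L ^+ 2] dominate [c * (2 * cb)], the constant obtained for the
     squares. *)
  pose L := c * (2 * cb) + 1.
  have cc : 0 <= c * (2 * cb) by rewrite mulr_ge0 ?mulr_ge0 ?ltW.
  exists L => x y.
  set D := pi x - pi y; set e := x - y; pose n := D - e.
  have nJ : n *m J = - n.
    have -> : n = (pi x - x) - (pi y - y).
      by rewrite /n /D /e !opprB addrACA [RHS]addrACA; congr (_ + _); rewrite addrC.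
    by rewrite mulmxBl (Hpi x).2 (Hpi y).2 [RHS]opprD.
  have PLn w : Sform M n w + Sform S n w = 0 by rewrite -SJ nJ SformNl addNr.
  have De : D = e + n by rewrite /n addrC subrK.
  have SD : 0 <= Sform S D D by apply: mG.1; [exact: (Hpi x).1|exact: (Hpi y).1].
  have MD : Sform M D D <= 2 * Sform M e e.
    have PLD : Sform M D D + Sform S D D = Sform M e e + Sform S e e.
      by rewrite De; exact: PLadd.
    by have := SM e; rewrite ler_norml => /andP[_]; lra.
  have : `|D| ^+ 2 <= c * (2 * cb) * `|e| ^+ 2.
    rewrite (le_trans (Mc D))// -mulrA ler_wpM2l ?(ltW c0)// (le_trans MD)// -mulrA ler_wpM2l//.
    by rewrite (le_trans (ler_norm _))// (le_trans (Mb _ _))// -mulrA -expr2.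
  move=> h; rewrite -(@ler_sqr _ `|D|) ?nnegrE//; last by rewrite mulr_ge0// /L addr_ge0.
  rewrite (le_trans h)// exprMn ler_wpM2r ?sqr_ge0// /L; nra.
- by move=> y; exact: (Hpi y).1.
- by move=> y; rewrite neg; have := M_ge0 SM (y - pi y); lra.
- move=> y; rewrite neg => h; apply/eqP; rewrite -subr_eq0; apply/eqP.
  by apply: (M_eq0 c0 Mc); lra.
Qed.

Hypothesis psiY : (\int[P]_w psi S G (Y w) < +oo)%E.

Lemma psi_integrable_of_L2 : P.-integrable setT (fun w => psi S G (Y w)).
Proof.
have [x0 Gx0] := maximal_neq0 mG.
apply: (@ereal_integrable _ _ _ P _ (fun w => Sform S x0 (Y w) - q x0)) => //.
- exact: (measurableT_comp (@psi_Rd R d S G) mY).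
- apply: intgB; last exact: intg_cst.
  by apply: (@intg_Sform S (fun=> x0) Y) => // i; exact: L2_cst.
- by move=> w; exact: psi_ge.
Qed.

Lemma weak_duality :
  (\int[P]_w (Sform S (X w) (Y w) / 2)%:E <= \int[P]_w psi S G (Y w))%E /\
  ((\int[P]_w psi S G (Y w) <= \int[P]_w (Sform S (X w) (Y w) / 2)%:E)%E ->
   {ae P, forall w, PG S G (Y w) (X w)}).
Proof.
have [pi [[L piL] Gpi q0 qpi]] := exists_minty_projection.
have cpi := lip_continuous piL.
have Lpi i : L2 P (fun w => pi (X w) 0 i).
  have c : continuous (fun x : vec => pi x 0 i).
    move=> x; apply: (@continuous_comp _ _ _ pi (fun x : vec => x 0 i)); first exact: cpi.
    exact: coord_continuous.
  apply: (@L2_le _ _ _ P _ (fun w => `|pi 0| + `|L| * \sum_k `|X w 0 k|)).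
  - exact: (measurableT_comp (continuous_Rd c) mX).
  - move=> w; rewrite (le_trans (norm_coord _ _))//.
    rewrite -[pi (X w)](subrK (pi 0)) addrC (le_trans (ler_normD _ _))// lerD2l.
    rewrite (le_trans (piL _ _))// subr0 (@le_trans _ _ (`|L| * `|X w : vec|))//.
      by rewrite ler_wpM2r// ler_norm.
    rewrite ler_wpM2l//; apply: norm_le; first exact: sumr_ge0.
    by move=> k; rewrite (bigD1 k)//= lerDl sumr_ge0.
  - by apply: L2D; [exact: L2_cst|apply: L2Z; apply: L2_sum => k; exact: L2_norm].
pose T1 w := Sform S (pi (X w)) (Y w) - q (pi (X w)).
pose T2 w := Sform S (pi (X w)) (X w) - q (pi (X w)).
pose qX w := q (X w : vec).
have iq (Z : T -> vec) : (forall i, L2 P (fun w => Z w 0 i)) ->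
    P.-integrable setT (EFin \o (fun w => q (Z w))).
  move=> LZ; under eq_fun do rewrite mulrC.
  by apply: intgZ; exact: intg_Sform.
have iT1 : P.-integrable setT (EFin \o T1) by apply: intgB; [exact: intg_Sform|exact: iq].
have iT2 : P.-integrable setT (EFin \o T2) by apply: intgB; [exact: intg_Sform|exact: iq].
have iqX : P.-integrable setT (EFin \o qX) by exact: iq.
have ET : E T1 = E T2.
  rewrite E_B; [|exact: intg_Sform|exact: iq].
  by rewrite E_B; [|exact: intg_Sform|exact: iq]; rewrite orth_Sform.
have iV : P.-integrable setT (EFin \o (fun w => Sform S (X w) (Y w) / 2)).
  by under eq_fun do rewrite mulrC; apply: intgZ; exact: intg_Sform.
have EV : E (fun w => Sform S (X w) (Y w) / 2) = E qX.
  rewrite /qX; under eq_Rintegral do rewrite mulrC.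
  under [RHS]eq_Rintegral do rewrite mulrC.
  rewrite !E_Z; [|exact: intg_Sform..]; congr (_ * _).
  exact: (@orth_Sform id (@cont_id _)).
have T2q w : T2 w - qX w = - q ((X w : vec) - pi (X w)).
  by rewrite /T2 /qX q_sub// (SformC (pi (X w)) (X w) ST); ring.
have T2q0 w : 0 <= T2 w - qX w by rewrite T2q oppr_ge0.
have qT1 : E qX <= E T1 by rewrite ET -subr_ge0 -E_B//; apply: Rintegral_ge0.
have ipsi := psi_integrable_of_L2.
have T1psi w : ((T1 w)%:E <= psi S G (Y w))%E by exact: psi_ge.
have ET1psi : ((E T1)%:E <= \int[P]_w psi S G (Y w))%E.
  by rewrite EFin_E//; apply: le_integral.
rewrite -EFin_E// EV; split; first by rewrite (le_trans _ ET1psi)// lee_fin.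
move=> psiV.
have e1 : (\int[P]_w psi S G (Y w) = (E T1)%:E)%E.
  by apply/eqP; rewrite eq_le ET1psi andbT (le_trans psiV)// lee_fin.
have e2 : E T1 = E qX.
  by apply/eqP; rewrite eq_le qT1 andbT -lee_fin (le_trans ET1psi).
(* Equality makes both slacks vanish: the first gives [X = pi X], so that [X] lies in [G], and the
   second makes this point a maximiser. *)
have a1 : {ae P, forall w, T2 w - qX w = 0}.
  apply: E_eq0_ae => //; first exact: intgB.
  by rewrite E_B// -ET e2 subrr.
have a2 : {ae P, forall w, psi S G (Y w) = (T1 w)%:E}.
  have mp : measurable_fun setT (fun w => psi S G (Y w)) by case/integrableP: ipsi.
  have : ae_eq P setT (fun w => psi S G (Y w) - (T1 w)%:E)%E (cst 0%E).
    apply/ae_eq_integral_abs => //.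
      by apply: emeasurable_funB => //; case/integrableP: iT1.
    under eq_integral do rewrite gee0_abs ?sube_ge0//.
    rewrite (integralB measurableT ipsi iT1) e1 -EFin_E//.
    by rewrite subee.
  apply: filterS => w /(_ I) /=; case: (psi S G (Y w)) => [r| |]//= [h].
  by congr EFin; apply/eqP; rewrite -subr_eq0 h.
apply: filterS2 a1 a2 => w h1 h2.
have Xpi : X w = pi (X w).
  by apply: qpi; move: h1; rewrite T2q => /eqP; rewrite oppr_eq0 => /eqP ->.
apply: PG_of_psi; first by rewrite Xpi.
by rewrite h2 /T1 -Xpi.
Qed.

End WeakDuality.

(** * Comparison of integrals almost surely *)

Section IntegralTools.
Context {R : realType} {dT : measure_display} {T : measurableType dT}.
Set Implicit Arguments.
Unset Strict Implicit.
Variable P : probability T R.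
Local Notation intg f := (P.-integrable setT (EFin \o f)).
Local Notation E f := (\int[P]_w f w).

Lemma negligible_ae (N : set T) : P.-negligible N -> {ae P, forall w, ~ N w}.
Proof.
move=> nN; have : P.-negligible (~` [set w | ~ N w]); last exact.
by apply: negligibleS nN => w /contrapT.
Qed.

Lemma intg_max (f g : T -> R) : intg f -> intg g -> intg (fun w => Num.max (f w) (g w)).
Proof.
move=> fi gi; apply: (@intg_le _ _ _ P _ (fun w => `|f w| + `|g w|)).
- by apply: measurable_maxr; [exact: intg_meas fi|exact: intg_meas gi].
- by move=> w; case: (leP (f w) (g w)) => _; rewrite ?lerDl ?lerDr.
- by apply: intgD; exact: intg_norm.
Qed.

(** [f] may be infinite on a null set; [k] clamps it between [g] and [u], which gives an integrable
    function almost surely equal to [f]. *)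
Lemma integral_le_ae (f : T -> \bar R) (g h : T -> R) : measurable_fun setT f ->
  intg g -> intg h -> (forall w, ((g w)%:E <= f w)%E) ->
  {ae P, forall w, (f w <= (h w)%:E)%E} -> (\int[P]_w f w <= (E h)%:E)%E.
Proof.
move=> mf gi hi gf fh.
pose u w := Num.max (h w) (g w).
pose k w := Num.max (g w) (Num.min (fine (f w)) (u w)).
have ui : intg u by exact: intg_max.
have mk : measurable_fun setT k.
  apply: measurable_maxr; first exact: intg_meas gi.
  apply: measurable_minr; last exact: intg_meas ui.
  by apply: (measurableT_comp _ mf).
have gu w : g w <= u w by rewrite /u le_max lexx orbT.
have ki : intg k.
  apply: (@intg_le _ _ _ P _ (fun w => `|g w| + `|u w|)) => //; last by apply: intgD; exact: intg_norm.
  move=> w; have kg : g w <= k w by rewrite /k le_max lexx.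
  have ku : k w <= u w by rewrite /k ge_max gu ge_min lexx orbT.
  have := ler_norm (u w); have := ler_norm (- g w); rewrite normrN => h1 h2.
  have := normr_ge0 (g w); have := normr_ge0 (u w) => h3 h4.
  by rewrite ler_norml; apply/andP; split; lra.
have fk : {ae P, forall w, f w = (k w)%:E}.
  apply: filterS fh => w; have := gf w; rewrite /k /u; case: (f w) => [r| |] //=.
  rewrite !lee_fin => gr rh; congr EFin.
  by rewrite (max_l (le_trans gr rh)) (min_l rh) (max_r gr).
rewrite (@ae_eq_integral _ _ _ P setT (EFin \o k))//.
- rewrite -EFin_E// lee_fin (@le_trans _ _ (E u))//.
    by apply: E_le => // w; rewrite /k ge_max gu ge_min lexx orbT.
  rewrite le_eqVlt; apply/orP; left; apply/eqP; apply: E_ae => //.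
  apply: filterS fh => w; have := gf w; rewrite /u; case: (f w) => [r| |] //=.
  by rewrite !lee_fin => gr rh; rewrite (max_l (le_trans gr rh)).
- exact: measurableT_comp.
- by apply: filterS fk => w e _.
Qed.

End IntegralTools.

(** * Continuous test functions of bounded support *)

Section Cutoffs.
Context {R : realType} {d : nat}.
Set Implicit Arguments.
Unset Strict Implicit.
Local Notation vec := 'rV[R]_d.

Definition cutoff (n : nat) (x : vec) : R := Num.max 0 (1 - `|x| / n.+1%:R).

Lemma cutoff_ge0 n x : 0 <= cutoff n x.
Proof. by rewrite /cutoff le_max lexx. Qed.

Lemma cutoff_le1 n x : cutoff n x <= 1.
Proof. by rewrite /cutoff ge_max ler01 gerBl divr_ge0. Qed.

Lemma cont_cutoff n : continuous (cutoff n).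
Proof.
have c : continuous (fun x : vec => 1 - `|x| / n.+1%:R).
  apply: contB; first exact: cont_cst.
  by apply: contM; [exact: norm_continuous|exact: cont_cst].
by move=> x; apply: (@continuous_max _ _ (fun=> 0) (fun x : vec => 1 - `|x| / n.+1%:R)); [exact: cont_cst|exact: c].
Qed.

Lemma cutoff_norm n x : cutoff n x * `|x| <= n.+1%:R.
Proof.
rewrite /cutoff; have [h|h] := leP (1 - `|x| / n.+1%:R) 0.
  by rewrite mul0r.
have : `|x| <= n.+1%:R.
  by move: h; rewrite subr_gt0 ltr_pdivrMr// mul1r => /ltW.
apply: le_trans; rewrite ler_piMl// gerBl divr_ge0//.
Qed.

Lemma cutoff_nd x m n : (m <= n)%N -> cutoff m x <= cutoff n x.
Proof.
move=> mn; rewrite /cutoff ge_max !le_max lexx /=; apply/orP; right.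
by rewrite lerD2l lerN2 ler_wpM2l// lef_pV2 ?posrE// ler_nat.
Qed.

Lemma cvg_inv_nat (a : R) : (fun n => a / n.+1%:R) @ \oo --> (0 : R).
Proof. by rewrite -(mulr0 a); apply: cvgM; [exact: cvg_cst|exact: cvg_harmonic]. Qed.

Lemma cvg_cutoff x : (fun n => cutoff n x) @ \oo --> (1 : R).
Proof.
apply: (@squeeze_cvgr _ _ _ _ (fun n => 1 - `|x| / n.+1%:R) (fun=> 1)).
- by near=> n; rewrite cutoff_le1 andbT /cutoff le_max lexx orbT.
- by rewrite -[X in _ --> X]subr0; apply: cvgB; [exact: cvg_cst|exact: cvg_inv_nat].
- exact: cvg_cst.
Unshelve. all: by end_near. Qed.

Section DistanceTo.
Variable F : set vec.
Hypotheses (cF : closed F) (F0 : F !=set0).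

Definition dist_to (x : vec) : R := inf [set `|x - a| | a in F].

Let has_inf_dist x : has_inf [set `|x - a| | a in F].
Proof.
have [a Fa] := F0; split; first by exists `|x - a|, a.
by exists 0 => _ [b _ <-].
Qed.

Lemma dist_to_le x a : F a -> dist_to x <= `|x - a|.
Proof. by move=> Fa; apply: ge_inf; [exact: (has_inf_dist x).2|exists a]. Qed.

Lemma dist_to_ge0 x : 0 <= dist_to x.
Proof. by apply: lb_le_inf; [exact: (has_inf_dist x).1|move=> _ [a _ <-]]. Qed.

Lemma cont_dist_to : continuous dist_to.
Proof.
have H x y : dist_to x - dist_to y <= `|x - y|.
  rewrite lerBlDr addrC -lerBlDr; apply: lb_le_inf; first exact: (has_inf_dist y).1.
  move=> _ [a Fa <-]; rewrite lerBlDr (le_trans (dist_to_le x Fa))//.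
  by rewrite -[x - a](subrKA y) addrC ler_normD.
apply: (@lip_continuous _ _ _ _ 1) => x y; rewrite mul1r ler_norml H andbT.
by rewrite lerNl opprB distrC.
Qed.

Lemma dist_to_gt0 x : ~ F x -> 0 < dist_to x.
Proof.
move=> nF; have : nbhs x (~` F) by apply: open_nbhs_nbhs; split => //; exact: closed_openC.
move=> /nbhs_normP[e /= e0 eF]; apply: lt_le_trans e0 _.
apply: lb_le_inf; first exact: (has_inf_dist x).1.
by move=> _ [a Fa <-]; rewrite leNgt; apply/negP => xa; exact: (eF a).
Qed.

(** Continuous approximation of the indicator of [F]; the cutoff keeps its product with [|x|]
    bounded, as required of test fields. *)
Definition plateau n x : R := cutoff n x * Num.max 0 (1 - n%:R * dist_to x).

Lemma plateau_bound n x : 0 <= plateau n x <= cutoff n x.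
Proof.
rewrite /plateau; have := cutoff_ge0 n x; have := cutoff_le1 n x.
have m1 : Num.max 0 (1 - n%:R * dist_to x) <= 1.
  by rewrite ge_max ler01 gerBl mulr_ge0// dist_to_ge0.
have m0 : 0 <= Num.max 0 (1 - n%:R * dist_to x) by rewrite le_max lexx.
by move=> h1 h2; rewrite mulr_ge0//= ler_piMr.
Qed.

Lemma cont_plateau n : continuous (plateau n).
Proof.
apply: contM; first exact: cont_cutoff.
have c : continuous (fun x : vec => 1 - n%:R * dist_to x).
  apply: contB; first exact: cont_cst.
  by apply: contM; [exact: cont_cst|exact: cont_dist_to].
by move=> x; apply: (@continuous_max _ _ (fun=> 0) (fun x : vec => 1 - n%:R * dist_to x)); [exact: cont_cst|exact: c].
Qed.

Lemma cvg_plateau x : (fun n => plateau n x) @ \oo --> (\1_F x : R).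
Proof.
rewrite indicE; have [Fx|nFx] := pselect (F x).
  rewrite mem_set//=; have d0 : dist_to x = 0.
    by apply/eqP; rewrite eq_le dist_to_ge0 andbT -(normr0 vec) -(subrr x) dist_to_le.
  rewrite /plateau d0; under eq_fun do rewrite mulr0 subr0 max_r// mulr1.
  exact: cvg_cutoff.
rewrite memNset//=; have d0 := dist_to_gt0 nFx.
apply: (@cvg_trans _ ((fun=> 0 : R) @ \oo)); last exact: cvg_cst.
apply: near_eq_cvg; exists (Num.truncn (dist_to x)^-1).+1 => // n /= hn.
rewrite /plateau max_l ?mulr0// subr_le0 -ler_pdivrMr// mul1r.
by rewrite (le_trans (ltW (truncnS_gt _)))// ler_nat.
Qed.

End DistanceTo.
End Cutoffs.

(** * First variation of the dual problem at an optimal set *)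

Section FirstOrder.
Context {R : realType} {d : nat} {dT : measure_display} {T : measurableType dT}.
Set Implicit Arguments.
Unset Strict Implicit.
Variables (P : probability T R) (S : 'M[R]_d) (G : set 'rV[R]_d) (Y : T -> Rd R d).
Hypotheses (ST : S^T = S) (Su : S \in unitmx) (mY : measurable_fun setT Y)
  (LY : forall i, L2 P (fun w => Y w 0 i)) (A4Y : A4 P S Y)
  (optG : dual_optimal P S Y G).
Local Notation vec := 'rV[R]_d.
Local Notation q x := (Sform S x x / 2).
Local Notation a x y := (Sform S x y - Sform S x x / 2).
Local Notation E f := (\int[P]_w f w).
Local Notation intg f := (P.-integrable setT (EFin \o f)).
Let mG : maximal_S_monotone S G := optG.1.

Lemma intg_aff (x0 : vec) : intg (fun w => a x0 (Y w)).
Proof.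
apply: intgB; last exact: intg_cst.
by apply: (@intg_Sform _ _ _ _ P S (fun=> x0) Y) => // i; exact: L2_cst.
Qed.

Lemma measurable_psiY H : measurable_fun setT (fun w => psi S H (Y w)).
Proof. exact: (measurableT_comp (@psi_Rd R d S H) mY). Qed.

Lemma integral_psi_le H (h : T -> R) : maximal_S_monotone S H -> intg h ->
  {ae P, forall w, (psi S H (Y w) <= (h w)%:E)%E} ->
  (\int[P]_w psi S G (Y w) <= (E h)%:E)%E.
Proof.
move=> mH hi Hh; apply: le_trans (optG.2 H mH) _.
have [x0 Hx0] := maximal_neq0 mH.
apply: (integral_le_ae (measurable_psiY H) (intg_aff x0) hi) => // w.
exact: psi_ge.
Qed.

(** [(M + S) / 4] is [q] of the positive part: convex and above [q], it dominates some [psi S G'],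
    and being quadratic it is integrable at [Y]. *)
Lemma dual_finite : (\int[P]_w psi S G (Y w) < +oo)%E.
Proof.
have [M [J [MT SJ JJ SM [c c0 Mc]]]] := pseudo_euclidean ST Su.
pose E0 : set (vec * R) := [set p | (Sform M p.1 p.1 + Sform S p.1 p.1) / 4 <= p.2].
have cE0 : cvx_set E0.
  move=> p1 p2 t; rewrite /E0 /= => H1 H2 /andP[t0 t1]; rewrite !SformE.
  rewrite (SformC p2.1 p1.1 MT) (SformC p2.1 p1.1 ST).
  have := MS_ge0 SM (p1.1 - p2.1); rewrite !SformE.
  rewrite (SformC p2.1 p1.1 MT) (SformC p2.1 p1.1 ST) => h.
  have h0 : 0 <= t * (1 - t) by rewrite mulr_ge0// subr_ge0.
  have h1 := mulr_ge0 h0 h.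
  have h2 : (1 - t) * ((Sform M p1.1 p1.1 + Sform S p1.1 p1.1) / 4) <= (1 - t) * p1.2.
    by rewrite ler_wpM2l ?subr_ge0.
  have h3 : t * ((Sform M p2.1 p2.1 + Sform S p2.1 p2.1) / 4) <= t * p2.2.
    by rewrite ler_wpM2l.
  by lra.
have qE0 : E0 `<=` above_q S.
  move=> p; rewrite /E0 /above_q /= => h.
  by have := SM p.1; rewrite ler_norml => /andP[_]; lra.
have [G' [mG' G'E0 _ _]] := maximal_monotone_below ST MT SJ JJ SM c0 Mc cE0 qE0.
have iq : intg (fun w => (Sform M (Y w) (Y w) + Sform S (Y w) (Y w)) / 4).
  under eq_fun do rewrite mulrC.
  by apply: intgZ; apply: intgD; exact: intg_Sform.
apply: le_lt_trans (integral_psi_le mG' iq _) (ltry _).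
apply: aeW => w; apply: psi_le => x G'x.
by apply: (G'E0 x (Y w : vec, _)) => //; rewrite /E0 /=.
Qed.

Let ipsi : P.-integrable setT (fun w => psi S G (Y w)).
Proof. exact: (psi_integrable_of_L2 mG mY LY dual_finite). Qed.

Definition good w := [/\ dompsi S G (Y w), interior_point S G (Y w) & ~ Sigma S G (Y w)].

Lemma ae_good : {ae P, forall w, good w}.
Proof.
have h1 : {ae P, forall w, dompsi S G (Y w)}.
  have := integrable_ae measurableT ipsi; apply: filterS => w /(_ I) h.
  by apply: (dompsiP mG); rewrite ltey_eq h.
have h2 : {ae P, forall w, ~ (dompsi S G (Y w) /\ ~ interior_point S G (Y w))}.
  exact: (negligible_ae (negligible_boundary A4Y G)).
have h3 : {ae P, forall w, ~ Sigma S G (Y w)}.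
  exact: (negligible_ae (negligible_Sigma A4Y mG)).
apply: filterS3 h1 h2 h3 => w w1 w2 w3; split => //.
by apply: contrapT => w4; exact: w2.
Qed.

Local Notation X := (fun w => proj_fun S G (Y w)).

Lemma measurable_X : measurable_fun setT X.
Proof. exact: (measurableT_comp (measurable_proj_fun mG) mY). Qed.

Lemma good_PG w : good w -> PG S G (Y w) (X w).
Proof.
by move=> [w1 w2 w3]; have [x Px] := PG_neq0 ST mG w1 w2; rewrite (proj_funP w3 Px).
Qed.

Let psir w := fine (psi S G (Y w)).

Lemma good_psir w : good w -> psir w = a (X w : vec) (Y w) /\ psi S G (Y w) = (psir w)%:E.
Proof. by move=> /good_PG /psi_PG e; rewrite /psir e. Qed.

Let ipsir : intg psir.
Proof.
apply: le_integrable ipsi => //.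
  apply: measurableT_comp => //; apply: measurableT_comp; first exact: fine_measurable.
  exact: measurable_psiY.
by move=> w _ /=; rewrite /psir; case: (psi S G (Y w)) => [r| |]//=; rewrite leey.
Qed.

Let Epsir : (\int[P]_w psi S G (Y w) = (E psir)%:E)%E.
Proof.
rewrite EFin_E//; apply: ae_eq_integral => //.
- exact: measurable_psiY.
- by case/integrableP: ipsir.
- by apply: filterS ae_good => w gw _; exact: (good_psir gw).2.
Qed.

Section Variation.
Variables (th : vec -> vec) (C1 : R).
Hypotheses (cth : continuous th) (thC : forall x, `|th x| <= C1)
  (thxC : forall x, `|th x| * `|x| <= C1).

(** The derivative of [a (x + eps *: th x) y] at [eps = 0]. *)
Let b x y := Sform S (th x) (y - x).
Let eps (n : nat) : R := n.+1%:R^-1.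
Let eps_gt0 n : 0 < eps n. Proof. by rewrite /eps invr_gt0. Qed.
Let C10 : 0 <= C1. Proof. exact: le_trans (normr_ge0 _) (thC 0). Qed.

Let b_bound : exists2 c, 0 <= c & forall x y, `|b x y| <= c * (1 + `|y|).
Proof.
have [cS cS0 Sb] := Sform_bound S; exists (cS * C1); first by rewrite mulr_ge0// ltW.
move=> x y; rewrite /b (le_trans (Sb _ _))// -!mulrA ler_wpM2l ?(ltW cS0)//.
apply: (@le_trans _ _ (`|th x| * (`|y| + `|x|))); first by rewrite ler_wpM2l// ler_normB.
have h1 : `|th x| * `|y| <= C1 * `|y| by rewrite ler_wpM2r.
by rewrite mulrDr; have := thxC x; lra.
Qed.

Let cont_b y : continuous (fun x => b x y).
Proof.
by apply: continuous_Sform => //; apply: cont_subv; [exact: cont_cst|exact: cont_id].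
Qed.

Let phi n (y : vec) : \bar R := ereal_sup [set (a x y + eps n * b x y)%:E | x in G].

Let measurable_phi n : measurable_fun setT (phi n : Rd R d -> \bar R).
Proof.
apply: (@sup_affine_Rd _ _ _ G (fun x y => a x y + eps n * b x y)) => x.
apply: contD; first apply: contB; try exact: cont_cst.
  by apply: continuous_Sform; [exact: cont_cst|exact: cont_id].
apply: contM; first exact: cont_cst.
apply: continuous_Sform; first exact: cont_cst.
by apply: cont_subv; [exact: cont_id|exact: cont_cst].
Qed.

(** [K1] pays for lying above [q]: if [x] is the Minty point of [p.1], then [p.1 - x] is negative,
    and shifting it by [e *: th x] leaves [q] at most [K1 * e ^+ 2]. [K2] pays for the term
    [- e ^+ 2 * q (th x)] absent from [phi]. *)
Lemma dominated_competitor : exists K, forall k : nat, exists2 H, maximal_S_monotone S H &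
  forall y r, (phi k y <= r%:E)%E -> (psi S H y <= (r + K * eps k ^+ 2)%:E)%E.
Proof.
have [M [J [MT SJ JJ SM [c c0 Mc]]]] := pseudo_euclidean ST Su.
have [cM cM0 Mb] := Sform_bound M; have [cS cS0 Sb] := Sform_bound S.
pose K1 := cM * C1 ^+ 2 / 2; pose K2 := cS * C1 ^+ 2 / 2.
have M1 x : Sform M (th x) (th x) / 2 <= K1.
  rewrite /K1 ler_pM2r// (le_trans (ler_norm _))// (le_trans (Mb _ _))// -mulrA -expr2.
  by rewrite ler_wpM2l ?(ltW cM0)// lerXn2r// nnegrE.
have S1 x : - q (th x) <= K2.
  rewrite /K2 -mulNr ler_pM2r// (le_trans (ler_norm _))// normrN (le_trans (Sb _ _))//.
  by rewrite -mulrA -expr2 ler_wpM2l ?(ltW cS0)// lerXn2r// nnegrE.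
exists (K1 + K2) => k; set e := eps k.
pose xe x := x + e *: th x.
pose E0 : set (vec * R) := [set p | forall x, G x -> a (xe x) p.1 + K1 * e ^+ 2 <= p.2].
have aE x y : a (xe x) y = a x y + e * b x y - e ^+ 2 * q (th x).
  by rewrite /xe /b !SformE (SformC (th x) x ST); field.
have cE0 : cvx_set E0.
  move=> p1 p2 t H1 H2 /andP[t0 t1] x Gx /=.
  have h1 : (1 - t) * (a (xe x) p1.1 + K1 * e ^+ 2) <= (1 - t) * p1.2.
    by rewrite ler_wpM2l ?subr_ge0//; exact: H1.
  have h2 : t * (a (xe x) p2.1 + K1 * e ^+ 2) <= t * p2.2 by rewrite ler_wpM2l//; exact: H2.
  move: (xe x) h1 h2 => x1 h1 h2; rewrite SformDr !SformZr; lra.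
have qE0 : E0 `<=` above_q S.
  move=> p H; rewrite /above_q /=.
  have [x Gx xJ] : exists2 x, G x & (p.1 - x) *m J = - (p.1 - x).
    exact: (minty_of_maximal ST MT SJ JJ SM c0 Mc mG p.1).
  have := H _ Gx.
  have -> : a (xe x) p.1 = q p.1 - q ((p.1 - x) - e *: th x).
    have -> : p.1 - x - e *: th x = p.1 - xe x by rewrite /xe opprD addrA.
    by rewrite q_sub// (SformC p.1 (xe x) ST); ring.
  have := negative_sub_form ST MT SJ SM (e *: th x) xJ.
  rewrite (SformZl M) (SformZr M) mulrA -expr2.
  have : e ^+ 2 * (Sform M (th x) (th x) / 2) <= e ^+ 2 * K1 by rewrite ler_wpM2l ?sqr_ge0.
  lra.
have [H [mH HE0 _ _]] := maximal_monotone_below ST MT SJ JJ SM c0 Mc cE0 qE0.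
exists H => // y r yr; apply: psi_le => x Hx.
apply: (HE0 x (y, r + (K1 + K2) * e ^+ 2)) => // x' Gx' /=; rewrite aE.
have : a x' y + e * b x' y <= r.
  by rewrite -lee_fin; apply: le_trans yr; apply: ereal_sup_ubound; exists x'.
have : e ^+ 2 * (- q (th x')) <= e ^+ 2 * K2 by rewrite ler_wpM2l ?sqr_ge0.
lra.
Qed.

Lemma first_order : intg (fun w => b (X w) (Y w)) /\ 0 <= E (fun w => b (X w) (Y w)).
Proof.
have [cb cb0 bb] := b_bound.
pose g w := cb * (1 + \sum_i `|Y w 0 i|).
have ig : intg g.
  apply: intgZ; apply: intgD; first exact: intg_cst.
  by apply: intg_sum => i; apply: intg_norm; exact: L2_intg.
have bg x w : `|b x (Y w)| <= g w.
  rewrite (le_trans (bb _ _))// /g ler_wpM2l// lerD2l; apply: norm_le; first exact: sumr_ge0.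
  by move=> i; rewrite (bigD1 i)//= lerDl sumr_ge0.
have g0 w : 0 <= g w := le_trans (normr_ge0 _) (bg 0 w).
pose raw n w := (fine (phi n (Y w)) - psir w) * n.+1%:R.
(* Outside [good] the quotient [raw] is not controlled; clamping it gives domination everywhere and
   changes nothing on [good]. *)
pose f_ n w := Num.max (- g w) (Num.min (g w) (raw n w)).
have mraw n : measurable_fun setT (raw n).
  apply: measurable_funM => //; apply: measurable_funB; last exact: intg_meas ipsir.
  by apply: measurableT_comp; [exact: fine_measurable|exact: (measurableT_comp (measurable_phi n) mY)].
have mg := intg_meas ig.
have mf_ n : measurable_fun setT (f_ n).
  apply: measurable_maxr; first exact: measurableT_comp.
  exact: measurable_minr.
have f_g n w : `|f_ n w| <= g w.
  rewrite /f_ ler_norml le_max lexx /= ge_max ge_min lexx /= andbT.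
  by rewrite (le_trans _ (g0 w))// oppr_le0.
have phi_fin n w : good w -> phi n (Y w) = (fine (phi n (Y w)))%:E /\
    forall c, (forall x, G x -> (a x (Y w) - psir w) / eps n + b x (Y w) <= c) ->
      raw n w <= c.
  move=> gw; have [e1 _] := good_psir gw; have [GX Xmax] := good_PG gw.
  have fin : phi n (Y w) = (fine (phi n (Y w)))%:E.
    rewrite fineK// fin_numE; apply/andP; split.
      rewrite gt_eqF// (lt_le_trans (ltNyr (a (X w : vec) (Y w) + eps n * b (X w) (Y w))))//.
      by apply: ereal_sup_ubound; exists (X w).
    rewrite lt_eqF// (@le_lt_trans _ _ (psir w + eps n * g w)%:E) ?ltry//.
    apply: ge_ereal_sup => _ [x Gx <-]; rewrite lee_fin lerD//; first by rewrite e1; exact: Xmax.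
    by rewrite ler_wpM2l ?(ltW (eps_gt0 n))// (le_trans (ler_norm _)).
  split => // c Hc; rewrite /raw -ler_pdivlMr// lerBlDr -lee_fin -fin.
  apply: ge_ereal_sup => _ [x Gx <-]; rewrite lee_fin -lerBlDr -/(eps n).
  have := Hc _ Gx; rewrite -(ler_pM2r (eps_gt0 n)) mulrDl divfK ?gt_eqF//; lra.
have raw_ge n w : good w -> b (X w) (Y w) <= raw n w.
  move=> gw; have [fin _] := phi_fin n w gw; have [e1 _] := good_psir gw.
  have [GX _] := good_PG gw.
  rewrite /raw -ler_pdivrMr// lerBrDl -lee_fin -fin e1.
  by apply: ereal_sup_ubound; exists (X w) => //; rewrite /eps [_^-1 * b _ _]mulrC.
have raw_f n w : good w -> f_ n w = raw n w.
  move=> gw; have rl := raw_ge n w gw; have [_ ru] := phi_fin n w gw.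
  have rg : raw n w <= g w.
    apply: ru => x Gx; have [e1 _] := good_psir gw; have [_ Xmax] := good_PG gw.
    have h1 : (a x (Y w) - psir w) / eps n <= 0.
      by rewrite pmulr_lle0 ?invr_gt0// subr_le0 e1; exact: Xmax.
    by have := bg x w; rewrite ler_norml => /andP[_]; lra.
  rewrite /f_ (min_r rg) max_r// (le_trans _ rl)//.
  by have := bg (X w) w; rewrite ler_norml => /andP[].
have mb : measurable_fun setT (fun w => b (X w) (Y w)).
  have mth i : measurable_fun setT (fun w => th (X w) 0 i).
    have c : continuous (fun x : vec => th x 0 i).
      move=> x; apply: (@continuous_comp _ _ _ th (fun x : vec => x 0 i)); first exact: cth.
      exact: coord_continuous.
    exact: (measurableT_comp (continuous_Rd c) measurable_X).
  rewrite /b; under eq_fun do rewrite Sform_sum.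
  apply: measurable_sum => i; apply: measurable_sum => j.
  apply: measurable_funM; first exact: measurable_funM.
  under eq_fun do rewrite !mxE.
  apply: measurable_funB; first exact: L2_meas (LY j).
  exact: (measurableT_comp (@coord_Rd R d j) measurable_X).
have [|cv ib] := @E_dominated _ _ _ P f_ (fun w => b (X w) (Y w)) g mf_ mb ig _ f_g.
  apply: filterS ae_good => w gw; apply/cvgrPdist_le => e e0.
  have [w1 w2 w3] := gw.
  have [ep0 ep00 Hep] := perturbed_max ST mG w1 w2 w3 (good_PG gw) (@cont_b (Y w) _) (bg ^~ w) e0.
  have [e1 _] := good_psir gw.
  near=> n; rewrite raw_f//.
  have h : raw n w <= b (X w) (Y w) + e.
    apply: (phi_fin n w gw).2 => x Gx; rewrite e1; apply: Hep => //.
    rewrite eps_gt0 /=; near: n.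
    have := @cvg_inv_nat R 1; move=> /cvgr_lt /(_ _ ep00).
    by apply: filterS => n; rewrite mul1r.
  by rewrite ler_norml; have := raw_ge n w gw; lra.
split => //; have [K HK] := dominated_competitor.
have fi_ n : intg (f_ n) by apply: (intg_le (mf_ n) (f_g n) ig).
(* Optimality of [G] against the competitor [H], divided by [eps n]. *)
have lb n : 0 <= E (f_ n) + K / n.+1%:R.
  have [H mH HH] := HK n.
  have ih : intg (fun w => psir w + eps n * f_ n w + K * eps n ^+ 2).
    by apply: intgD; [apply: intgD => //; exact: intgZ|exact: intg_cst].
  have := integral_psi_le mH ih; rewrite Epsir lee_fin.
  rewrite E_D; [|by apply: intgD => //; exact: intgZ|exact: intg_cst].
  rewrite E_D//; last exact: intgZ.
  rewrite E_Z// E_cst.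
  have : {ae P, forall w, (psi S H (Y w) <= (psir w + eps n * f_ n w + K * eps n ^+ 2)%:E)%E}.
    apply: filterS ae_good => w gw; apply: HH.
    rewrite (raw_f n w gw) /raw mulrA [eps n * _]mulrC -mulrA [eps n * _]mulrC.
    rewrite mulfV ?mulr1; last by rewrite pnatr_eq0.
    by rewrite addrC subrK (phi_fin n w gw).1.
  move=> aeH /(_ aeH); rewrite -addrA lerDl expr2 mulrA -[eps n * E _ + _]/(_) => h.
  have : 0 <= eps n * (E (f_ n) + K / n.+1%:R) by rewrite mulrDr -/(eps n); lra.
  by rewrite pmulr_rge0.
have cv' : (fun n => E (f_ n) + K / n.+1%:R) @ \oo --> E (fun w => b (X w) (Y w)) + 0.
  by apply: cvgD => //; exact: cvg_inv_nat.
rewrite addr0 in cv'.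
by apply: (cvgr_to_ge cv'); near=> n.
Unshelve. all: by end_near. Qed.

End Variation.
End FirstOrder.

(** * The martingale property and the equality of primal and dual values *)

Section Martingale.
Context {R : realType} {d : nat} {dT : measure_display} {T : measurableType dT}.
Set Implicit Arguments.
Unset Strict Implicit.
Variables (P : probability T R) (S : 'M[R]_d) (G : set 'rV[R]_d) (Y : T -> Rd R d).
Hypotheses (ST : S^T = S) (Su : S \in unitmx) (mY : measurable_fun setT Y)
  (LY : forall i, L2 P (fun w => Y w 0 i)) (A4Y : A4 P S Y)
  (optG : dual_optimal P S Y G).
Local Notation vec := 'rV[R]_d.
Local Notation q x := (Sform S x x / 2).
Local Notation E f := (\int[P]_w f w).
Local Notation intg f := (P.-integrable setT (EFin \o f)).
Local Notation X := (fun w => proj_fun S G (Y w)).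
Let mG : maximal_S_monotone S G := optG.1.

Let mX : measurable_fun setT X. Proof. exact: measurable_X mY optG. Qed.
Let mXi i : measurable_fun setT (fun w => X w 0 i).
Proof. exact: (measurableT_comp (@coord_Rd R d i) mX). Qed.

(** The field [f x *: v], with [v] the [S]-dual of the basis vector, isolates coordinate [i]; the
    inequality for [f] and for [- f] gives equality. *)
Lemma test_fun_centered (f : vec -> R) (C : R) i : continuous f -> (forall x, `|f x| <= C) ->
  (forall x, `|f x| * `|x| <= C) ->
  intg (fun w => f (X w) * (Y w 0 i - X w 0 i)) /\
  E (fun w => f (X w) * (Y w 0 i - X w 0 i)) = 0.
Proof.
move=> cf fC fxC.
pose v : vec := delta_mx 0 i *m invmx S.
have Sv (z : vec) : Sform S v z = z 0 i.
  by rewrite /Sform /v mulmxKV// -(dot_delta z i) SformC ?trmx1// /Sform mulmx1.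
have H (f' : vec -> R) : continuous f' -> (forall x, `|f' x| <= C) ->
    (forall x, `|f' x| * `|x| <= C) ->
    intg (fun w => f' (X w) * (Y w 0 i - X w 0 i)) /\
    0 <= E (fun w => f' (X w) * (Y w 0 i - X w 0 i)).
  move=> cf' f'C f'xC.
  have cth : continuous (fun x : vec => f' x *: v) by exact: cont_scalev.
  have [] := first_order ST Su mY LY A4Y optG cth (C1 := C * `|v|) _ _.
  - by move=> x; rewrite normrZ ler_wpM2r.
  - by move=> x; rewrite normrZ mulrAC ler_wpM2r.
  have -> : (fun w => Sform S (f' (X w) *: v) ((Y w : vec) - X w)) =
      (fun w => f' (X w) * (Y w 0 i - X w 0 i)).
    by apply/funext => w; rewrite SformZl Sv !mxE.
  by [].
have [fi f0] := H f cf fC fxC; split => //; apply/eqP; rewrite eq_le f0 andbT.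
have cNf : continuous (fun x => - f x).
  by under eq_fun do rewrite -mulN1r; apply: contM => //; exact: cont_cst.
have [||_] := H (fun x => - f x) cNf; try by move=> x; rewrite normrN.
have -> : (fun w => - f (X w) * (Y w 0 i - X w 0 i)) =
    (fun w => -1 * (f (X w) * (Y w 0 i - X w 0 i))).
  by apply/funext => w; ring.
by rewrite E_Z// mulN1r oppr_ge0.
Qed.

(** With [c] the cutoff, testing on [c^2 x_i] gives [E[c^2 X_i^2] = E[c^2 X_i Y_i]]; Young's
    inequality absorbs half of the left side, so [E (k n)] is bounded uniformly in [n]. The square
    of the cutoff keeps the test function bounded after multiplication by [|x|]. *)
Lemma L2_X i : L2 P (fun w => X w 0 i).
Proof.
split => //; pose k n w := cutoff n (X w) ^+ 2 * X w 0 i ^+ 2.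
have chi_bound n (x : vec) : `|cutoff n x ^+ 2 * x 0 i| <= n.+1%:R ^+ 2 /\
    `|cutoff n x ^+ 2 * x 0 i| * `|x| <= n.+1%:R ^+ 2.
  have c0 := cutoff_ge0 n x; have c1 := cutoff_le1 n x; have cx := cutoff_norm n x.
  have xi := norm_coord x i; have cx0 : 0 <= cutoff n x * `|x| by rewrite mulr_ge0.
  have e : `|cutoff n x ^+ 2 * x 0 i| <= cutoff n x * (cutoff n x * `|x|).
    by rewrite normrM ger0_norm ?sqr_ge0// expr2 -mulrA ler_wpM2l// ler_wpM2l.
  split.
    rewrite (le_trans e)// (@le_trans _ _ (cutoff n x * `|x|))//; first by rewrite ler_piMl.
    by rewrite (le_trans cx)// expr2 ler_peMr// ler1n.
  apply: (@le_trans _ _ ((cutoff n x * `|x|) ^+ 2)).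
    have -> : (cutoff n x * `|x|) ^+ 2 = cutoff n x * (cutoff n x * `|x|) * `|x| by ring.
    by rewrite ler_wpM2r.
  by rewrite lerXn2r ?nnegrE.
have cchi n : continuous (fun x : vec => cutoff n x ^+ 2 * x 0 i).
  apply: contM; last exact: coord_continuous.
  by under eq_fun do rewrite expr2; apply: contM; exact: cont_cutoff.
have mchi n : measurable_fun setT (fun w => cutoff n (X w) ^+ 2 * X w 0 i).
  exact: (measurableT_comp (continuous_Rd (cchi n)) mX).
have kE n w : k n w = cutoff n (X w) ^+ 2 * X w 0 i * X w 0 i by rewrite /k expr2; ring.
have mk n : measurable_fun setT (k n).
  have -> : k n = (fun w => cutoff n (X w) ^+ 2 * X w 0 i * X w 0 i) by exact/funext/kE.
  by apply: measurable_funM.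
have k0 n w : 0 <= k n w by rewrite /k mulr_ge0// sqr_ge0.
have ik n : intg (k n).
  apply: (@intg_le _ _ _ P _ (fun=> n.+1%:R ^+ 2)) => //; last exact: intg_cst.
  move=> w; rewrite kE normrM (le_trans _ (chi_bound n (X w)).2)//.
  by rewrite ler_wpM2l// norm_coord.
have iB n : intg (fun w => cutoff n (X w) ^+ 2 * X w 0 i * Y w 0 i).
  apply: (@intg_le _ _ _ P _ (fun w => n.+1%:R ^+ 2 * `|Y w 0 i|)).
  - by apply: measurable_funM => //; exact: L2_meas (LY i).
  - by move=> w; rewrite normrM ler_wpM2r//; exact: (chi_bound n (X w)).1.
  - by apply: intgZ; apply: intg_norm; exact: L2_intg.
have iY2 : intg (fun w => Y w 0 i ^+ 2) := (LY i).2.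
have Ek n : E (k n) <= E (fun w => Y w 0 i ^+ 2).
  have [_] := test_fun_centered i (cchi n) (fun x => (chi_bound n x).1) (fun x => (chi_bound n x).2).
  have e w : cutoff n (X w) ^+ 2 * X w 0 i * (Y w 0 i - X w 0 i) =
     cutoff n (X w) ^+ 2 * X w 0 i * Y w 0 i - k n w by rewrite kE; ring.
  under eq_Rintegral do rewrite e.
  rewrite E_B// => /eqP; rewrite subr_eq0 => /eqP eB.
  have : E (fun w => cutoff n (X w) ^+ 2 * X w 0 i * Y w 0 i) <=
      E (fun w => 2^-1 * k n w + 2^-1 * Y w 0 i ^+ 2).
    apply: E_le => //; first by apply: intgD; exact: intgZ.
    move=> w; rewrite /k; set c := cutoff n (X w) ^+ 2.
    have c0 : 0 <= c by rewrite sqr_ge0.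
    have c1 : c <= 1 by rewrite expr_le1 ?cutoff_ge0 ?cutoff_le1.
    set x := X w 0 i; set y := Y w 0 i.
    have h1 : 0 <= c * (x - y) ^+ 2 by rewrite mulr_ge0// sqr_ge0.
    have h2 : 0 <= (1 - c) * y ^+ 2 by rewrite mulr_ge0 ?sqr_ge0// subr_ge0.
    by move: h1 h2; rewrite !expr2; lra.
  rewrite eB E_D; [|exact: intgZ..]; rewrite !E_Z//; lra.
have lim w : limn (fun n => (k n w)%:E) = (X w 0 i ^+ 2)%:E.
  apply: cvg_lim => //; apply/fine_cvgP; split; first by exists 0%N.
  rewrite -[X in _ --> X]mul1r -(expr1n _ 2); apply: cvgM; last exact: cvg_cst.
  by under eq_fun do rewrite /= expr2; rewrite expr2; apply: cvgM; exact: cvg_cutoff.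
have mEk n : measurable_fun setT (EFin \o k n) by exact: measurableT_comp.
have kE0 n w : setT w -> (0 <= (EFin \o k n) w)%E by move=> _; rewrite lee_fin.
have knd w : setT w -> nondecreasing_seq (fun n => (EFin \o k n) w).
  move=> _ m n mn /=; rewrite lee_fin ler_wpM2r ?sqr_ge0//.
  by rewrite lerXn2r ?nnegrE ?cutoff_ge0// cutoff_nd.
apply/integrableP; split; first by apply: measurableT_comp => //; exact: measurable_funX.
have -> : (\int[P]_w `|(EFin \o (fun w => X w 0 i ^+ 2)%R) w| =
    \int[P]_w limn (fun n => (EFin \o k n) w))%E.
  by apply: eq_integral => w _; rewrite lim gee0_abs// lee_fin sqr_ge0.
rewrite (monotone_convergence P measurableT mEk kE0 knd).
apply: (@le_lt_trans _ _ (E (fun w => Y w 0 i ^+ 2))%:E); last exact: ltry.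
apply: lime_le.
  apply: ereal_nondecreasing_is_cvgn => m n mn; apply: ge0_le_integral => // w _.
    by rewrite lee_fin.
  exact: knd.
by apply: nearW => n; rewrite -EFin_E// lee_fin.
Qed.

Let LU i : L2 P (fun w => Y w 0 i - X w 0 i).
Proof. by under eq_fun do rewrite -mulN1r; apply: L2D => //; apply: L2Z; exact: L2_X. Qed.

Lemma centered_closed i (F : set vec) : closed F ->
  E (fun w => \1_F (X w) * (Y w 0 i - X w 0 i)) = 0.
Proof.
move=> cF; have [F0|/set0P F0] := eqVneq F set0.
  have -> : (fun w => \1_F (X w) * (Y w 0 i - X w 0 i)) = (fun=> 0).
    by apply/funext => w; rewrite F0 indic0 /= mul0r.
  exact: E_cst.
have bb n x : `|plateau F n x| <= n.+1%:R /\ `|plateau F n x| * `|x| <= n.+1%:R.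
  have /andP[b0 bc] := plateau_bound F0 n x; rewrite ger0_norm//; split.
    by rewrite (le_trans bc)// (le_trans (cutoff_le1 _ _))// ler1n.
  by rewrite (le_trans _ (cutoff_norm n x))// ler_wpM2r.
have t n := test_fun_centered i (@cont_plateau _ _ _ F0 n) (fun x => (bb n x).1) (fun x => (bb n x).2).
have iU := L2_intg (LU i).
have [||||cv _] := @E_dominated _ _ _ P (fun n w => plateau F n (X w) * (Y w 0 i - X w 0 i))
   (fun w => \1_F (X w) * (Y w 0 i - X w 0 i)) (fun w => `|Y w 0 i - X w 0 i|)
   _ _ (intg_norm iU).
- move=> n; apply: measurable_funM; last exact: intg_meas iU.
  exact: (measurableT_comp (continuous_Rd (@cont_plateau _ _ _ F0 n)) mX).
- apply: measurable_funM; last exact: intg_meas iU.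
  by apply: (measurableT_comp _ mX); exact: (measurable_indic (closed_Rd cF)).
- by apply: aeW => w; apply: cvgM; [exact: cvg_plateau|exact: cvg_cst].
- move=> n w; rewrite normrM ler_piMl//.
  have /andP[b0 bc] := plateau_bound F0 n (X w); rewrite ger0_norm//.
  exact: le_trans bc (cutoff_le1 _ _).
have : (fun n => E (fun w => plateau F n (X w) * (Y w 0 i - X w 0 i))) @ \oo --> 0.
  by under eq_fun do rewrite (t _).2; exact: cvg_cst.
by move/(cvg_unique _ cv); exact.
Qed.

(** Dynkin's theorem from the open sets; stability under complement rests on the case of the whole
    space, where the mean of [U] vanishes. *)
Lemma centered_X i (A : set (Rd R d)) : measurable A ->
  (\int[P]_(w in X @^-1` A) (Y w 0 i - X w 0 i)%:E = 0)%E.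
Proof.
pose U w := Y w 0 i - X w 0 i; have iU : intg U := L2_intg (LU i).
pose H (A : set (Rd R d)) := (\int[P]_(w in X @^-1` A) (U w)%:E = 0)%E.
have r (B : set (Rd R d)) (mB : measurable B) := E_restrict mX iU mB.
have Hcl (F : set vec) : closed F -> H F.
  move=> cF; rewrite /H -(r _ (closed_Rd cF)).2; congr EFin.
  exact: centered_closed.
have HC (B : set (Rd R d)) : measurable B -> H B -> H (~` B).
  move=> mB; have mCB := measurableC mB; rewrite /H -(r _ mB).2 -(r _ mCB).2 => -[HB].
  congr EFin; have e w : \1_(~` B) (X w) * U w = U w - \1_B (X w) * U w.
    rewrite !indicE in_setC; case: (_ \in B); rewrite /= ?mul0r ?mul1r ?subrr//.
    by rewrite subr0.
  under eq_Rintegral do rewrite e.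
  rewrite E_B//; last exact: (r _ mB).1.
  rewrite HB subr0; have [HT] : H setT by exact: (Hcl _ closedT).
  by move: HT; rewrite /H preimage_setT -EFin_E// => -[].
move: A; apply: (@dynkin_induction _ (Rd R d) (@open 'M[R]_(1, d)) H erefl).
- by move=> A B oA oB; exact: openI.
- exact: (Hcl _ closedT).
- move=> A oA; rewrite -[A]setCK; apply: HC.
    by apply: closed_Rd; exact: open_closedC.
  by apply: Hcl; exact: open_closedC.
- exact: HC.
- move=> F mF tF HF; rewrite /H preimage_bigcup integral_bigcup.
  + by apply: eseries0 => n _ _; exact: HF.
  + by move=> m n _ _ [w [Fm Fn]]; apply: tF => //; exists (X w).
  + by move=> n; rewrite -[X in measurable X]setTI; exact: mX.
  + apply: (integrableS measurableT _ (@subsetT _ _) iU).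
    by apply: bigcupT_measurable => n; rewrite -[X in measurable X]setTI; exact: mX.
Qed.

Lemma martingale_X (A : set (Rd R d)) : measurable A -> forall i,
  (\int[P]_(w in X @^-1` A) (Y w 0 i)%:E = \int[P]_(w in X @^-1` A) (X w 0 i)%:E)%E.
Proof.
move=> mA i; have mXA : measurable (X @^-1` A) by rewrite -[X in measurable X]setTI; exact: mX.
have iY := integrableS measurableT mXA (@subsetT _ _) (L2_intg (LY i)).
have iX := integrableS measurableT mXA (@subsetT _ _) (L2_intg (L2_X i)).
have := centered_X i mA; under eq_integral do rewrite EFinB.
rewrite (integralB mXA iY iX).
have fY : (\int[P]_(w in X @^-1` A) (Y w 0%R i)%:E)%E \is a fin_num by exact: integrable_fin_num.
have fX : (\int[P]_(w in X @^-1` A) (X w 0%R i)%:E)%E \is a fin_num by exact: integrable_fin_num.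
by rewrite -(fineK fY) -(fineK fX) -EFinB => -[/eqP]; rewrite subr_eq0 => /eqP ->.
Qed.

(** On [good], [psi] at [Y] is [S(X, Y) - q(X)], and the martingale property gives
    [E q(X) = E S(X, Y) / 2]. *)
Lemma primal_value : (\int[P]_w (Sform S (X w) (Y w) / 2)%:E = \int[P]_w psi S G (Y w))%E.
Proof.
have iXY : intg (fun w => Sform S (X w) (Y w)) by apply: intg_Sform => //; exact: L2_X.
have iXX : intg (fun w => Sform S (X w) (X w)) by apply: intg_Sform; exact: L2_X.
have iV : intg (fun w => 2^-1 * Sform S (X w) (Y w)) by exact: intgZ.
have iq : intg (fun w => 2^-1 * Sform S (X w) (X w)) by exact: intgZ.
have ia : intg (fun w => Sform S (X w) (Y w) - 2^-1 * Sform S (X w) (X w)) by exact: intgB.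
have eo := orth_Sform S mX L2_X LY martingale_X (@cont_id _) L2_X.
transitivity (\int[P]_w (Sform S (X w) (Y w) - 2^-1 * Sform S (X w) (X w))%:E)%E.
  under eq_integral do rewrite mulrC.
  rewrite -!EFin_E//; congr EFin.
  by rewrite E_B// !E_Z// eo; lra.
apply: ae_eq_integral => //; first by case/integrableP: ia.
  exact: measurable_psiY.
apply: filterS (ae_good ST Su mY LY A4Y optG) => w gw _ /=.
by rewrite (psi_PG (good_PG ST optG gw)) [_ / 2]mulrC.
Qed.

End Martingale.

(** * Change of variables and almost sure equality of events *)

Section Laws.
Context {R : realType} {dT dW : measure_display} {T : measurableType dT} {W : measurableType dW}.
Set Implicit Arguments.
Unset Strict Implicit.

(** [m] is tied to the image measure only through its values on measurable sets, the form in which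
    [in_Gamma] gives the marginal. *)
Lemma integral_law (P : {measure set T -> \bar R}) (m : {measure set W -> \bar R})
    (phi : T -> W) (D : set W) (f : W -> \bar R) :
  measurable_fun setT phi -> (forall A, measurable A -> m A = P (phi @^-1` A)) ->
  measurable D -> measurable_fun setT f ->
  (\int[m]_(y in D) f y = \int[P]_(x in phi @^-1` D) f (phi x))%E.
Proof.
move=> mphi law mD mf.
have H (g : W -> \bar R) : measurable_fun setT g -> (forall y, (0 <= g y)%E) ->
    (\int[m]_(y in D) g y = \int[P]_(x in phi @^-1` D) g (phi x))%E.
  move=> mg g0; rewrite -(@ge0_integral_pushforward _ _ _ _ _ phi mphi P D g)//.
    by apply: eq_measure_integral => A mA _; rewrite law.
  exact: measurable_funTS.
rewrite integralE [RHS]integralE; congr (_ - _)%E.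
  rewrite H; [|exact: measurable_funepos|by move=> y; exact: funepos_ge0].
  by apply: eq_integral => x _; rewrite !funeposE.
rewrite H; [|exact: measurable_funeneg|by move=> y; exact: funeneg_ge0].
by apply: eq_integral => x _; rewrite !funenegE.
Qed.

Lemma ae_imply2 (P : probability T R) (A B C : T -> Prop) :
  (forall w, A w -> B w -> C w) -> {ae P, forall w, A w} -> {ae P, forall w, B w} ->
  {ae P, forall w, C w}.
Proof. by move=> ABC; exact: filterS2. Qed.

Lemma measure_ae_eq (P : probability T R) (A B : set T) : measurable A -> measurable B ->
  {ae P, forall w, A w <-> B w} -> P A = P B.
Proof.
move=> mA mB AB.
rewrite -[A in LHS]setIT -[B in RHS]setIT -!(integral_indic P measurableT)//.
apply: ae_eq_integral => //.
- by apply: measurableT_comp => //; exact: measurable_indic.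
- by apply: measurableT_comp => //; exact: measurable_indic.
- apply: filterS AB => w [AB BA] _ /=; rewrite !indicE.
  suff -> : (w \in A) = (w \in B) by [].
  by apply/idP/idP => /set_mem h; apply/mem_set; [exact: AB|exact: BA].
Qed.

End Laws.

(** * From the square norm to square-integrable coordinates *)

Section SquareNorm.
Context {R : realType} {d : nat} {dT : measure_display} {T : measurableType dT}.
Set Implicit Arguments.
Unset Strict Implicit.
Variable P : probability T R.

Lemma measurable_sqnorm : measurable_fun setT (@sqnorm R d : Rd R d -> R).
Proof.
apply: measurable_sum => i; apply: measurable_funX; exact: coord_Rd.
Qed.

Lemma sqr_le_sqnorm (x : 'rV[R]_d) i : x 0 i ^+ 2 <= sqnorm x.
Proof. by rewrite /sqnorm (bigD1 i)//= lerDl sumr_ge0// => j _; exact: sqr_ge0. Qed.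

(** The majorant [f] accommodates the sum of two square norms that is integrated in [in_Gamma]. *)
Lemma L2_of_sqnorm (Z : T -> Rd R d) (f : T -> R) : measurable_fun setT Z ->
  (forall w, sqnorm (Z w) <= f w) -> measurable_fun setT f ->
  (\int[P]_w (f w)%:E < +oo)%E -> forall i, L2 P (fun w => Z w 0 i).
Proof.
move=> mZ Zf mf fi i.
have mZi : measurable_fun setT (fun w => Z w 0 i) := measurableT_comp (@coord_Rd R d i) mZ.
split => //; apply: (@intg_le _ _ _ P _ f).
- exact: measurable_funX.
- by move=> w; rewrite ger0_norm ?sqr_ge0// (le_trans (sqr_le_sqnorm _ _)).
- apply/integrableP; split; first exact: measurableT_comp.
  move: fi; apply: le_lt_trans; rewrite le_eqVlt; apply/orP; left; apply/eqP.
  apply: eq_integral => w _; rewrite gee0_abs// lee_fin (le_trans _ (Zf w))//.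
  by apply: sumr_ge0 => j _; exact: sqr_ge0.
Qed.

Lemma intg_sqnorm (Z : T -> Rd R d) : (forall i, L2 P (fun w => Z w 0 i)) ->
  P.-integrable setT (EFin \o (fun w => sqnorm (Z w))).
Proof. by move=> LZ; apply: intg_sum => i; exact: (LZ i).2. Qed.

End SquareNorm.

(** * Optimality and uniqueness of the map and of the plan *)

Section Main.
Context {R : realType} {d : nat} {dT : measure_display} {T : measurableType dT}.
Set Implicit Arguments.
Unset Strict Implicit.
Variables (P : probability T R) (S : 'M[R]_d) (G : set 'rV[R]_d) (Y : T -> Rd R d).
Hypotheses (ST : S^T = S) (Su : S \in unitmx) (mY : measurable_fun setT Y)
  (sqY : (\int[P]_w (sqnorm (Y w))%:E < +oo)%E) (A4Y : A4 P S Y)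
  (optG : dual_optimal P S Y G).
Local Notation Rd := (Rd R d).
Local Notation X := (Xopt S G Y).
Let mG : maximal_S_monotone S G := optG.1.

Let LY i : L2 P (fun w => Y w 0 i).
Proof.
apply: (L2_of_sqnorm mY (f := fun w => sqnorm (Y w))) => //.
exact: (measurableT_comp measurable_sqnorm mY).
Qed.

Let mX : measurable_fun setT X. Proof. exact: measurable_X mY optG. Qed.
Let LX i : L2 P (fun w => X w 0 i). Proof. exact: (L2_X ST Su mY LY A4Y optG i). Qed.
Let psi_fin := dual_finite ST Su mY LY optG.
Let valueX : map_value P S Y X = (\int[P]_w psi S G (Y w))%E.
Proof. exact: (primal_value ST Su mY LY A4Y optG). Qed.

Lemma in_calX_Xopt : in_calX P Y X.
Proof.
split; first exact: mX.
split.
  move=> A mA; exists (proj_fun S G @^-1` A); split => //.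
  by rewrite -[X in measurable X]setTI; exact: measurable_proj_fun.
split; first by rewrite -EFin_E ?ltry//; exact: intg_sqnorm.
by move=> A mA i; exact: (martingale_X ST Su mY LY A4Y optG mA i).
Qed.

(** [X] attains the dual value, so any optimal map has equality in weak duality and takes values in
    [PG S G (Y w)], almost surely a single point. *)
Lemma unique_map : unique_optimal_map P S Y X.
Proof.
have wd X' : in_calX P Y X' ->
  (map_value P S Y X' <= \int[P]_w psi S G (Y w))%E /\
  ((\int[P]_w psi S G (Y w) <= map_value P S Y X')%E ->
   {ae P, forall w, PG S G (Y w) (X' w)}).
  move=> [mX' [_ [sqX' XY']]].
  have LX' : forall i, L2 P (fun w => X' w 0 i).
    apply: (L2_of_sqnorm mX' (f := fun w => sqnorm (X' w))) => //.
    exact: (measurableT_comp measurable_sqnorm mX').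
  exact: (weak_duality ST Su mG mX' mY LX' LY XY' psi_fin).
split.
  split; first exact: in_calX_Xopt.
  by move=> X' /wd[h _]; rewrite valueX.
move=> X' [X'c X'opt]; have := X'opt _ in_calX_Xopt; rewrite valueX => /(wd _ X'c).2.
move=> PX'; apply: filterS2 PX' (ae_good ST Su mY LY A4Y optG) => w Pw [_ _ nS].
exact/esym/(proj_funP nS Pw).
Qed.

Let XY w : Rd * Rd := (X w, Y w).
Let mXY : measurable_fun setT XY. Proof. exact: measurable_fun_pair. Qed.

Let mXY_pack : {mfun T >-> (Rd * Rd)%type} := HB.pack XY (isMeasurableFun.Build _ _ _ _ XY mXY).

Definition plan : probability (Rd * Rd)%type R := distribution P mXY_pack.

Lemma planE A : plan A = P (XY @^-1` A).
Proof. by []. Qed.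

Let msq1 : measurable_fun setT (fun z : Rd * Rd => sqnorm z.1).
Proof. exact: (measurableT_comp measurable_sqnorm measurable_fst). Qed.
Let msq2 : measurable_fun setT (fun z : Rd * Rd => sqnorm z.2).
Proof. exact: (measurableT_comp measurable_sqnorm measurable_snd). Qed.

Let mS : measurable_fun setT (fun z : Rd * Rd => Sform S z.1 z.2 / 2).
Proof.
apply: measurable_funM => //; under eq_fun do rewrite Sform_sum.
apply: measurable_sum => i; apply: measurable_sum => j.
apply: measurable_funM; last exact: (measurableT_comp (@coord_Rd R d j) measurable_snd).
apply: measurable_funM => //.
exact: (measurableT_comp (@coord_Rd R d i) measurable_fst).
Qed.

Lemma in_Gamma_plan : in_Gamma P Y plan.
Proof.
split.
  rewrite (integral_law mXY (fun A _ => planE A) measurableT) /=; last first.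
    by apply: measurableT_comp => //; exact: measurable_funD.
  rewrite preimage_setT -EFin_E ?ltry//.
  by apply: intgD; exact: intg_sqnorm.
split.
  by move=> B mB; rewrite planE; congr (P _); apply/seteqP; split => w //= [].
move=> B mB i.
have mBT : measurable (B `*` setT : set (Rd * Rd)) by exact: measurableX.
have eB : XY @^-1` (B `*` setT) = X @^-1` B by apply/seteqP; split => w //= [].
rewrite !(integral_law mXY (fun A _ => planE A) mBT) ?eB /=.
- exact: (martingale_X ST Su mY LY A4Y optG mB i).
- by apply: measurableT_comp => //; exact: (measurableT_comp (@coord_Rd R d i) measurable_fst).
- by apply: measurableT_comp => //; exact: (measurableT_comp (@coord_Rd R d i) measurable_snd).
Qed.

Lemma plan_valueE : plan_value S plan = (\int[P]_w psi S G (Y w))%E.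
Proof.
rewrite -valueX /plan_value (integral_law mXY (fun A _ => planE A) measurableT) ?preimage_setT//.
exact: measurableT_comp.
Qed.

(** A plan is the law of the coordinate pair on the probability space [Rd * Rd], so weak duality
    applies with [fst] and [snd] in place of [X] and [Y]. *)
Lemma plan_weak_duality (g : probability (Rd * Rd)%type R) : in_Gamma P Y g ->
  (plan_value S g <= \int[P]_w psi S G (Y w))%E /\
  ((\int[P]_w psi S G (Y w) <= plan_value S g)%E ->
   {ae g, forall z, PG S G z.2 z.1}).
Proof.
move=> [sqg [lawg mart]].
have mfst : measurable_fun setT (fst : Rd * Rd -> Rd) := measurable_fst.
have msnd : measurable_fun setT (snd : Rd * Rd -> Rd) := measurable_snd.
have L1 : forall i, L2 g (fun z => z.1 0 i).
  apply: (L2_of_sqnorm mfst _ _ sqg); last exact: measurable_funD.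
  by move=> z; rewrite lerDl; apply: sumr_ge0 => j _; exact: sqr_ge0.
have L2' : forall i, L2 g (fun z => z.2 0 i).
  apply: (L2_of_sqnorm msnd _ _ sqg); last exact: measurable_funD.
  by move=> z; rewrite lerDr; apply: sumr_ge0 => j _; exact: sqr_ge0.
have e : (\int[g]_z psi S G z.2 = \int[P]_w psi S G (Y w))%E.
  have law2 (A : set Rd) : measurable A -> pushforward g snd A = P (Y @^-1` A).
    by move=> mA; rewrite -lawg// /pushforward; congr (g _); apply/seteqP; split => z //= [].
  have mpsi := @psi_Rd R d S G.
  have h1 := @integral_law _ _ _ _ _ g (pushforward g snd) snd setT _ msnd (fun _ _ => erefl) measurableT mpsi.
  have h2 := @integral_law _ _ _ _ _ P (pushforward g snd) Y setT _ mY law2 measurableT mpsi.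
  by rewrite preimage_setT in h1; rewrite preimage_setT in h2; rewrite -h1 h2.
rewrite -e; apply: (weak_duality ST Su mG mfst msnd L1 L2').
  move=> A mA i; have := mart A mA i.
  have -> : A `*` setT = (fst : Rd * Rd -> Rd) @^-1` A by apply/seteqP; split => z //= [].
  by [].
by rewrite e.
Qed.

(** An optimal plan is carried by the graph of [proj_fun], so [g A] is the mass of [B] under the
    second marginal, which is prescribed. *)
Lemma unique_plan : unique_optimal_plan P S Y plan.
Proof.
split.
  split; first exact: in_Gamma_plan.
  by move=> g /plan_weak_duality[h _]; rewrite plan_valueE.
move=> g [gG gopt] A mA; have := gopt _ in_Gamma_plan.
rewrite plan_valueE => /(plan_weak_duality gG).2 aePG.
have [_ [lawg _]] := gG.
have mSig := measurable_Sigma mG.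
have nS : {ae g, forall z, ~ Sigma S G z.2}.
  apply: negligible_ae; exists (setT `*` Sigma S G); split.
  - exact: measurableX.
  - have mYS : measurable (Y @^-1` Sigma S G) by rewrite -[X in measurable X]setTI; exact: mY.
    by rewrite lawg//; exact: (measure_negligible mYS (negligible_Sigma A4Y mG)).
  - by move=> z /=.
pose B : set Rd := [set y | A (proj_fun S G y, y)].
have mB : measurable B.
  have mf : measurable_fun setT (fun y : Rd => (proj_fun S G y, y)).
    by apply: measurable_fun_pair => //; exact: measurable_proj_fun mG.
  by rewrite -[B]setTI; exact: mf.
rewrite (@measure_ae_eq _ _ _ g A (setT `*` B))//; last first.
  - apply: ae_imply2 aePG nS => z Pz nSz; rewrite /B /= (proj_funP nSz Pz).
    by case: z {Pz nSz} => z1 z2; split => //= -[].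
  - exact: measurableX.
by rewrite lawg.
Qed.

End Main.

Theorem theorem7 (R : realType) (d m : nat) (S : 'M[R]_d)
  (dT : measure_display) (T : measurableType dT) (P : probability T R)
  (Y : T -> Rd R d) :
  in_SSdm m S ->
  measurable_fun setT Y -> (\int[P]_w (sqnorm (Y w))%:E < +oo)%E ->
  interior (conv_hull (supp P Y)) !=set0 ->
  A4 P S Y ->
  (forall G : set 'rV[R]_d, maximal_S_monotone S G ->
     (\int[P]_w psi S G (Y w) < +oo)%E ->
     P.-negligible (Y @^-1` Sigma S G)) /\
  (forall G : set 'rV[R]_d, dual_optimal P S Y G ->
     unique_optimal_map P S Y (Xopt S G Y) /\
     exists g : probability (Rd R d * Rd R d)%type R,
       (forall A : set (Rd R d * Rd R d)%type, measurable A ->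
          g A = P ((fun w => (Xopt S G Y w, Y w)) @^-1` A)) /\
       unique_optimal_plan P S Y g).
Proof.
move=> [ST [Su _]] mY sqY _ A4Y; split=> [G mG _|G optG].
  exact: (negligible_Sigma A4Y mG).
split; first exact: unique_map.
exists (plan mY optG); split; last exact: unique_plan.
by move=> A _; rewrite planE.
Qed.
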